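(* Let $\lambda\in\mathbb{R}_+=[0,\infty)$, and let the processes $(\mathrm{w}_t)_{t\ge 0}$, $(\mathrm{m}_{\lambda,t})_{t\ge 0}$, $(\mathrm{w}_{\lambda,t})_{t\ge 0}$, the fundamental solutions $\mathrm{w}^0_t,\mathrm{m}^0_{\lambda,t},\mathrm{w}^0_{\lambda,t}$, and the measure $\mathrm{d}=\frac12(\delta_{-1}+\delta_1)$ be as in the context. (i) Provided that $\mathrm{w}_{\lambda,0}=\mathrm{m}_{\lambda,0}^{\mathbf{s}}$ (the symmetrization of $\mathrm{m}_{\lambda,0}$), the following equality holds: $$S_{\mathrm{w}_{\lambda,t}}(z)=S_{\mathrm{d}}(z)\sqrt{S_{\mathrm{m}_{\lambda,t}}(z)},\qquad t\ge0.$$ (ii) Assume that the $S$-transform $S_{\mathrm{w}_0}(z)$ of the initial probability measure is well defined. Then, for $t\ge0$, $$\frac{S_{\mathrm{w}_t}(z)}{1-\big(S_{\mathrm{w}_t}(z)/S_{\mathrm{w}^0_t}(z)\big)^2}=S_{\mathrm{w}_0}\Big(z\big\{1-\big(S_{\mathrm{w}_t}(z)/S_{\mathrm{w}^0_t}(z)\big)^2\big\}\Big).$$ (iii) Assume that the $S$-transform $S_{\mathrm{m}_{\lambda,0}}(z)$ of the initial measure is well defined. Then, for $t\ge0$, $$\frac{S_{\mathrm{m}_{\lambda,t}}(z)}{\big\{1-S_{\mathrm{m}_{\lambda,t}}(z)/S_{\mathrm{w}^0_t}(z)^2\big\}\big\{1-S_{\mathrm{m}_{\lambda,t}}(z)/S_{\mathrm{m}^0_{\lambda,t}}(z)\big\}}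 =S_{\mathrm{m}_{\lambda,0}}\Big(z\big\{1-S_{\mathrm{m}_{\lambda,t}}(z)/S_{\mathrm{m}^0_{\lambda,t}}(z)\big\}\Big).$$ (iv) Assume that the $S$-transform $S_{\mathrm{w}_{\lambda,0}}(z)$ of the initial measure is well defined. Then, for $t\ge0$, $$\sqrt{\frac{1-\frac{z}{1+z}\big(S_{\mathrm{w}_{\lambda,t}}(z)/S_{\mathrm{w}^0_{\lambda,t}}(z)\big)^2}{1-\frac{z}{1+z}\big(S_{\mathrm{w}_{\lambda,t}}(z)/S_{\mathrm{w}^0_t}(z)\big)^2}}\; \frac{S_{\mathrm{w}_{\lambda,t}}(z)}{1-\big(S_{\mathrm{w}_{\lambda,t}}(z)/S_{\mathrm{w}^0_{\lambda,t}}(z)\big)^2} =S_{\mathrm{w}_{\lambda,0}}\Big(z\big\{1-\big(S_{\mathrm{w}_{\lambda,t}}(z)/S_{\mathrm{w}^0_{\lambda,t}}(z)\big)^2\big\}\Big).$$ Since $\mathrm{w}_{1,t}=\mathrm{w}_t$, for $\lambda=1$ this equality reduces to the equality in (ii).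
   Context: For $S=\mathbb{R}$ or $\mathbb{R}_+$, $\mathcal{P}^0(S)$ is the set of Borel probability measures on $S$ with bounded support, with the weak topology; $\mathcal{P}^0_{\mathrm{s}}(\mathbb{R})$ is the set of symmetric elements of $\mathcal{P}^0(\mathbb{R})$. $\mathbb{C}^\pm=\{\pm\operatorname{Im}z>0\}$. The Cauchy transform of $\mu\in\mathcal{P}^0(S)$ is $G_\mu(z)=\int_S\frac{\mu(dx)}{z-x}$. Processes: each of the following is a continuous process in $t\in[0,\infty)$ whose Cauchy transforms are a solution, for $t\ge0$ and $z\in\mathbb{C}^+$, of the indicated PDE with initial datum the Cauchy transform of the given initial measure (the initial measures having bounded support). - $(\mathrm{w}_t)_{t\ge0}$, values in $\mathcal{P}^0(\mathbb{R})$: $$\frac{\partial G_{\mathrm{w}_t}(z)}{\partial t}+G_{\mathrm{w}_t}(z)\frac{\partial G_{\mathrm{w}_t}(z)}{\partial z}=0.$$ - $(\mathrm{m}_{\lambda,t})_{t\ge0}$, values in $\mathcal{P}^0(\mathbb{R}_+)$: $$\frac{\partial G_{\mathrm{m}_{\lambda,t}}(z)}{\partial t}+\{2zG_{\mathrm{m}_{\lambda,t}}(z)-(1-\lambda)\}\frac{\partial G_{\mathrm{m}_{\lambda,t}}(z)}{\partial z}+G_{\mathrm{m}_{\lambda,t}}(z)^2=0.$$ - $(\mathrm{w}_{\lambda,t})_{t\ge0}$, values in $\mathcal{P}^0_{\mathrm{s}}(\mathbb{R})$: $$\frac{\partial G_{\mathrm{w}_{\lambda,t}}(z)}{\partial t}+\Big(G_{\mathrm{w}_{\lambda,t}}(z)-\frac{1-\lambda}{2z}\Big)\frac{\partial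 G_{\mathrm{w}_{\lambda,t}}(z)}{\partial z}+\frac{1-\lambda}{2z^2}G_{\mathrm{w}_{\lambda,t}}(z)=0.$$ Let $\mu^{(2)}$ denote the push-forward of $\mu$ under $x\mapsto|x|^2$. The processes are related by $\mathrm{m}_{\lambda,t}=\mathrm{w}_{\lambda,t}^{(2)}$ for all $t\ge0$ when the initial measures match, i.e. $\mathrm{m}_{\lambda,0}=\mathrm{w}_{\lambda,0}^{(2)}$. The symmetrization $\mu^{\mathbf{s}}$ of $\mu\in\mathcal{P}^0(\mathbb{R}_+)$ is the unique element of $\mathcal{P}^0_{\mathrm{s}}(\mathbb{R})$ with $\int_{\mathbb{R}} f(x^2)\mu^{\mathbf{s}}(dx)=\int f(x)\mu(dx)$ for all compactly supported continuous $f$, i.e. $(\mu^{\mathbf{s}})^{(2)}=\mu$. $S$-transform: let $\Psi_\mu(z)=\int\frac{xz}{1-xz}\mu(dx)$. If $\mu\in\mathcal{P}^0(\mathbb{R}_+)$ with $\mu(\{0\})<1$, $\Psi_\mu$ has a unique inverse $\chi_\mu$ on the left half-plane $\sqrt{-1}\,\mathbb{C}^+$, and $S_\mu(z)=\frac{1+z}{z}\chi_\mu(z)$, $z\in\Psi_\mu(\sqrt{-1}\,\mathbb{C}^+)$. If $\mu\in\mathcal{P}^0_{\mathrm{s}}(\mathbb{R})$ with $\mu(\{0\})<1$, $\Psi_\mu$ has a unique inverse $\chi_\mu:\Psi_\mu(H)\to H$ on $H=\{z\in\mathbb{C}^-:|\operatorname{Re}z|<|\operatorname{Im}z|\}$ and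 a unique inverse $\widetilde\chi_\mu:\Psi_\mu(\widetilde H)\to\widetilde H$ on $\widetilde H=\{z\in\mathbb{C}^+:|\operatorname{Re}z|<|\operatorname{Im}z|\}$, giving two $S$-transforms $S_\mu(z)=\frac{1+z}{z}\chi_\mu(z)$ and $\widetilde S_\mu(z)=\frac{1+z}{z}\widetilde\chi_\mu(z)$; $S_\mu$ denotes the former. In general, the $S$-transform is said to be well defined when $\Psi_\mu$ has such a compositional inverse $\chi_\mu$, and then $S_\mu(z)=\frac{1+z}{z}\chi_\mu(z)$. Identities between $S$-transforms are identities of analytic functions on the common domain of definition (near $z=0$), at those $t$ for which the $S$-transforms occurring are defined. Here $S_{\mathrm{d}}(z)=\sqrt{(1+z)/z}$. In (i), $\sqrt{S_{\mathrm{m}_{\lambda,t}}}$ is the branch that is positive for $z\in(\mathrm{m}_{\lambda,t}(\{0\})-1,0)$. In (iv), the square-root factor is the branch tending to $1$ as $z\to0$. A superscript $0$ denotes the process started from $\delta_0$; its $S$-transforms are $S_{\mathrm{w}^0_t}(z)=\sqrt{1/(tz)}$, $S_{\mathrm{m}^0_{\lambda,t}}(z)=\frac{1}{t(z+\lambda)}$, and $S_{\mathrm{w}^0_{\lambda,t}}(z)=\sqrt{\frac{1+z}{z}\cdot\frac{1}{t(z+\lambda)}}$. In the formulas, $1/S_{\mathrm{w}^0_t}(z)^2$, $1/S_{\mathrm{m}^0_{\lambda,t}}(z)$ and $1/S_{\mathrm{w}^0_{\lambda,t}}(z)^2$ stand for $tz$, $t(z+\lambda)$ and $\frac{t z(z+\lambda)}{1+z}$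 respectively (so they vanish at $t=0$). *)

(* Defs.v *)
From HB Require Import structures.
From mathcomp Require Import all_boot all_order all_algebra.
From mathcomp Require Import complex.
From mathcomp Require Import all_classical all_reals all_analysis.
Import Order.TTheory GRing.Theory Num.Theory numFieldNormedType.Exports.
Set Implicit Arguments.
Unset Strict Implicit.
Unset Printing Implicit Defensive.

Local Open Scope classical_set_scope.
Local Open Scope ring_scope.
Local Open Scope complex_scope.

(* The library equips an abstract numClosedFieldType with the topology of its
   norm, but does not find these structures on [complex R] itself. *)
Section ComplexTopology.
Variable R : realType.
HB.instance Definition _ := NormedModule.copy R[i] R[i]^o.
End ComplexTopology.

Section Transforms.
Variable R : realType.
Implicit Types (mu : {measure set R -> \bar R}) (U : set R[i]) (z : R[i]).

Definition cintegral mu (f : R -> R[i]) : R[i] :=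
  (\int[mu]_x complex.Re (f x)) +i* (\int[mu]_x complex.Im (f x)).

Definition cauchy mu z : R[i] := cintegral mu (fun x => (z - x%:C)^-1).

Definition Psi mu z : R[i] :=
  cintegral mu (fun x => x%:C * z / (1 - x%:C * z)).

Definition upper_half : set R[i] := [set z | 0 < complex.Im z].

(* sqrt(-1) times the upper half-plane *)
Definition left_half : set R[i] := [set z | complex.Re z < 0].

Definition Hcone : set R[i] :=
  [set z | complex.Im z < 0 /\ `|complex.Re z| < `|complex.Im z|].

(* chi_mu, the inverse of Psi_mu : U -> Psi_mu(U). *)
Definition chi mu U : R[i] -> R[i] := 'pinv_(fun=> 0) U (Psi mu).

Definition Sdom mu U : set R[i] := Psi mu @` U.

(* Meaningful on [Sdom mu U] when Psi_mu is injective on U. *)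
Definition Strans mu U z : R[i] := (1 + z) / z * chi mu U z.

(* A general measure on the line has no canonical region such as [left_half]
   or [Hcone]: Psi_mu is inverted on some region U reaching 0, the inverse being
   normalized by chi_mu(z) --> 0 as z --> 0. For [left_half] and measures on
   the half-line, and for [Hcone] and symmetric measures, this normalization
   holds as soon as mu <> delta_0. *)
Definition S_well_defined mu U : Prop :=
  [/\ open U, closure U 0, set_inj U (Psi mu) &
      chi mu U z @[z --> within (Sdom mu U) 0^'] --> (0 : R[i])].

(* Open sector with axis u and half-opening arctan k; [Hcone] is
   [sector (- 'i) 1]. *)
Definition sector (u : R[i]) (k : R) : set R[i] :=
  [set z | `|complex.Im (z / u)| < k * complex.Re (z / u)].

(* When the mean is nonzero, Psi_mu is invertible in a neighbourhood of 0 and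
   the inverse is unique. When it vanishes, Psi_mu is two-to-one near 0; the
   inverse involves a choice of square root, which is made by the sector. *)
Definition same_branch mu (U U' : set R[i]) : Prop :=
  \int[mu]_x x != 0 \/
  exists u k, [/\ u != 0, 0 < k, U `<=` sector u k & U' `<=` sector u k].

(* d = (delta_{-1} + delta_1) / 2 *)
Definition dmeas : {measure set R -> \bar R} :=
  mscale (2^-1)%:nng (measure_add \d_(-1 : R) \d_(1 : R)).

(* 1 / S_{w^0_t}(z)^2, 1 / S_{m^0_{lam,t}}(z) and 1 / S_{w^0_{lam,t}}(z)^2,
   S_{w^0_t}(z) = sqrt(1 / (t z)), S_{m^0_{lam,t}}(z) = 1 / (t (z + lam)) and
   S_{w^0_{lam,t}}(z) = sqrt((1 + z) / z / (t (z + lam))) being the S-transforms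
   of the processes started from delta_0. *)
Definition inv_Sw0_sq (t : R) z : R[i] := t%:C * z.
Definition inv_Sm0 (lam t : R) z : R[i] := t%:C * (z + lam%:C).
Definition inv_Swl0_sq (lam t : R) z : R[i] :=
  t%:C * z * (z + lam%:C) / (1 + z).

End Transforms.
Arguments upper_half {R}.
Arguments left_half {R}.
Arguments Hcone {R}.
Arguments dmeas {R}.

Section Processes.
Variable R : realType.
Implicit Types mu nu : probability R R.

Definition bounded_support mu : Prop := exists M : R, mu (~` `[- M, M]%classic) = 0%E.

Definition on_halfline mu : Prop := mu `]-oo, 0[%classic = 0%E.

Definition symmetric_law mu : Prop :=
  forall A, measurable A -> pushforward mu -%R A = mu A.

Definition is_symmetrization mu nu : Prop :=
  [/\ bounded_support nu, symmetric_law nu &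
      forall A, measurable A -> pushforward nu (fun x => `|x| ^+ 2) A = mu A].

Definition weakly_continuous (mu : R -> probability R R) : Prop :=
  forall f : R -> R, continuous f -> bounded_fun f ->
    {within `[0, +oo[%classic, continuous (fun t => \int[mu t]_x f x)}.

(* One-sided at t = 0. *)
Definition is_time_derivative (f : R -> R[i]) (t : R) (l : R[i]) : Prop :=
  (h^-1)%:C * (f (t + h) - f t) @[h --> within [set h | 0 <= t + h] 0^'] --> l.

(* dG/dt + a(z, G) dG/dz + b(z, G) = 0 *)
Definition solves_pde (a b : R[i] -> R[i] -> R[i]) (G : R -> R[i] -> R[i]) :=
  forall (t : R) (z : R[i]), 0 <= t -> upper_half z ->
  exists dt dz : R[i],
    [/\ is_time_derivative (fun s => G s z) t dt,
        is_derive z 1 (G t) dz &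
        dt + a z (G t z) * dz + b z (G t z) = 0].

Definition w_process (w : R -> probability R R) : Prop :=
  [/\ forall t, 0 <= t -> bounded_support (w t),
      weakly_continuous w &
      solves_pde (fun _ g => g) (fun _ _ => 0) (fun t => cauchy (w t))].

Definition m_process (lam : R) (m : R -> probability R R) : Prop :=
  [/\ forall t, 0 <= t -> bounded_support (m t) /\ on_halfline (m t),
      weakly_continuous m &
      solves_pde (fun z g => 2 * z * g - (1 - lam)%:C) (fun _ g => g ^+ 2)
                 (fun t => cauchy (m t))].

Definition wl_process (lam : R) (wl : R -> probability R R) : Prop :=
  [/\ forall t, 0 <= t -> bounded_support (wl t) /\ symmetric_law (wl t),
      weakly_continuous wl &
      solves_pde (fun z g => g - (1 - lam)%:C / (2 * z))
                 (fun z g => (1 - lam)%:C / (2 * z ^+ 2) * g)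
                 (fun t => cauchy (wl t))].

End Processes.

(* Main.v *)
(** Along its characteristics each equation becomes explicit: for [w_t] the
    Cauchy transform is constant on straight lines, and for [m_t] it is
    [g / (1 - g (t - s))] on a curve quadratic in [s]. A Gronwall estimate
    replaces the uniqueness theory of the equation: a process takes these values
    all along the characteristic as soon as it does at one point. Read at
    [1 / a], this transports [Psi] at time [t] near 0 to [Psi] at time 0, and the
    identities follow once the transported point is recognized as [chi] at time
    0, by injectivity of [Psi] on the half-plane, near 0 when the mean does not
    vanish, or else on one side of 0. Squaring maps the symmetric process [w_lam]
    to a solution of the equation of [m_lam], which reduces (iv) to (iii). The
    same characteristics show that two solutions with the same initial datum have
    the same transform near infinity, hence the same moments and, the supports
    being bounded, the same laws. *)

Require Import Defs.
From HB Require Import structures.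
From mathcomp Require Import all_boot all_order all_algebra.
From mathcomp Require Import complex.
From mathcomp Require Import all_classical all_reals all_analysis.
From mathcomp Require Import measurable_realfun ring lra.
Import Order.TTheory GRing.Theory Num.Theory numFieldNormedType.Exports.

Set Implicit Arguments.
Unset Strict Implicit.
Unset Printing Implicit Defensive.

Local Open Scope classical_set_scope.
Local Open Scope ring_scope.
Local Open Scope complex_scope.

(* [Re] and [Im] alone are those of [numClosedFieldType]. *)
Local Notation Re := complex.Re.
Local Notation Im := complex.Im.

(** It is recovered from a Taylor estimate in space, whose constant depends only on the distance to
    the real axis and thus serves at all times although the supports need not be uniformly bounded,
    and from weak continuity, which makes the space derivative continuous in time. A characteristic
    is built backwards from the value at time [t] and must stay in the upper half-plane: for [w] it
    always does, for [m] this is shown only far from the origin. Far from the origin means [a] near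
    0; real [a] and [a] in the upper half-plane are then reached by continuity and conjugation. The
    transported point need not lie in the region where [chi] at time 0 takes its values: it is
    identified because both points are small, whence the quantitative bounds on [Psi], and the
    second moment when the mean vanishes. In (iv) the square root is defined as the factor that
    makes the identity true; what remains to prove is its square and its limit. *)

Section Modulus.
Context {R : realType}.
Implicit Types (z w : R[i]) (x : R).

(** The norm of [R[i]] takes its values in [R[i]]; a modulus with values in [R] gives access to a
    total order and to [lra]. *)
Definition cabs z : R := Normc.normc z.

Lemma cabsE z : cabs z = Num.sqrt (Re z ^+ 2 + Im z ^+ 2).
Proof. by case: z. Qed.

Lemma norm_cabs z : `|z| = (cabs z)%:C.
Proof. by rewrite normc_def cabsE. Qed.

Lemma cabs_ge0 z : 0 <= cabs z.
Proof. by rewrite cabsE sqrtr_ge0. Qed.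

Lemma cabsM z w : cabs (z * w) = cabs z * cabs w.
Proof. exact: Normc.normcM. Qed.

Lemma cabsV z : cabs z^-1 = (cabs z)^-1.
Proof. exact: Normc.normcV. Qed.

Lemma cabsD z w : cabs (z + w) <= cabs z + cabs w.
Proof. exact: le_normcD. Qed.

Lemma cabsN z : cabs (- z) = cabs z.
Proof. exact: normcN. Qed.

Lemma cabsB z w : cabs (z - w) <= cabs z + cabs w.
Proof. by rewrite -(cabsN w) cabsD. Qed.

Lemma cabsBC z w : cabs (z - w) = cabs (w - z).
Proof. by rewrite -cabsN opprB. Qed.

Lemma cabs_triB z w : cabs z - cabs w <= cabs (z - w).
Proof. by rewrite lerBlDr (le_trans _ (cabsD _ _))// subrK. Qed.

Lemma cabs0 : cabs 0 = 0.
Proof. exact: Normc.normc0. Qed.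

Lemma cabs1 : cabs 1 = 1.
Proof. exact: Normc.normc1. Qed.

Lemma cabsX z n : cabs (z ^+ n) = cabs z ^+ n.
Proof. by elim: n => [|n ih]; rewrite ?expr0 ?cabs1// !exprS cabsM ih. Qed.

Lemma cabsr x : cabs x%:C = `|x|.
Proof. by rewrite cabsE/= expr0n/= addr0 sqrtr_sqr. Qed.

Lemma cabs_eq0 z : (cabs z == 0) = (z == 0).
Proof.
by apply/idP/idP => [/eqP/Normc.eq0_normc->//|/eqP->]; rewrite cabs0.
Qed.

Lemma cabs_gt0 z : (0 < cabs z) = (z != 0).
Proof. by rewrite lt_neqAle cabs_ge0 andbT eq_sym cabs_eq0. Qed.

Lemma cabs_sqr z : cabs z ^+ 2 = Re z ^+ 2 + Im z ^+ 2.
Proof. by rewrite cabsE sqr_sqrtr// addr_ge0 ?sqr_ge0. Qed.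

Lemma cabs_Re z : `|Re z| <= cabs z.
Proof. by rewrite cabsE -sqrtr_sqr ler_wsqrtr// lerDl sqr_ge0. Qed.

Lemma cabs_Im z : `|Im z| <= cabs z.
Proof. by rewrite cabsE -sqrtr_sqr ler_wsqrtr// lerDr sqr_ge0. Qed.

Lemma cabs_le z : cabs z <= `|Re z| + `|Im z|.
Proof.
have h : 0 <= `|Re z| + `|Im z| by rewrite addr_ge0.
rewrite -(ler_pXn2r (n := 2)) ?nnegrE ?cabs_ge0// cabs_sqr sqrrD.
rewrite !real_normK ?num_real//.
have := mulr_ge0 (normr_ge0 (Re z)) (normr_ge0 (Im z)).
lra.
Qed.

Lemma ReD z w : Re (z + w) = Re z + Re w.
Proof. by case: z; case: w. Qed.
Lemma ImD z w : Im (z + w) = Im z + Im w.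
Proof. by case: z; case: w. Qed.
Lemma ReN z : Re (- z) = - Re z.
Proof. by case: z. Qed.
Lemma ImN z : Im (- z) = - Im z.
Proof. by case: z. Qed.
Lemma ReM z w : Re (z * w) =
  Re z * Re w - Im z * Im w.
Proof. by case: z; case: w. Qed.
Lemma ImM z w : Im (z * w) =
  Re z * Im w + Im z * Re w.
Proof. by case: z; case: w. Qed.
Lemma ReV z : Re z^-1 = Re z / cabs z ^+ 2.
Proof. by rewrite cabs_sqr; case: z. Qed.
Lemma ImV z : Im z^-1 = - Im z / cabs z ^+ 2.
Proof. by rewrite cabs_sqr mulNr; case: z. Qed.

Lemma RerM x z : Re (x%:C * z) = x * Re z.
Proof. by rewrite ReM/= mul0r subr0. Qed.
Lemma ImrM x z : Im (x%:C * z) = x * Im z.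
Proof. by rewrite ImM/= mul0r addr0. Qed.

Lemma complex_eqP z w :
  Re z = Re w -> Im z = Im w -> z = w.
Proof. by case: z => a b; case: w => c d /= -> ->. Qed.

End Modulus.

(** * Limits and derivatives over [R[i]] in terms of the real modulus *)

Section Topology.
Context {R : realType}.
Implicit Types (f : R[i] -> R[i]) (z w l : R[i]) (A : set R[i]).

Lemma nbhs_cabsP z A :
  nbhs z A <-> exists2 e : R, 0 < e & forall w, cabs (z - w) < e -> A w.
Proof.
split.
- move=> /nbhs_ballP[e /=]; rewrite ltcE/= => /andP[/eqP e0 epos] eA.
  exists (Re e) => // w wz; apply: eA => /=.
  rewrite /ball/=  /ball_/= norm_cabs ltcE/= wz andbT.
  exact/eqP.
- move=> [e e0 eA]; apply/nbhs_ballP; exists e%:C => /=; first by rewrite ltcR.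
  move=> w /=; rewrite /ball/= norm_cabs ltcR; exact: eA.
Qed.

Lemma near_punctured z (P : R[i] -> Prop) (e : R) : 0 < e ->
  (forall w, w != z -> cabs (z - w) < e -> P w) -> \forall w \near z^', P w.
Proof.
move=> e0 eP; rewrite /dnbhs/= near_withinE; apply/nbhs_cabsP.
by exists e => // w wz /= neq; apply: eP.
Qed.

Lemma cvg_cabsP T (F : set_system T) (FF : Filter F) (f : T -> R[i]) l :
  f @ F --> l <-> forall e : R, 0 < e -> \forall x \near F, cabs (l - f x) < e.
Proof.
split.
- move=> fl e e0; have := fl [set w | cabs (l - w) < e]; apply.
  by apply/nbhs_cabsP; exists e.
- move=> H A /nbhs_cabsP[e e0 eA].
  rewrite /fmap/nbhs/=. apply: filterS (H e e0) => x; exact: eA.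
Qed.

Lemma cvg_withinP A z (f : R[i] -> R[i]) l :
  f w @[w --> within A z^'] --> l <->
  forall e : R, 0 < e -> exists2 d : R, 0 < d &
    forall w, w != z -> A w -> cabs (z - w) < d -> cabs (l - f w) < e.
Proof.
split.
- move=> /cvg_cabsP H e e0; have /= := H e e0.
  rewrite near_withinE /dnbhs near_withinE => /nbhs_cabsP[d d0 dH].
  by exists d => // w wz Aw zw; apply: dH.
- move=> H; apply/cvg_cabsP => e e0; have [d d0 dH] := H e e0.
  rewrite near_withinE /dnbhs near_withinE; apply/nbhs_cabsP.
  by exists d => // w wz /= neq Aw; apply: dH.
Qed.

Lemma within_continuousP A (f : R[i] -> R[i]) :
  (forall z, A z -> forall e : R, 0 < e -> exists2 d : R, 0 < d &
    forall w, A w -> cabs (z - w) < d -> cabs (f z - f w) < e) ->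
  {within A, continuous f}.
Proof.
move=> H; apply/subspace_continuousP => z Az; apply/cvg_cabsP => e e0.
have [d d0 dH] := H z Az e e0.
rewrite near_withinE; apply/nbhs_cabsP.
by exists d => // w wz Aw; apply: dH.
Qed.

Lemma closure_cabsP z A : closure A z ->
  forall e : R, 0 < e -> exists2 w, A w & cabs (z - w) < e.
Proof.
move=> cA e e0; have [|w [Aw we]] := cA [set w | cabs (z - w) < e].
  by apply/nbhs_cabsP; exists e.
by exists w.
Qed.

Lemma time_derivativeP (f : R -> R[i]) (t : R) l :
  is_time_derivative f t l ->
  forall e : R, 0 < e -> exists2 d : R, 0 < d &
    forall h : R, `|h| < d -> 0 <= t + h ->
      cabs (f (t + h) - f t - h%:C * l) <= e * `|h|.
Proof.
move=> /cvg_cabsP H e e0; have /= := H e e0.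
rewrite near_withinE /dnbhs near_withinE => /nbhs_ballP[d /= d0 dH].
exists d => // h hd th; have [->|h0] := eqVneq h 0.
  by rewrite addr0 subrr mul0r subr0 cabs0 normr0 mulr0.
have hC : h%:C != 0 by apply/eqP => -[] /eqP; rewrite (negbTE h0).
have := dH h; rewrite /ball/= sub0r normrN => /(_ hd h0 th) /ltW K.
rewrite (_ : _ - _ = - h%:C * (l - (h^-1)%:C * (f (t + h) - f t))).
  by rewrite cabsM cabsN cabsr mulrC ler_wpM2r.
rewrite fmorphV/=; by field.
Qed.

Lemma is_deriveP (f : R[i] -> R[i]) z (l : R[i]) :
  is_derive z 1 f l ->
  forall e : R, 0 < e -> exists2 d : R, 0 < d &
    forall h : R[i], cabs h < d ->
      cabs (f (z + h) - f z - h * l) <= e * cabs h.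
Proof.
move=> [H1 H2] e e0; move: H1; rewrite /derivable => H1.
have : h^-1 *: ((f \o shift z) (h *: 1) - f z) @[h --> 0^'] --> l.
  by rewrite -H2.
move=> /cvg_cabsP/(_ e e0) /=.
rewrite /dnbhs near_withinE => /nbhs_cabsP[d /= d0 dH].
exists d => // h hd; have [->|h0] := eqVneq h 0.
  by rewrite addr0 subrr mul0r subr0 cabs0 mulr0.
have := dH h; rewrite sub0r cabsN => /(_ hd h0) /ltW K.
rewrite (_ : _ - _ = - h * (l - h^-1 * (f (z + h) - f z))).
  rewrite cabsM cabsN mulrC ler_wpM2r ?cabs_ge0//.
  apply: le_trans K. rewrite (_ : h *: 1 = h); last exact: mulr1.
  by rewrite /= (addrC h).
by field.
Qed.

Lemma cabs_small z : (forall e : R, 0 < e -> cabs z < e) -> z = 0.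
Proof.
move=> H; apply/eqP; rewrite -cabs_eq0 eq_le cabs_ge0 andbT.
by apply/ler_addgt0Pl => e e0; rewrite addr0; exact/ltW/H.
Qed.

End Topology.

(** * Measurability of complex-valued functions *)

Section ComplexMeasurable.
Context {R : realType}.
Implicit Types (f g : R -> R[i]) (M : R).

(** Inversion is continuous only off 0, where it takes the default value 0; the line is cut
    there. *)
Lemma measurable_inv : measurable_fun [set: R] (@GRing.inv R).
Proof.
have -> : [set: R] = [set x | x != 0] `|` [set 0].
  by apply/seteqP; split => // x _ /=; case: (eqVneq x 0) => [->|]; [right|left].
have o : open [set x : R | x != 0].
  by apply: open_neq.
apply/measurable_funU => //; first exact: open_measurable.
split; last exact: measurable_fun_set1.
apply: open_continuous_measurable_fun => // x; rewrite inE/= => x0.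
exact: inv_continuous.
Qed.

Definition cmeasurable f :=
  measurable_fun [set: R] (fun x => Re (f x)) /\
  measurable_fun [set: R] (fun x => Im (f x)).

Lemma cmeasurable_cst (c : R[i]) : cmeasurable (fun=> c).
Proof. by split; exact: measurable_cst. Qed.

Lemma cmeasurable_real (f : R -> R) : measurable_fun [set: R] f ->
  cmeasurable (fun x => (f x)%:C).
Proof. by split => //; exact: measurable_cst. Qed.

Lemma cmeasurable_id : cmeasurable (fun x => x%:C).
Proof. exact: cmeasurable_real. Qed.

Lemma cmeasurableN f : cmeasurable f -> cmeasurable (fun x => - f x).
Proof.
move=> [f1 f2]; split.
- by under eq_fun do rewrite ReN; exact: measurable_funN.
- by under eq_fun do rewrite ImN; exact: measurable_funN.
Qed.

Lemma cmeasurableD f g : cmeasurable f -> cmeasurable g ->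
  cmeasurable (fun x => f x + g x).
Proof.
move=> [f1 f2] [g1 g2]; split.
- by under eq_fun do rewrite ReD; exact: measurable_funD.
- by under eq_fun do rewrite ImD; exact: measurable_funD.
Qed.

Lemma cmeasurableB f g : cmeasurable f -> cmeasurable g ->
  cmeasurable (fun x => f x - g x).
Proof. by move=> mf mg; apply: cmeasurableD => //; exact: cmeasurableN. Qed.

Lemma cmeasurableM f g : cmeasurable f -> cmeasurable g ->
  cmeasurable (fun x => f x * g x).
Proof.
move=> [f1 f2] [g1 g2]; split.
- under eq_fun do rewrite ReM.
  by apply: measurable_funB; exact: measurable_funM.
- under eq_fun do rewrite ImM.
  by apply: measurable_funD; exact: measurable_funM.
Qed.

Lemma cmeasurableX f n : cmeasurable f -> cmeasurable (fun x => f x ^+ n).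
Proof.
move=> mf; elim: n => [|n ih]; first exact: cmeasurable_cst.
by under eq_fun do rewrite exprS; exact: cmeasurableM.
Qed.

Lemma cmeasurableV f : cmeasurable f -> cmeasurable (fun x => (f x)^-1).
Proof.
move=> [f1 f2].
have mn : measurable_fun [set: R] (fun x => (cabs (f x) ^+ 2)^-1).
  under eq_fun do rewrite cabs_sqr.
  apply: (measurableT_comp measurable_inv).
  by apply: measurable_funD; exact: measurable_funX.
split.
- by under eq_fun do rewrite ReV; exact: measurable_funM.
- under eq_fun do rewrite ImV.
  by apply: measurable_funM => //; exact: measurable_funN.
Qed.

End ComplexMeasurable.

Ltac cmeas := repeat match goal with
  | |- cmeasurable (fun=> ?c) => exact: cmeasurable_cst
  | |- cmeasurable (fun x => x%:C) => exact: cmeasurable_id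
  | |- cmeasurable (real_complex _) => exact: cmeasurable_id
  | |- cmeasurable (fun x => _ + _) => apply: cmeasurableD
  | |- cmeasurable (fun x => - _) => apply: cmeasurableN
  | |- cmeasurable (fun x => _ * _) => apply: cmeasurableM
  | |- cmeasurable (fun x => _ ^+ _) => apply: cmeasurableX
  | |- cmeasurable (fun x => _^-1) => apply: cmeasurableV
  end.

(** * Complex integrals against a law of bounded support *)

Section ComplexIntegral.
Context {R : realType}.
Implicit Types (mu : probability R R) (f g : R -> R[i]) (M : R).

Definition supported_in mu M := mu (~` `[- M, M]%classic) = 0%E.

Lemma in_supp M (x : R) : `[- M, M]%classic x <-> `|x| <= M.
Proof. by rewrite /= in_itv/= ler_norml. Qed.

Lemma supported_in_le mu M M' : M <= M' -> supported_in mu M ->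
  supported_in mu M'.
Proof.
move=> MM; apply: subset_measure0; try exact: measurableC.
by apply: subsetC => x /in_supp xM; apply/in_supp; exact: le_trans xM MM.
Qed.

Lemma bounded_integrable mu M (f : R -> R) : supported_in mu M ->
  measurable_fun [set: R] f -> (exists C, forall x, `|x| <= M -> `|f x| <= C) ->
  mu.-integrable [set: R] (EFin \o f).
Proof.
move=> mM mf [C fC]; have mfE := (proj2 (measurable_EFinP _ _) mf).
apply/integrableP; split => //.
have mfa : measurable_fun [set: R] (fun x => `|(EFin \o f) x|%E).
  exact: measurableT_comp.
rewrite (ge0_negligible_integral _ _ mfa _ mM)//; last exact: measurableC.
rewrite setTD setCK.
apply: (@le_lt_trans _ _ (\int[mu]_(x in `[(- M)%R, M]) (`|C|%R)%:E)%E).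
  apply: ge0_le_integral => //.
  - exact: measurable_funTS.
  - move=> x /in_supp xM; rewrite /= lee_fin.
    exact: le_trans (fC _ xM) (ler_norm _).
rewrite integral_cst//.
apply: lte_mul_pinfty => //.
by rewrite (le_lt_trans (probability_le1 _ _))// ltry.
Qed.

Lemma integrable_all_bounded mu (f : R -> R) : measurable_fun [set: R] f ->
  (exists C, forall x, `|f x| <= C) -> mu.-integrable [set: R] (EFin \o f).
Proof.
move=> mf [C fC]; apply: measurable_bounded_integrable => //.
  by rewrite (le_lt_trans (probability_le1 _ _))// ltry.
exists C; split; first exact: num_real.
by move=> y Cy x _; apply: le_trans (ltW Cy).
Qed.

Lemma eq_Rintegral_supp mu M (f g : R -> R) : supported_in mu M ->
  measurable_fun [set: R] f -> measurable_fun [set: R] g ->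
  (forall x, `|x| <= M -> f x = g x) ->
  \int[mu]_x f x = \int[mu]_x g x.
Proof.
move=> mM mf mg fg; congr fine; apply: ae_eq_integral => //.
- exact/measurable_EFinP.
- exact/measurable_EFinP.
exists (~` `[- M, M]%classic); split => //; first exact: measurableC.
move=> x /= H; apply: contra_not H => /in_supp xM _.
by rewrite fg.
Qed.

Lemma Rintegral_prob_cst mu (c : R) : \int[mu]_x c = c.
Proof.
rewrite Rintegral_cst// -[RHS]mulr1; congr (_ * _).
by have /= -> := @probability_setT _ _ _ mu.
Qed.

Lemma integrable_lin mu (a b : R) (u v : R -> R) :
  mu.-integrable [set: R] (EFin \o u) -> mu.-integrable [set: R] (EFin \o v) ->
  mu.-integrable [set: R] (EFin \o (fun x => a * u x + b * v x)).
Proof.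
move=> iu iv; have ia := integrableZl measurableT a iu.
have ib := integrableZl measurableT b iv.
by apply: eq_integrable (integrableD measurableT ia ib).
Qed.

Lemma Rintegral_lin mu (a b : R) (u v : R -> R) :
  mu.-integrable [set: R] (EFin \o u) -> mu.-integrable [set: R] (EFin \o v) ->
  \int[mu]_x (a * u x + b * v x) = a * \int[mu]_x u x + b * \int[mu]_x v x.
Proof.
move=> iu iv; have ia := integrableZl measurableT a iu.
have ib := integrableZl measurableT b iv.
by rewrite RintegralD ?RintegralZl//; apply: eq_integrable.
Qed.

Definition cintegrable mu f :=
  mu.-integrable [set: R] (EFin \o (fun x => Re (f x))) /\
  mu.-integrable [set: R] (EFin \o (fun x => Im (f x))).

Lemma cintegrable_supp mu M f : supported_in mu M -> cmeasurable f ->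
  (exists C, forall x, `|x| <= M -> cabs (f x) <= C) -> cintegrable mu f.
Proof.
move=> mM [f1 f2] [C fC]; split.
  apply: (bounded_integrable mM f1).
  by exists C => x /fC; apply: le_trans; exact: cabs_Re.
apply: (bounded_integrable mM f2).
by exists C => x /fC; apply: le_trans; exact: cabs_Im.
Qed.

Lemma eq_cintegral_supp mu M f g : supported_in mu M ->
  cmeasurable f -> cmeasurable g -> (forall x, `|x| <= M -> f x = g x) ->
  cintegral mu f = cintegral mu g.
Proof.
move=> mM [f1 f2] [g1 g2] fg; apply: complex_eqP => /=;
  by apply: (eq_Rintegral_supp mM) => // x /fg ->.
Qed.

Lemma cintegralD mu f g : cintegrable mu f -> cintegrable mu g ->
  cintegral mu (fun x => f x + g x) = cintegral mu f + cintegral mu g.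
Proof.
move=> [f1 f2] [g1 g2]; apply: complex_eqP => /=.
  by under eq_Rintegral do rewrite ReD; rewrite RintegralD.
by under eq_Rintegral do rewrite ImD; rewrite RintegralD.
Qed.

Lemma cintegralZ mu (c : R[i]) f : cintegrable mu f ->
  cintegral mu (fun x => c * f x) = c * cintegral mu f.
Proof.
move=> [f1 f2].
apply: complex_eqP; rewrite ?ReM ?ImM /=.
  under eq_Rintegral do rewrite ReM -mulNr.
  by rewrite Rintegral_lin// mulNr.
by under eq_Rintegral do rewrite ImM; rewrite Rintegral_lin.
Qed.

Lemma cintegral_cst mu (c : R[i]) : cintegral mu (fun=> c) = c.
Proof.
by apply: complex_eqP => /=; exact: Rintegral_prob_cst.
Qed.

Lemma cintegrableZ mu (c : R[i]) f : cintegrable mu f ->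
  cintegrable mu (fun x => c * f x).
Proof.
move=> [f1 f2].
split.
  under [X in EFin \o X]eq_fun do rewrite ReM -mulNr.
  exact: integrable_lin.
by under [X in EFin \o X]eq_fun do rewrite ImM; exact: integrable_lin.
Qed.

Lemma cintegrableD mu f g : cintegrable mu f -> cintegrable mu g ->
  cintegrable mu (fun x => f x + g x).
Proof.
move=> [f1 f2] [g1 g2]; split.
  have := integrable_lin 1 1 f1 g1; apply: eq_integrable => // x _.
  by rewrite /= ReD !mul1r.
have := integrable_lin 1 1 f2 g2; apply: eq_integrable => // x _.
by rewrite /= ImD !mul1r.
Qed.

Lemma cintegralB mu f g : cintegrable mu f -> cintegrable mu g ->
  cintegral mu (fun x => f x - g x) = cintegral mu f - cintegral mu g.
Proof.
move=> mf mg; under [X in cintegral _ X]eq_fun do rewrite -mulN1r.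
rewrite cintegralD//; last exact: cintegrableZ.
by rewrite cintegralZ// mulN1r.
Qed.

Lemma Rintegral_le_supp mu M (f : R -> R) C : supported_in mu M ->
  measurable_fun [set: R] f -> (forall x, `|x| <= M -> `|f x| <= C) ->
  `|\int[mu]_x f x| <= C.
Proof.
move=> mM mf fC.
(* For [M < 0] the interval is empty and its complement, the whole line, would be null. *)
have M0 : 0 <= M.
  rewrite leNgt; apply/negP => M0; have : mu [set: R] = 0%E.
    move: mM; rewrite /supported_in set_itv_ge ?setC0//.
    by rewrite bnd_simp -ltNge; lra.
  by rewrite probability_setT => -[] /eqP; rewrite oner_eq0.
have C0 : 0 <= C by apply: le_trans (fC 0 _); rewrite ?normr0.
have iff : mu.-integrable [set: R] (EFin \o f).
  by apply: (bounded_integrable mM) => //; exists C.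
apply: le_trans (le_normr_Rintegral _ iff) _ => //.
rewrite (_ : C = \int[mu]_x C); last exact/esym/Rintegral_prob_cst.
pose g x := Num.min `|f x| C.
(* The bound by [C] holds only on the support; truncating at [C] makes it hold everywhere without
   changing the integral. *)
rewrite (@eq_Rintegral_supp mu M (fun x => `|f x|) g)//.
- have mg : measurable_fun [set: R] g.
    by apply: measurable_minr => //; exact: measurableT_comp.
  apply: le_Rintegral => //.
  + apply: (integrable_all_bounded mu mg).
    exists C => x; rewrite /g ger0_norm ?le_min ?normr_ge0//.
    by rewrite ge_min lexx orbT.
  + by apply: integrable_all_bounded => //; exists `|C|.
  + by move=> x _; rewrite /g ge_min lexx orbT.
- exact: measurableT_comp.
- by apply: measurable_minr => //; exact: measurableT_comp.
- by move=> x /fC h; rewrite /g min_l.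
Qed.

(** The factor 2 is the price of bounding the real and imaginary parts separately. *)
Lemma cabs_cintegral_supp mu M f C : supported_in mu M -> cmeasurable f ->
  (forall x, `|x| <= M -> cabs (f x) <= C) -> cabs (cintegral mu f) <= 2 * C.
Proof.
move=> mM [f1 f2] fC; apply: le_trans (cabs_le _) _ => /=.
rewrite mulr_natl mulr2n; apply: lerD; apply: (Rintegral_le_supp mM) => //.
- by move=> x /fC; apply: le_trans; exact: cabs_Re.
- by move=> x /fC; apply: le_trans; exact: cabs_Im.
Qed.

End ComplexIntegral.

(** * Paths in the complex plane and a Gronwall estimate *)

Section Gronwall.
Context {R : realType}.
Implicit Types (u du : R -> R[i]) (s t K : R).

(** Increments are confined to the closed interval, so the derivative is one-sided at both ends, in
    accordance with [is_time_derivative] at time 0. *)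
Definition has_path_derivative (t : R) u du := forall s, 0 <= s <= t ->
  forall e, 0 < e -> exists2 d, 0 < d & forall h, `|h| < d -> 0 <= s + h <= t ->
    cabs (u (s + h) - u s - h%:C * du s) <= e * `|h|.

Lemma is_derive_eps (f : R -> R) (s l : R) :
  (forall e, 0 < e -> exists2 d, 0 < d & forall h, `|h| < d ->
    `|f (s + h) - f s - h * l| <= e * `|h|) -> is_derive s 1 f l.
Proof.
move=> H.
have cl : h^-1 *: (f (h *: (1 : R) + s) - f s) @[h --> (0 : R)^'] --> l.
  apply/cvgrPdist_le => e e0; have [d d0 dH] := H _ e0.
  rewrite near_withinE; apply/nbhs_ballP; exists d => // h.
  rewrite /ball/= sub0r normrN => hd h0.
  have -> : l - h^-1 *: (f (h *: 1 + s) - f s) =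
     - h^-1 * (f (s + h) - f s - h * l).
    by rewrite [_ *: 1]mulr1 /GRing.scale/= (addrC h); field.
  rewrite normrM normrN normfV mulrC ler_pdivrMr ?normr_gt0//.
  exact: dH.
split; last exact: cvg_lim cl.
by apply/cvg_ex; exists l.
Qed.

Lemma path_derivative_continuous t u du : has_path_derivative t u du ->
  forall s, 0 <= s <= t -> forall e, 0 < e -> exists2 d, 0 < d &
    forall h, `|h| < d -> 0 <= s + h <= t -> cabs (u (s + h) - u s) < e.
Proof.
move=> H s st e e0; have [d d0 dH] := H s st 1 ltr01.
pose c := 1 + cabs (du s).
have c0 : 0 < c by rewrite /c; have := cabs_ge0 (du s); lra.
exists (Num.min d (e / c)); first by rewrite lt_min d0 divr_gt0.
move=> h; rewrite lt_min => /andP[hd he] sh.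
have := dH h hd sh; rewrite mul1r => H1.
have H2 := cabsD (u (s + h) - u s - h%:C * du s) (h%:C * du s).
rewrite subrK cabsM cabsr in H2.
apply: le_lt_trans H2 _; move: he; rewrite ltr_pdivlMr// /c; lra.
Qed.

(** The square is taken because the modulus need not be differentiable where [u] vanishes. *)
Lemma path_norm_derivative t u du : has_path_derivative t u du ->
  forall s, 0 < s < t -> is_derive s 1 (fun s => cabs (u s) ^+ 2)
    (2 * (Re (u s) * Re (du s) +
          Im (u s) * Im (du s))).
Proof.
move=> H s /andP[s0 st].
have hP (p : R[i] -> R) : (forall z w, p (z + w) = p z + p w) ->
    (forall z, p (- z) = - p z) -> (forall z, `|p z| <= cabs z) ->
    (forall (h : R) z, p (h%:C * z) = h * p z) ->
    is_derive s 1 (fun s => p (u s)) (p (du s)).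
  move=> pD pN pc pZ; apply: is_derive_eps => e e0.
  have [|d d0 dH] := H s _ e e0; first by rewrite !ltW.
  exists (Num.min d (Num.min s (t - s))); first by rewrite !lt_min d0 s0 subr_gt0.
  move=> h; rewrite !lt_min => /and3P[hd hs ht].
  rewrite -pZ -!pN -!pD; apply: le_trans (pc _) _; apply: dH => //.
  by move: hs ht; rewrite !ltr_norml; lra.
have h1 : is_derive s 1 (fun s => Re (u s)) (Re (du s)).
  apply: hP; [exact: ReD|exact: ReN|exact: cabs_Re|].
  by move=> h z; rewrite ReM/= mul0r subr0.
have h2 : is_derive s 1 (fun s => Im (u s)) (Im (du s)).
  apply: hP; [exact: ImD|exact: ImN|exact: cabs_Im|].
  by move=> h z; rewrite ImM/= mul0r addr0.
under eq_fun do rewrite cabs_sqr !expr2.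
have h3 := is_deriveD (is_deriveM h1 h1) (is_deriveM h2 h2).
apply: is_derive_eq h3 _.
rewrite /GRing.scale/=; ring.
Qed.

Lemma Re_dot_le (z w : R[i]) :
  `|Re z * Re w + Im z * Im w| <=
  cabs z * cabs w.
Proof.
have -> : cabs z * cabs w = cabs (z * conjc w).
  by rewrite cabsM; congr (_ * _); rewrite !cabsE; case: w => a b/=; rewrite sqrrN.
apply: le_trans (cabs_Re _).
by rewrite ReM; case: z; case: w => a b c d /=; rewrite mulrN opprK.
Qed.

Lemma path_norm_continuous t u du : has_path_derivative t u du ->
  {within `[0, t], continuous (fun s => cabs (u s) ^+ 2)}.
Proof.
move=> H; apply/subspace_continuousP => s; rewrite /= in_itv/= => st.
have c : cabs (u x) @[x --> within `[0, t] (nbhs s)] --> cabs (u s).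
  apply/cvgrPdist_lt => e e0.
  have [d d0 dH] := path_derivative_continuous H st e0.
  rewrite near_withinE; apply/nbhs_ballP; exists d => // x.
  rewrite /ball/= => sx; rewrite in_itv/= => xt.
  apply: le_lt_trans (dH (x - s) _ _); rewrite ?(addrC s) ?subrK//.
    by rewrite distrC ler_distl; have := cabs_triB (u x) (u s);
       have := cabs_triB (u s) (u x); rewrite (cabsBC (u s)); lra.
  by rewrite distrC.
rewrite (_ : (fun s => _) = (fun s => cabs (u s) * cabs (u s))); first exact: cvgM.
by apply/funext => x; rewrite expr2.
Qed.

(** [|u|^2 exp(2 K s)] is nondecreasing and [|u|^2 exp(- 2 K s)] is nonincreasing: the first forces
    [u = 0] before [s1], the second after it. Both directions of time are needed, since a value is
    carried from [t] back to 0 and, for uniqueness, from 0 to [t]. *)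
Lemma gronwall_zero t K u du : has_path_derivative t u du ->
  (forall s, 0 <= s <= t -> cabs (du s) <= K * cabs (u s)) ->
  forall s1, 0 <= s1 <= t -> u s1 = 0 -> forall s, 0 <= s <= t -> u s = 0.
Proof.
move=> H HK s1 s1t us1 s st.
pose F (c s : R) := cabs (u s) ^+ 2 * expR (c * s).
pose dF (c s : R) := expR (c * s) * (2 * (Re (u s) * Re (du s) +
          Im (u s) * Im (du s)) + c * cabs (u s) ^+ 2).
have dFP c x : 0 < x < t -> is_derive x 1 (F c) (dF c x).
  move=> xt; have h1 := path_norm_derivative H xt.
  have h2 : is_derive x 1 (fun s : R => expR (c * s)) (expR (c * x) * c).
    apply: (@is_derive1_comp _ expR (fun s => c * s)).
    have := is_deriveM (is_derive_cst c x 1) (is_derive_id x 1).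
    by move=> h; apply: is_derive_eq h _; rewrite /GRing.scale/= mulr0 mulr1 addr0.
  apply: is_derive_eq (is_deriveM h1 h2) _.
  rewrite /GRing.scale/= /dF; ring.
have cF c : {within `[0, t], continuous (F c)}.
  move=> x; apply: cvgM; first exact: (path_norm_continuous H).
  apply: continuous_subspaceT => y.
  apply: continuous_comp; last exact: continuous_expR.
  by apply: cvgM; [exact: cvg_cst|exact: cvg_id].
have dlt x : 0 < x < t -> `|2 * (Re (u x) * Re (du x) +
    Im (u x) * Im (du x))| <= 2 * K * cabs (u x) ^+ 2.
  move=> /andP[x0 xt]; rewrite normrM ger0_norm// -mulrA ler_wpM2l//.
  apply: le_trans (Re_dot_le _ _) _.
  rewrite expr2 mulrCA; apply: ler_wpM2l; first exact: cabs_ge0.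
  by apply: HK; rewrite !ltW.
have F1 c : F c s1 = 0 by rewrite /F us1 cabs0 expr0n mul0r.
have Fge0 c : 0 <= F c s by rewrite mulr_ge0 ?sqr_ge0 ?expR_ge0.
suff [c Fc] : exists c, F c s <= 0.
  have : F c s = 0 by apply/eqP; rewrite eq_le Fc Fge0.
  move=> /eqP; rewrite mulf_eq0 expf_eq0/= cabs_eq0 => /orP[/eqP//|].
  by rewrite gt_eqF// expR_gt0.
have [ss1|s1s] := leP s s1.
- exists (2 * K); rewrite -(F1 (2 * K)).
  apply: (@ger0_derive1_le_cc _ (F (2 * K)) 0 t) => //.
  + by move=> x; rewrite in_itv/= => xt; have [] := dFP (2 * K) x xt.
  + move=> x; rewrite in_itv/= => xt; have h := dFP (2 * K) x xt.
    rewrite derive1E derive_val mulr_ge0 ?expR_ge0//.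
    by have := dlt _ xt; rewrite ler_norml => /andP[]; lra.
- exists (- (2 * K)); rewrite -(F1 (- (2 * K))).
  apply: (@ler0_derive1_le_cc _ (F (- (2 * K))) 0 t) => //; last exact: ltW.
  + by move=> x; rewrite in_itv/= => xt; have [] := dFP (- (2 * K)) x xt.
  + move=> x; rewrite in_itv/= => xt; have h := dFP (- (2 * K)) x xt.
    rewrite derive1E derive_val mulr_ge0_le0 ?expR_ge0//.
    by have := dlt _ xt; rewrite ler_norml => /andP[]; lra.
Qed.

End Gronwall.

(* [cauchy] alone now refers to Cauchy filters. *)
Notation cauchyG := Defs.cauchy.

(** * The Cauchy transform: Taylor estimate and continuity in time *)

Section CauchyKernel.
Context {R : realType}.
Implicit Types (mu : probability R R) (z w : R[i]) (M d : R).

(** Distance from [z] to the interval carrying the measure. Two choices of [d] matter: [Im z], valid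
    whatever the support, and [cabs z - M], far from the support. *)
Definition separated M d z := forall x : R, `|x| <= M -> d <= cabs (z - x%:C).

Lemma separated_Im M z : separated M (Im z) z.
Proof.
move=> x _; apply: le_trans (cabs_Im _).
by rewrite ImD ImN/= subr0 ler_norm.
Qed.

Lemma separated_le M d d' z : d' <= d -> separated M d z -> separated M d' z.
Proof. by move=> dd H x /H; apply: le_trans. Qed.

Lemma separated_cabs M z : separated M (cabs z - M) z.
Proof.
move=> x xM; apply: le_trans (cabs_triB _ _); rewrite cabsr; lra.
Qed.

Lemma separated_neq0 M d z : 0 < d -> separated M d z ->
  forall x : R, `|x| <= M -> z - x%:C != 0.
Proof. by move=> d0 H x /H; rewrite -cabs_gt0; apply: lt_le_trans. Qed.

Lemma separated_inv M d z : 0 < d -> separated M d z ->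
  forall x : R, `|x| <= M -> cabs (z - x%:C)^-1 <= d^-1.
Proof.
move=> d0 H x xM; rewrite cabsV lef_pV2 ?posrE ?H//.
exact: lt_le_trans (H _ xM).
Qed.

(* minus the derivative of the Cauchy transform *)
Definition cauchy2 mu z : R[i] := cintegral mu (fun x => (z - x%:C)^-1 ^+ 2).

Lemma cabs_cauchy mu M d z : supported_in mu M -> 0 < d -> separated M d z ->
  cabs (cauchyG mu z) <= 2 * d^-1.
Proof.
move=> mM d0 H; apply: (cabs_cintegral_supp mM); first by cmeas.
exact: separated_inv d0 H.
Qed.

Lemma cabs_cauchy2 mu M d z : supported_in mu M -> 0 < d -> separated M d z ->
  cabs (cauchy2 mu z) <= 2 * d^-1 ^+ 2.
Proof.
move=> mM d0 H; apply: (cabs_cintegral_supp mM); first by cmeas.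
move=> x xM; rewrite cabsX lerXn2r ?nnegrE ?cabs_ge0 ?invr_ge0 ?(ltW d0)//.
exact: separated_inv d0 H _ xM.
Qed.

Lemma cintegrable_kernel mu M d z : supported_in mu M -> 0 < d ->
  separated M d z -> cintegrable mu (fun x => (z - x%:C)^-1).
Proof.
move=> mM d0 H; apply: (cintegrable_supp mM); first by cmeas.
by exists d^-1; exact: separated_inv d0 H.
Qed.

Lemma cintegrable_kernel2 mu M d z : supported_in mu M -> 0 < d ->
  separated M d z -> cintegrable mu (fun x => (z - x%:C)^-1 ^+ 2).
Proof.
move=> mM d0 H; apply: (cintegrable_supp mM); first by cmeas.
exists (d^-1 ^+ 2) => x xM.
rewrite cabsX lerXn2r ?nnegrE ?cabs_ge0 ?invr_ge0 ?(ltW d0)//.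
exact: separated_inv d0 H _ xM.
Qed.

(** The remainder of the kernel is exactly [(w - z)^2 / ((z - x)^2 (w - x))], so only the two end
    points have to be away from the support. The bound does not involve [M], which varies with
    time. *)
Lemma cauchy_taylor mu M d z w : supported_in mu M -> 0 < d ->
  separated M d z -> separated M d w ->
  cabs (cauchyG mu w - cauchyG mu z + (w - z) * cauchy2 mu z) <=
  2 * (d^-1 ^+ 3 * cabs (w - z) ^+ 2).
Proof.
move=> mM d0 Hz Hw.
have i1 := cintegrable_kernel mM d0 Hz; have i2 := cintegrable_kernel mM d0 Hw.
have i3 := cintegrable_kernel2 mM d0 Hz.
rewrite -cintegralB// -cintegralZ// -cintegralD; last exact: cintegrableZ.
  apply: (cabs_cintegral_supp mM); first by cmeas.
  move=> x xM.
  have z0 := separated_neq0 d0 Hz xM; have w0 := separated_neq0 d0 Hw xM.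
  have -> : (w - x%:C)^-1 - (z - x%:C)^-1 + (w - z) * (z - x%:C)^-1 ^+ 2 =
    (z - x%:C)^-1 ^+ 2 * (w - x%:C)^-1 * (w - z) ^+ 2 by field; rewrite z0 w0.
  rewrite 2!cabsM !cabsX ler_wpM2r ?sqr_ge0// [d^-1 ^+ 3]exprSr.
  apply: ler_pM; rewrite ?cabs_ge0 ?sqr_ge0//; last exact: separated_inv d0 Hw _ xM.
  rewrite lerXn2r ?nnegrE ?cabs_ge0 ?invr_ge0 ?(ltW d0)//.
  exact: separated_inv d0 Hz _ xM.
have := cintegrableD i2 (cintegrableZ (-1) i1).
by under eq_fun do rewrite mulN1r.
Qed.

(** The equation only provides some derivative; comparison with the Taylor estimate along one small
    real increment identifies it. *)
Lemma cauchy_derive_val mu M z (l : R[i]) : supported_in mu M ->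
  0 < Im z -> is_derive z 1 (cauchyG mu) l -> l = - cauchy2 mu z.
Proof.
move=> mM y0 /is_deriveP Hl.
pose d := Im z / 2; have d0 : 0 < d by rewrite /d; lra.
apply/eqP; rewrite -subr_eq0 opprK; apply/eqP; apply: cabs_small => e e0.
have e3 : 0 < e / 3 by lra.
have [r r0 rH] := Hl _ e3.
pose c := 2 * d^-1 ^+ 3; have c0 : 0 < c by rewrite /c mulr_gt0// exprn_gt0 ?invr_gt0.
pose h := Num.min (r / 2) (Num.min d (e / 3 / c)).
have h0 : 0 < h by rewrite /h !lt_min d0 !divr_gt0.
have hr : h < r by rewrite /h gt_min; apply/orP; left; lra.
have hd : h <= d by rewrite /h !ge_min lexx !orbT.
have hc : c * h <= e / 3.
  by rewrite -ler_pdivlMl// mulrC /h !ge_min lexx !orbT.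
have := rH h%:C; rewrite cabsr gtr0_norm// => /(_ hr) H1.
have sz : separated M d z.
  by apply: separated_le (@separated_Im _ _); rewrite /d; lra.
have sw : separated M d (z + h%:C).
  apply: separated_le (@separated_Im _ _); rewrite ImD/= addr0 /d; lra.
have H2 := cauchy_taylor mM d0 sz sw.
rewrite (_ : z + h%:C - z = h%:C) in H2; last by ring.
rewrite cabsr gtr0_norm// mulrA -/c in H2.
have H3 := cabsB (cauchyG mu (z + h%:C) - cauchyG mu z + h%:C * cauchy2 mu z)
  (cauchyG mu (z + h%:C) - cauchyG mu z - h%:C * l).
rewrite (_ : _ - _ = h%:C * (l + cauchy2 mu z)) in H3; last by ring.
rewrite cabsM cabsr gtr0_norm// in H3.
rewrite -(ltr_pM2l h0).
have : c * h ^+ 2 <= e / 3 * h by rewrite expr2 mulrA ler_wpM2r// ltW.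
have : 0 < e * h by rewrite mulr_gt0.
lra.
Qed.

Lemma lipschitz_continuous (f : R -> R) (C : R) :
  (forall x y, `|f x - f y| <= C * `|x - y|) -> continuous f.
Proof.
move=> H x; apply/cvgrPdist_lt => e e0.
pose c := `|C| + 1; have c0 : 0 < c by rewrite /c; have := normr_ge0 C; lra.
apply/nbhs_ballP; exists (e / c); first by rewrite /= divr_gt0.
move=> y; rewrite /ball/= => xy; apply: le_lt_trans (H _ _) _.
move: xy; rewrite ltr_pdivlMr//; apply: le_lt_trans.
rewrite mulrC ler_wpM2l// /c; have := ler_norm C; lra.
Qed.

Lemma weakly_continuous_cintegral (mu : R -> probability R R) (k : R -> R[i])
    (C B : R) : weakly_continuous mu ->
  (forall x y, cabs (k x - k y) <= C * `|x - y|) ->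
  (forall x, cabs (k x) <= B) ->
  forall s, 0 <= s -> forall e, 0 < e -> exists2 d, 0 < d &
    forall h, `|h| < d -> 0 <= s + h ->
      cabs (cintegral (mu (s + h)) k - cintegral (mu s) k) < e.
Proof.
move=> wc kC kB s s0 e e0.
have part (p : R[i] -> R) : (forall z w, p (z + w) = p z + p w) ->
    (forall z, p (- z) = - p z) -> (forall z, `|p z| <= cabs z) ->
    exists2 d, 0 < d & forall h, `|h| < d -> 0 <= s + h ->
      `|\int[mu (s + h)]_x p (k x) - \int[mu s]_x p (k x)| < e / 2.
  move=> pD pN pc.
  have pcont : continuous (fun x => p (k x)).
    apply: (@lipschitz_continuous _ C) => x y; rewrite -pN -pD.
    exact: le_trans (pc _) (kC _ _).
  have pb : bounded_fun (fun x => p (k x)).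
    exists B; split; first exact: num_real.
    by move=> y By x _; apply: le_trans (pc _) (le_trans (kB x) (ltW By)).
  have /subspace_continuousP := wc _ pcont pb.
  move=> /(_ s); rewrite /= in_itv/= s0 => /(_ isT)/cvgrPdist_lt.
  have e2 : 0 < e / 2 by lra.
  move=> /(_ _ e2); rewrite near_withinE => /nbhs_ballP[d /= d0 dH].
  exists d => // h hd sh; rewrite distrC; apply: dH.
    by rewrite /ball/= opprD addrA subrr sub0r normrN.
  by rewrite in_itv/= sh.
have [d1 d10 H1] := part _ ReD ReN cabs_Re.
have [d2 d20 H2] := part _ ImD ImN cabs_Im.
exists (Num.min d1 d2); first by rewrite lt_min d10 d20.
move=> h; rewrite lt_min => /andP[h1 h2] sh.
apply: le_lt_trans (cabs_le _) _; rewrite ReD ReN ImD ImN/=.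
have := H1 h h1 sh; have := H2 h h2 sh; lra.
Qed.

(** The kernel is bounded and Lipschitz on the whole line with constants depending only on [Im z],
    so weak continuity applies without control of the supports. *)
Lemma cauchy2_time_continuous (mu : R -> probability R R) z :
  weakly_continuous mu -> 0 < Im z ->
  forall s, 0 <= s -> forall e, 0 < e -> exists2 d, 0 < d &
    forall h, `|h| < d -> 0 <= s + h ->
      cabs (cauchy2 (mu (s + h)) z - cauchy2 (mu s) z) < e.
Proof.
move=> wc y0; set y := Im z in y0.
have sep x : y <= cabs (z - x%:C) by exact: (@separated_Im `|x|).
have inv x : cabs (z - x%:C)^-1 <= y^-1.
  by rewrite cabsV lef_pV2 ?posrE//; exact: lt_le_trans (sep _).
have ne0 x : z - x%:C != 0 by rewrite -cabs_gt0; exact: lt_le_trans (sep _).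
have k0 : 0 <= y^-1 by rewrite invr_ge0 ltW.
apply: (@weakly_continuous_cintegral _ _ (2 * y^-1 ^+ 3) (y^-1 ^+ 2) wc).
- move=> x x'.
  have -> : (z - x%:C)^-1 ^+ 2 - (z - x'%:C)^-1 ^+ 2 =
     (z - x%:C)^-1 * (z - x'%:C)^-1 *
     ((z - x%:C)^-1 + (z - x'%:C)^-1) * (x%:C - x'%:C).
    by field; rewrite !ne0.
  rewrite 3!cabsM -rmorphB cabsr ler_wpM2r//.
  have -> : 2 * y^-1 ^+ 3 = y^-1 * y^-1 * (y^-1 + y^-1) by ring.
  apply: ler_pM; rewrite ?mulr_ge0 ?cabs_ge0//.
    by apply: ler_pM; rewrite ?cabs_ge0.
  by apply: le_trans (cabsD _ _) _; have := inv x; have := inv x'; lra.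
- by move=> x; rewrite cabsX lerXn2r ?nnegrE ?cabs_ge0.
Qed.

End CauchyKernel.

(** * Characteristics and calculus of path derivatives *)

Section Characteristic.
Context {R : realType}.

Lemma cabs_sum5 (a b c d e : R[i]) :
  cabs (a + b + c + d + e) <= cabs a + cabs b + cabs c + cabs d + cabs e.
Proof.
have := cabsD (a + b + c + d) e; have := cabsD (a + b + c) d.
have := cabsD (a + b) c; have := cabsD a b; lra.
Qed.

(* Along the characteristic Z the value gh predicted by the equation is
   attained at all times as soon as it is at one time: the difference u
   satisfies [|u'| <= K |u|]. *)
Lemma characteristic (mu : R -> probability R R) (a b : R[i] -> R[i] -> R[i])
    (t d L : R) (Z gh : R -> R[i]) :
  (forall s, 0 <= s -> bounded_support (mu s)) ->
  weakly_continuous mu -> solves_pde a b (fun s => cauchyG (mu s)) ->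
  0 < d -> (forall s, 0 <= s <= t -> d <= Im (Z s)) ->
  has_path_derivative t Z (fun s => a (Z s) (gh s)) ->
  has_path_derivative t gh (fun s => - b (Z s) (gh s)) ->
  (forall s g, 0 <= s <= t -> cabs g <= 2 * d^-1 ->
     cabs (a (Z s) g - a (Z s) (gh s)) <= L * cabs (g - gh s) /\
     cabs (b (Z s) g - b (Z s) (gh s)) <= L * cabs (g - gh s)) ->
  forall s1, 0 <= s1 <= t -> cauchyG (mu s1) (Z s1) = gh s1 ->
  forall s, 0 <= s <= t -> cauchyG (mu s) (Z s) = gh s.
Proof.
move=> bs wc pde d0 dZ Zd ghd Lip s1 s1t e1 s st.
pose u s := cauchyG (mu s) (Z s) - gh s.
(* The time derivative of the transform is eliminated by the equation at [Z s]; only differences of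
   the coefficients at [gh s] and at the actual value remain, which is what makes [du] of the order
   of [u]. *)
pose du s := - cauchy2 (mu s) (Z s) *
    (a (Z s) (gh s) - a (Z s) (cauchyG (mu s) (Z s))) +
    (b (Z s) (gh s) - b (Z s) (cauchyG (mu s) (Z s))).
have Zsep M r : 0 <= r <= t -> separated M d (Z r).
  by move=> /dZ H; apply: separated_le H _; exact: separated_Im.
suff : u s = 0 by move/eqP; rewrite subr_eq0 => /eqP.
have ge0 r : 0 <= r <= t -> 0 <= r by case/andP.
pose k1 : R := 2 * d^-1 ^+ 2; pose k3 : R := 2 * d^-1 ^+ 3.
have k10 : 0 < k1 by rewrite /k1 mulr_gt0// exprn_gt0 ?invr_gt0.
have k30 : 0 < k3 by rewrite /k3 mulr_gt0// exprn_gt0 ?invr_gt0.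
have c2 r z M : supported_in (mu r) M -> separated M d z ->
    cabs (cauchy2 (mu r) z) <= k1.
  by move=> mM; exact: cabs_cauchy2.
apply: (@gronwall_zero _ t (k1 * L + L) u du _ _ s1) => //; last by rewrite /u e1 subrr.
- move=> r rt e e0.
  have [M1 mM1] := bs r (ge0 _ rt).
  have y0 : 0 < Im (Z r) by exact: lt_le_trans (dZ r rt).
  have [ft [fz [ftd fzd]]] := pde r (Z r) (ge0 _ rt) y0.
  move=> /eqP; rewrite -addrA addr_eq0 => /eqP fte.
  move: fte; rewrite (cauchy_derive_val mM1 y0 fzd) => fte.
  set A := cabs (a (Z r) (gh r)).
  have A0 : 0 <= A by exact: cabs_ge0.
  (* The five errors below are at most [e' |h|] times 1, [k1], [A], 1 and 1. *)
  set N := k1 + A + 3.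
  have N0 : 0 < N by rewrite /N; lra.
  set e' := e / N; have e'0 : 0 < e' by rewrite divr_gt0.
  have c0 : 0 < k3 * (A + 1) ^+ 2 by rewrite mulr_gt0// exprn_gt0//; lra.
  have [d1 d10 H1] := Zd r rt e' e'0.
  have [d2 d20 H2] := Zd r rt 1 ltr01.
  have [d3 d30 H3] := ghd r rt e' e'0.
  have [d4 d40 H4] := time_derivativeP ftd e'0.
  have [d5 d50 H5] := cauchy2_time_continuous wc y0 (ge0 _ rt) e'0.
  exists (Num.min d1 (Num.min d2 (Num.min d3 (Num.min d4 (Num.min d5
     (e' / (k3 * (A + 1) ^+ 2))))))).
    by rewrite !lt_min d10 d20 d30 d40 d50 divr_gt0.
  move=> h; rewrite !lt_min => /and5P[h1 h2 h3 h4 /andP[h5 h6]] rh.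
  have {}H1 := H1 h h1 rh; have {}H2 := H2 h h2 rh; have {}H3 := H3 h h3 rh.
  have {}H4 := H4 h h4 (ge0 _ rh); have {}H5 := H5 h h5 (ge0 _ rh).
  have [M2 mM2] := bs (r + h) (ge0 _ rh).
  set dz := Z (r + h) - Z r in H1 H2.
  have Dz : cabs dz <= (A + 1) * `|h|.
    have := cabsD (dz - h%:C * a (Z r) (gh r)) (h%:C * a (Z r) (gh r)).
    rewrite subrK cabsM cabsr -/A mul1r in H2 *; lra.
  have T := cauchy_taylor mM2 d0 (Zsep M2 r rt) (Zsep M2 _ rh).
  rewrite -/dz in T.
  (* The space increment is expanded at time [r + h], then the space derivative is brought back to
     time [r] by weak continuity, and the time increment is taken at the fixed point [Z r]: this
     replaces joint differentiability. *)
  have -> : u (r + h) - u r - h%:C * du r =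
    (cauchyG (mu (r + h)) (Z (r + h)) - cauchyG (mu (r + h)) (Z r) +
       dz * cauchy2 (mu (r + h)) (Z r)) +
    - (dz - h%:C * a (Z r) (gh r)) * cauchy2 (mu (r + h)) (Z r) +
    - (h%:C * a (Z r) (gh r)) * (cauchy2 (mu (r + h)) (Z r) - cauchy2 (mu r) (Z r)) +
    (cauchyG (mu (r + h)) (Z r) - cauchyG (mu r) (Z r) - h%:C * ft) +
    - (gh (r + h) - gh r - h%:C * - b (Z r) (gh r)).
    by rewrite fte /u /du; ring.
  apply: le_trans (cabs_sum5 _ _ _ _ _) _.
  rewrite !cabsM !cabsN cabsM cabsr -/A.
  have T1 : 2 * (d^-1 ^+ 3 * cabs dz ^+ 2) <= e' * `|h|.
    rewrite mulrA -/k3; apply: (@le_trans _ _ (k3 * ((A + 1) * `|h|) ^+ 2)).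
      apply: ler_wpM2l; first exact: ltW.
      by rewrite lerXn2r ?nnegrE ?cabs_ge0// mulr_ge0//; lra.
    rewrite exprMn mulrA expr2 mulrA ler_wpM2r//.
    by move/ltW: h6; rewrite ler_pdivlMr// mulrC.
  have T2 := c2 _ _ _ mM2 (Zsep M2 r rt).
  have T3 : cabs (dz - h%:C * a (Z r) (gh r)) * cabs (cauchy2 (mu (r + h)) (Z r))
      <= e' * `|h| * k1 by apply: ler_pM => //; exact: cabs_ge0.
  have T4 : `|h| * A * cabs (cauchy2 (mu (r + h)) (Z r) - cauchy2 (mu r) (Z r))
      <= `|h| * A * e' by rewrite ler_wpM2l ?mulr_ge0// ltW.
  have -> : e = e' * N by rewrite /e' divfK// gt_eqF.
  rewrite /N; lra.
- move=> r rt; have [M1 mM1] := bs r (ge0 _ rt).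
  have gb : cabs (cauchyG (mu r) (Z r)) <= 2 * d^-1.
    exact: cabs_cauchy mM1 d0 (Zsep M1 r rt).
  have [L1 L2] := Lip r _ rt gb.
  rewrite /du; apply: le_trans (cabsD _ _) _; rewrite cabsM cabsN.
  rewrite (cabsBC (a _ _)) (cabsBC (b _ _)) mulrDl lerD// -mulrA.
  by apply: ler_pM; rewrite ?cabs_ge0//; exact: c2 mM1 (Zsep M1 r rt).
Qed.

Lemma path_derivative_eq (t : R) (u du du' : R -> R[i]) :
  (forall s, 0 <= s <= t -> du s = du' s) ->
  has_path_derivative t u du -> has_path_derivative t u du'.
Proof. by move=> E H s st e e0; rewrite -E//; exact: H. Qed.

Lemma path_derivative_cst (t : R) (c : R[i]) :
  has_path_derivative t (fun=> c) (fun=> 0).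
Proof.
move=> s st e e0; exists 1 => // h _ _.
by rewrite subrr mulr0 subr0 cabs0 mulr_ge0// ltW.
Qed.

Lemma path_derivative_id (t : R) : has_path_derivative t (fun s => s%:C) (fun=> 1).
Proof.
move=> s st e e0; exists 1 => // h _ _.
have -> : (s + h)%:C - s%:C - h%:C * 1 = 0 :> R[i] by rewrite rmorphD; ring.
by rewrite cabs0 mulr_ge0// ltW.
Qed.

Lemma path_derivativeD (t : R) (u du v dv : R -> R[i]) :
  has_path_derivative t u du -> has_path_derivative t v dv ->
  has_path_derivative t (fun s => u s + v s) (fun s => du s + dv s).
Proof.
move=> Hu Hv s st e e0; have e2 : 0 < e / 2 by lra.
have [d1 d10 H1] := Hu s st _ e2; have [d2 d20 H2] := Hv s st _ e2.
exists (Num.min d1 d2); first by rewrite lt_min d10 d20.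
move=> h; rewrite lt_min => /andP[h1 h2] sh.
have := cabsD (u (s + h) - u s - h%:C * du s) (v (s + h) - v s - h%:C * dv s).
rewrite (_ : u (s + h) + v (s + h) - _ - _ =
  (u (s + h) - u s - h%:C * du s) + (v (s + h) - v s - h%:C * dv s)); last by ring.
have := H1 h h1 sh; have := H2 h h2 sh; lra.
Qed.

Lemma path_derivativeM (t : R) (u du v dv : R -> R[i]) :
  has_path_derivative t u du -> has_path_derivative t v dv ->
  has_path_derivative t (fun s => u s * v s) (fun s => du s * v s + u s * dv s).
Proof.
move=> Hu Hv s st e e0.
set U := cabs (u s); set V := cabs (v s); set DV := cabs (dv s).
have [U0 V0 DV0] : [/\ 0 <= U, 0 <= V & 0 <= DV] by rewrite !cabs_ge0.
set N := U + V + DV + 2; have N0 : 0 < N by rewrite /N; lra.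
(* The cap at 1 bounds the increment of [u], hence controls the product of the two increments. *)
set e' := Num.min (e / N) 1.
have e'0 : 0 < e' by rewrite lt_min divr_gt0//= ltr01.
have [d1 d10 H1] := Hu s st _ e'0; have [d2 d20 H2] := Hv s st _ e'0.
have [d3 d30 H3] := path_derivative_continuous Hu st e'0.
exists (Num.min d1 (Num.min d2 d3)); first by rewrite !lt_min d10 d20.
move=> h; rewrite !lt_min => /and3P[h1 h2 h3] sh.
have {}H1 := H1 h h1 sh; have {}H2 := H2 h h2 sh; have {}H3 := H3 h h3 sh.
set a := u (s + h) - u s - h%:C * du s in H1.
set b := v (s + h) - v s - h%:C * dv s in H2.
set c := u (s + h) - u s in H3.
rewrite (_ : _ - _ - _ = a * v s + u s * b + c * b + c * (h%:C * dv s) + 0);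
  last by rewrite /a /b /c; ring.
apply: le_trans (cabs_sum5 _ _ _ _ _) _; rewrite !cabsM cabsr cabs0 addr0 -/U -/V -/DV.
have q1 : cabs a * V <= e' * `|h| * V by rewrite ler_wpM2r.
have q2 : U * cabs b <= U * (e' * `|h|) by rewrite ler_wpM2l.
have q3 : cabs c * cabs b <= 1 * (e' * `|h|).
  apply: ler_pM; rewrite ?cabs_ge0//; apply: le_trans (ltW H3) _.
  by rewrite /e' ge_min lexx orbT.
have q4 : cabs c * (`|h| * DV) <= e' * (`|h| * DV).
  by rewrite ler_wpM2r ?mulr_ge0// ltW.
have q5 : 0 <= e' * `|h| by rewrite mulr_ge0// ltW.
have : e' * `|h| * N <= e * `|h|.
  rewrite mulrAC ler_wpM2r// -ler_pdivlMr// /e' ge_min lexx//.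
rewrite /N; lra.
Qed.

Lemma path_derivativeV (t : R) (u du : R -> R[i]) :
  (forall s, 0 <= s <= t -> u s != 0) -> has_path_derivative t u du ->
  has_path_derivative t (fun s => (u s)^-1) (fun s => - du s / u s ^+ 2).
Proof.
move=> u0 Hu s st e e0; have us0 := u0 s st.
set U := cabs (u s); have U0 : 0 < U by rewrite cabs_gt0.
set DU := cabs (du s); have DU0 : 0 <= DU by exact: cabs_ge0.
(* |1/v - 1/u + h u'/u^2| = |(v - u - h u') u - (v - u) h u'| / |v u^2| *)
set N := 2 * (U + DU) / U ^+ 3; have N0 : 0 < N.
  by rewrite divr_gt0 ?exprn_gt0//; lra.
set e' := e / N; have e'0 : 0 < e' by rewrite divr_gt0.
have U20 : 0 < U / 2 by lra.
have [d1 d10 H1] := Hu s st _ e'0.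
have [d2 d20 H2] := path_derivative_continuous Hu st e'0.
have [d3 d30 H3] := path_derivative_continuous Hu st U20.
exists (Num.min d1 (Num.min d2 d3)); first by rewrite !lt_min d10 d20.
move=> h; rewrite !lt_min => /and3P[h1 h2 h3] sh.
have {}H1 := H1 h h1 sh; have {}H2 := H2 h h2 sh; have {}H3 := H3 h h3 sh.
have v0 := u0 _ sh.
rewrite (_ : _ - _ - _ = - ((u (s + h) - u s - h%:C * du s) * u s -
   (u (s + h) - u s) * (h%:C * du s)) / (u (s + h) * u s ^+ 2)); last first.
  by field; rewrite us0 v0.
rewrite cabsM cabsN cabsV cabsM cabsX -/U.
have vU : U / 2 <= cabs (u (s + h)).
  have := cabs_triB (u s) (u s - u (s + h)); rewrite subKr cabsBC -/U; lra.
rewrite ler_pdivrMr ?mulr_gt0 ?exprn_gt0 ?cabs_gt0//.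
apply: le_trans (cabsB _ _) _; rewrite !cabsM cabsr -/U -/DU.
have q1 : cabs (u (s + h) - u s - h%:C * du s) * U <= e' * `|h| * U.
  by rewrite ler_wpM2r// ltW.
have q2 : cabs (u (s + h) - u s) * (`|h| * DU) <= e' * (`|h| * DU).
  by rewrite ler_wpM2r ?mulr_ge0// ltW.
apply: (@le_trans _ _ (e * `|h| * (U / 2 * U ^+ 2))); last first.
  by rewrite ler_wpM2l ?mulr_ge0 ?(ltW e0)// ler_wpM2r ?exprn_ge0// ltW.
have -> : e = e' * N by rewrite /e' divfK// gt_eqF.
rewrite (_ : e' * N * `|h| * _ = e' * `|h| * (U + DU)); first by lra.
by rewrite /N; field; rewrite gt_eqF.
Qed.

End Characteristic.

(** * Laws on the half-line and imaginary parts *)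

Section HalfLine.
Context {R : realType}.
Implicit Types (mu : probability R R) (z w : R[i]) (M d : R).

Lemma measurable_abs : measurable_fun [set: R] (fun x : R => `|x|).
Proof. exact: measurableT_comp. Qed.

(** Replacing [x] by [|x|] turns bounds valid for [x >= 0] into bounds valid on the whole line, so
    that later integrals need no restricted domain. *)
Lemma Rintegral_halfline mu (f : R -> R) : on_halfline mu ->
  measurable_fun [set: R] f -> \int[mu]_x f x = \int[mu]_x f `|x|.
Proof.
move=> hm mf; congr fine; apply: ae_eq_integral => //.
- exact/measurable_EFinP.
- by apply/measurable_EFinP; apply: (measurableT_comp mf); exact: measurable_abs.
exists `]-oo, 0[%classic; split => //.
move=> x /= H; rewrite in_itv/= ltNge; apply/negP => x0; apply: H => _.
by rewrite ger0_norm.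
Qed.

Lemma Rintegral_halfline_ge0 mu (f : R -> R) : on_halfline mu ->
  measurable_fun [set: R] f -> (forall x, 0 <= x -> 0 <= f x) ->
  0 <= \int[mu]_x f x.
Proof.
move=> hm mf f0; rewrite Rintegral_halfline//.
by apply: Rintegral_ge0 => x _; exact: f0.
Qed.

Lemma supported_in_ge0 mu M : supported_in mu M -> 0 <= M.
Proof.
move=> mM; rewrite leNgt; apply/negP => M0; have : mu [set: R] = 0%E.
  move: mM; rewrite /supported_in set_itv_ge ?setC0//.
  by rewrite bnd_simp -ltNge; lra.
by rewrite probability_setT => -[] /eqP; rewrite oner_eq0.
Qed.

Lemma Im_kernel z (x : R) :
  Im (z - x%:C)^-1 = - Im z * (cabs (z - x%:C) ^- 2).
Proof. by rewrite ImV ImD ImN/= subr0. Qed.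

Lemma Im_zkernel z (x : R) :
  Im (z * (z - x%:C)^-1) = - Im z * (x * cabs (z - x%:C) ^- 2).
Proof. by rewrite ImM ReV ImV ReD ImD ReN ImN/=; ring. Qed.

Lemma measurable_kernel_sqr z : measurable_fun [set: R]
  (fun x : R => cabs (z - x%:C) ^- 2).
Proof.
apply: (measurableT_comp measurable_inv).
under eq_fun do rewrite cabs_sqr ReD ReN ImD ImN/= subr0.
apply: measurable_funD => //.
by apply: measurable_funX; apply: measurable_funD => //; exact: measurable_funN.
Qed.

(** More than a sign is kept: the factor [Im z] is explicit and [A] is bounded in terms of [d]
    alone, as [m_path_Im] needs arbitrarily close to the real axis. *)
Lemma Im_cauchy mu M d z : supported_in mu M -> 0 < d -> separated M d z ->
  exists2 A, 0 <= A <= d^-1 ^+ 2 &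
    Im (cauchyG mu z) = - Im z * A.
Proof.
move=> mM d0 Hz; have mk := measurable_kernel_sqr z.
have bk x : `|x| <= M -> `|cabs (z - x%:C) ^- 2| <= d^-1 ^+ 2.
  move=> xM; rewrite -exprVn -cabsV ger0_norm ?sqr_ge0//.
  rewrite lerXn2r ?nnegrE ?cabs_ge0 ?invr_ge0 ?(ltW d0)//.
  exact: separated_inv d0 Hz _ xM.
exists (\int[mu]_x (cabs (z - x%:C) ^- 2)).
  apply/andP; split.
    by apply: Rintegral_ge0 => x _; rewrite invr_ge0 sqr_ge0.
  by apply: le_trans (ler_norm _) _; exact: Rintegral_le_supp mM mk bk.
rewrite /= -RintegralZl//; last first.
  by apply: (bounded_integrable mM mk); exists (d^-1 ^+ 2).
by apply: eq_Rintegral => x _; rewrite Im_kernel.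
Qed.

(** Here [B] is the integral of [x / |z - x|^2], nonnegative because the support is in the
    half-line. *)
Lemma Im_zcauchy mu M d z : supported_in mu M -> on_halfline mu ->
  0 < d -> separated M d z ->
  exists2 B, 0 <= B <= M * d^-1 ^+ 2 &
    Im (z * cauchyG mu z) = - Im z * B.
Proof.
move=> mM hm d0 Hz.
have mk : measurable_fun [set: R] (fun x : R => x * cabs (z - x%:C) ^- 2).
  by apply: measurable_funM => //; exact: measurable_kernel_sqr.
have bk x : `|x| <= M -> `|x * cabs (z - x%:C) ^- 2| <= M * d^-1 ^+ 2.
  move=> xM; rewrite normrM; apply: ler_pM => //.
  rewrite -exprVn -cabsV ger0_norm ?sqr_ge0//.
  rewrite lerXn2r ?nnegrE ?cabs_ge0 ?invr_ge0 ?(ltW d0)//.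
  exact: separated_inv d0 Hz _ xM.
exists (\int[mu]_x (x * cabs (z - x%:C) ^- 2)).
  apply/andP; split.
    apply: (Rintegral_halfline_ge0 hm mk) => x x0.
    by rewrite mulr_ge0// invr_ge0 sqr_ge0.
  by apply: le_trans (ler_norm _) _; exact: Rintegral_le_supp mM mk bk.
rewrite -cintegralZ; last exact: cintegrable_kernel mM d0 Hz.
rewrite /= -RintegralZl//; last first.
  by apply: (bounded_integrable mM mk); exists (M * d^-1 ^+ 2).
by apply: eq_Rintegral => x _; rewrite Im_zkernel.
Qed.

End HalfLine.

(** * The explicit characteristics of the two equations *)

Section Flows.
Context {R : realType}.
Implicit Types (w m : R -> probability R R) (z g : R[i]).

Lemma path_derivative_lag (t : R) :
  has_path_derivative t (fun s => (t - s)%:C : R[i]) (fun=> -1).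
Proof.
have := path_derivativeD (@path_derivative_cst R t t%:C)
  (path_derivativeM (@path_derivative_cst R t (-1)) (@path_derivative_id R t)).
have -> : (fun s => t%:C + -1 * s%:C) = (fun s => (t - s)%:C : R[i]).
  by apply/funext => s; rewrite rmorphB; ring.
by apply: path_derivative_eq => s _; ring.
Qed.

Lemma w_characteristic w (t : R) z g : w_process w -> 0 < Im z ->
  Im g <= 0 ->
  forall s1, 0 <= s1 <= t -> cauchyG (w s1) (z - (t - s1)%:C * g) = g ->
  forall s, 0 <= s <= t -> cauchyG (w s) (z - (t - s)%:C * g) = g.
Proof.
move=> [bs wc pde] y0 g0.
apply: (@characteristic _ w _ _ t (Im z) 1
  (fun s => z - (t - s)%:C * g) (fun=> g) bs wc pde y0).
(* Going back in time [Im Z] does not decrease, because [Im g <= 0]. *)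
- move=> s /andP[s0 st]; rewrite ImD ImN ImrM.
  have : (t - s) * Im g <= 0 by rewrite mulr_ge0_le0// subr_ge0.
  lra.
- have := path_derivativeD (@path_derivative_cst R t z)
    (path_derivativeM (@path_derivative_lag t) (@path_derivative_cst R t (- g))).
  have -> : (fun s => z + (t - s)%:C * - g) = (fun s => z - (t - s)%:C * g).
    by apply/funext => s; rewrite mulrN.
  by apply: path_derivative_eq => s _; ring.
- apply: path_derivative_eq (@path_derivative_cst R t g) => s _.
  by rewrite oppr0.
- by move=> s h st hb; rewrite mul1r subrr cabs0 cabs_ge0.
Qed.

(** The line is fixed by the value of [w] at time [t]. It is followed back to time 0 with [w], where
    the two processes agree, and forward again with [w']. *)
Lemma w_unique w w' : w_process w -> w_process w' ->
  (forall z, 0 < Im z -> cauchyG (w 0) z = cauchyG (w' 0) z) ->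
  forall t z, 0 <= t -> 0 < Im z ->
    cauchyG (w t) z = cauchyG (w' t) z.
Proof.
move=> hw hw' e0 t z t0 y0; set g := cauchyG (w t) z.
have [bs _ _] := hw; have [M mM] := bs t t0.
have [A /andP[A0 _] Ag] := Im_cauchy mM y0 (@separated_Im _ M z).
have g0 : Im g <= 0.
  by rewrite /g Ag mulNr oppr_le0 mulr_ge0// ltW.
have tt : 0 <= t <= t by rewrite t0 lexx.
have t00 : 0 <= (0 : R) <= t by rewrite lexx t0.
have Zt : z - (t - t)%:C * g = z by rewrite subrr mul0r subr0.
have h1 := @w_characteristic w t z g hw y0 g0 t tt.
rewrite Zt in h1; have {}h1 := h1 erefl 0 t00.
have Z0 : 0 < Im (z - (t - 0)%:C * g).
  rewrite ImD ImN ImrM subr0.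
  have : t * Im g <= 0 by rewrite mulr_ge0_le0.
  lra.
rewrite e0// in h1.
have := @w_characteristic w' t z g hw' y0 g0 0 t00 h1 t tt.
by rewrite Zt => ->.
Qed.

(* The characteristic passing through [z] at time [t], along which the Cauchy
   transform is [g / (1 - g (t - s))]. *)
Definition m_path (lam t : R) z g (s : R) : R[i] :=
  (1 - g * (t - s)%:C) * (z * (1 - g * (t - s)%:C) + (1 - lam)%:C * (t - s)%:C).

Lemma m_characteristic (lam : R) m (t d : R) z g : m_process lam m -> 0 < d ->
  cabs g * t <= 1 / 2 ->
  (forall s, 0 <= s <= t -> d <= Im (m_path lam t z g s)) ->
  forall s1, 0 <= s1 <= t ->
    cauchyG (m s1) (m_path lam t z g s1) = g / (1 - g * (t - s1)%:C) ->
  forall s, 0 <= s <= t ->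
    cauchyG (m s) (m_path lam t z g s) = g / (1 - g * (t - s)%:C).
Proof.
move=> [bs0 wc pde] d0 gt hd.
have bs s : 0 <= s -> bounded_support (m s) by move=> /bs0[].
(* The hypothesis on [g] keeps the denominator [1 - g (t - s)] between 1/2 and 2 in modulus. *)
have ga s : 0 <= s <= t -> cabs (g * (t - s)%:C) <= 1 / 2.
  move=> /andP[s0 st]; rewrite cabsM cabsr ger0_norm ?subr_ge0//.
  by apply: le_trans gt; rewrite ler_wpM2l ?cabs_ge0//; lra.
have a2 s : 0 <= s <= t -> 1 / 2 <= cabs (1 - g * (t - s)%:C).
  by move=> st; have := cabs_triB 1 (g * (t - s)%:C); rewrite cabs1;
     have := ga s st; lra.
have a3 s : 0 <= s <= t -> cabs (1 - g * (t - s)%:C) <= 2.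
  by move=> st; have := cabsB 1 (g * (t - s)%:C); rewrite cabs1;
     have := ga s st; lra.
have a0 s : 0 <= s <= t -> 1 - g * (t - s)%:C != 0.
  by move=> st; rewrite -cabs_gt0; have := a2 s st; lra.
have da : has_path_derivative t (fun s => 1 - g * (t - s)%:C) (fun=> g).
  have := path_derivativeD (@path_derivative_cst R t 1)
    (path_derivativeM (@path_derivative_cst R t (- g)) (@path_derivative_lag t)).
  have -> : (fun s => 1 + - g * (t - s)%:C) = (fun s => 1 - g * (t - s)%:C).
    by apply/funext => s; rewrite mulNr.
  by apply: path_derivative_eq => s _; ring.
(* [B] bounds the path, so [2 * B] is a Lipschitz constant in [g] for the transport coefficient; the
   rest of [L] bounds [|h + gs|], the slope of [g^2]. *)
pose B := 2 * (2 * (cabs z * 2 + cabs (1 - lam)%:C * t)).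
pose L := 2 * B + (2 * d^-1 + 2 * cabs g).
apply: (@characteristic _ m _ _ t d L (m_path lam t z g)
  (fun s => g / (1 - g * (t - s)%:C)) bs wc pde d0 hd).
- have := path_derivativeM da (path_derivativeD
    (path_derivativeM (@path_derivative_cst R t z) da)
    (path_derivativeM (@path_derivative_cst R t (1 - lam)%:C)
      (@path_derivative_lag t))).
  apply: path_derivative_eq => s st; rewrite /m_path.
  by field; rewrite -rmorphB; exact: a0.
- have := path_derivativeM (@path_derivative_cst R t g) (path_derivativeV a0 da).
  apply: path_derivative_eq => s st; move: (a0 s st).
  by set a := 1 - g * _ => as0; field.
- move=> s h st hb.
  have t0 : 0 <= t by case/andP: st => s0; exact: le_trans.
  have gb : cabs (g / (1 - g * (t - s)%:C)) <= 2 * cabs g.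
    rewrite cabsM cabsV mulrC ler_wpM2r ?cabs_ge0//.
    rewrite -[leRHS]invrK lef_pV2 ?posrE ?cabs_gt0 ?a0//.
    by have := a2 s st; lra.
  have Zb : cabs (m_path lam t z g s) <= B.
    rewrite /m_path /B cabsM.
    have q : cabs (z * (1 - g * (t - s)%:C) + (1 - lam)%:C * (t - s)%:C) <=
        cabs z * 2 + cabs (1 - lam)%:C * t.
      apply: le_trans (cabsD _ _) _; rewrite (cabsM z) (cabsM (1 - lam)%:C).
      apply: lerD; apply: ler_wpM2l; rewrite ?cabs_ge0 ?a3//.
      by case/andP: st => s0 st; rewrite cabsr ger0_norm; lra.
    apply: le_trans (_ : _ <= 2 * (cabs z * 2 + cabs (1 - lam)%:C * t)) _.
      by apply: ler_pM; rewrite ?cabs_ge0 ?a3.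
    rewrite ler_peMl// ?ler1n// mulr_ge0// addr_ge0// mulr_ge0 ?cabs_ge0//.
  set gs := g / _ in gb *; set Z := m_path _ _ _ _ _ in Zb *.
  have B0 : 0 <= B by exact: le_trans (cabs_ge0 _) Zb.
  have hg := cabs_ge0 (h - gs); have gg := cabs_ge0 g.
  have dd : 0 < d^-1 by rewrite invr_gt0.
  split.
    have -> : 2 * Z * h - (1 - lam)%:C - (2 * Z * gs - (1 - lam)%:C) =
       (2 : R)%:C * Z * (h - gs).
      by rewrite (_ : (2 : R)%:C = 2); [ring|rewrite rmorph_nat].
    rewrite 2!cabsM cabsr ger0_norm// ler_wpM2r//.
    by rewrite /L; lra.
  have -> : h ^+ 2 - gs ^+ 2 = (h + gs) * (h - gs) by ring.
  rewrite cabsM ler_wpM2r//; apply: le_trans (cabsD _ _) _.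
  by rewrite /L; lra.
Qed.

(** This path may descend as time runs back. Its imaginary part is [Im z] times a factor that is
    close to at least 1 once [z] is large, however small [Im z] is; this uniformity is needed
    because [z = 1 / a] for all small [a] in the lower half-plane. *)
Lemma m_path_Im (lam : R) m (t : R) : m_process lam m -> 0 <= t ->
  exists2 r, 0 < r & forall z, 0 < Im z -> r <= cabs z ->
    let g := cauchyG (m t) z in
    cabs g * t <= 1 / 2 /\ forall s, 0 <= s <= t ->
      Im z / 2 <= Im (m_path lam t z g s).
Proof.
move=> [bs _ _] t0; have [[M mM] hm] := bs t t0.
have M0 := supported_in_ge0 mM.
(* The three terms of [C] bound those of [X] below, up to the factor [v]. [D] is such that
   [v D <= 1] gives at once [v t <= 1/4], [v t^2 C <= 1/2], [v <= 1] and [v M <= 1]. *)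
pose C := 4 + 2 * M + `|1 - lam|.
have C0 : 0 <= C by rewrite /C; have := normr_ge0 (1 - lam); lra.
pose D := 2 * t ^+ 2 * C + 4 * t + 1 + M.
have tC : 0 <= t ^+ 2 * C by rewrite mulr_ge0// sqr_ge0.
have D0 : 1 <= D by rewrite /D; lra.
exists (D + M); first by lra.
move=> z y0 zr g; set y := Im z in y0 *.
pose d := cabs z - M; have d1 : D <= d by rewrite /d; lra.
have d0 : 0 < d by lra.
have sep : separated M d z by exact: separated_cabs.
have gb := cabs_cauchy mM d0 sep; rewrite -/g in gb.
have [A /andP[A0 A1] AE] := Im_cauchy mM d0 sep; rewrite -/g -/y in AE.
have [B /andP[B0 B1] BE] := Im_zcauchy mM hm d0 sep; rewrite -/g -/y in BE.
set v := d^-1 in gb A1 B1.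
have v0 : 0 < v by rewrite invr_gt0.
have vd : v * d = 1 by rewrite mulVf// gt_eqF.
have vD : v * D <= 1 by rewrite -vd ler_wpM2l// ltW.
have v1 : v <= 1 by have := ler_wpM2l (ltW v0) D0; lra.
have vt : 0 <= v * t by rewrite mulr_ge0// ltW.
have vM : 0 <= v * M by rewrite mulr_ge0// ltW.
have vtC : 0 <= v * (t ^+ 2 * C) by rewrite mulr_ge0// ltW.
have vDE : v * D = 2 * (v * (t ^+ 2 * C)) + 4 * (v * t) + v + v * M.
  by rewrite /D; ring.
split.
  by have := ler_wpM2r t0 gb; lra.
move=> s /andP[s0 st]; pose tau := t - s.
have tau0 : 0 <= tau by rewrite /tau subr_ge0.
have taut : tau <= t by rewrite /tau; lra.
have ZE : Im (m_path lam t z g s) = y * (1 + 2 * (tau * B) -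
    tau ^+ 2 * (A * Re (z * g) + B * Re g - (1 - lam) * A)).
  rewrite (_ : m_path _ _ _ _ _ = z - 2 * tau%:C * (z * g) +
      (tau ^+ 2)%:C * ((z * g) * g) + (1 - lam)%:C * tau%:C -
      ((1 - lam) * tau ^+ 2)%:C * g); last first.
    by rewrite /m_path -/tau; ring.
  rewrite (_ : 2 * tau%:C = (2 * tau)%:C); last by rewrite rmorphM rmorph_nat.
  rewrite !ImD !ImN !ImrM (ImM (z * g) g) BE AE -/y.
  rewrite (_ : Im tau%:C = 0)//; ring.
rewrite ZE ler_wpM2l ?(ltW y0)//.
have zg : `|Re (z * g)| <= 4.
  apply: le_trans (cabs_Re _) _; rewrite cabsM.
  apply: le_trans (ler_wpM2l (cabs_ge0 z) gb) _.
  have -> : cabs z = d + M by rewrite /d subrK.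
  have -> : (d + M) * (2 * v) = 2 * (v * d) + 2 * (v * M) by ring.
  lra.
have g2 : `|Re g| <= 2.
  by apply: le_trans (cabs_Re _) _; lra.
set X := A * Re (z * g) + B * Re g - (1 - lam) * A.
have v2 : v ^+ 2 <= v by rewrite expr2 -[leRHS]mulr1 ler_wpM2l// ltW.
have Xb : X <= v * C.
  have h1 : A * Re (z * g) <= v * 4.
    apply: le_trans (ler_norm _) _; rewrite normrM (ger0_norm A0).
    by apply: ler_pM => //; exact: le_trans A1 v2.
  have h2 : B * Re g <= v * (2 * M).
    apply: le_trans (ler_norm _) _; rewrite normrM (ger0_norm B0).
    apply: le_trans (_ : _ <= (M * v ^+ 2) * 2) _; first exact: ler_pM.
    have := ler_wpM2l M0 v2; lra.
  have h3 : - ((1 - lam) * A) <= v * `|1 - lam|.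
    apply: le_trans (ler_norm _) _; rewrite normrN normrM mulrC (ger0_norm A0).
    by apply: ler_wpM2r => //; exact: le_trans A1 v2.
  by rewrite /X /C; lra.
have XT : tau ^+ 2 * X <= v * (t ^+ 2 * C).
  apply: le_trans (ler_wpM2l (sqr_ge0 tau) Xb) _.
  rewrite mulrCA ler_wpM2l ?(ltW v0)// ler_wpM2r//.
  by rewrite lerXn2r ?nnegrE.
have : 0 <= tau * B by rewrite mulr_ge0.
lra.
Qed.

(** The same exchange of processes at time 0 as for [w], restricted to large [z] where the path
    stays in the upper half-plane; this is enough to recover the moments. *)
Lemma m_unique (lam : R) m m' : m_process lam m -> m_process lam m' ->
  (forall z, 0 < Im z -> cauchyG (m 0) z = cauchyG (m' 0) z) ->
  forall t, 0 <= t -> exists2 r, 0 < r &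
    forall z, 0 < Im z -> r <= cabs z ->
      cauchyG (m t) z = cauchyG (m' t) z.
Proof.
move=> hm hm' e0 t t0; have [r r0 Hr] := m_path_Im hm t0.
exists r => // z y0 zr; have [gt hd] := Hr z y0 zr.
set g := cauchyG (m t) z in gt hd *.
have d0 : 0 < Im z / 2 by lra.
have tt : 0 <= t <= t by rewrite t0 lexx.
have t00 : 0 <= (0 : R) <= t by rewrite lexx t0.
have Zt : m_path lam t z g t = z.
  by rewrite /m_path subrr; ring.
have gE : g = g / (1 - g * (t - t)%:C) by rewrite subrr mulr0 subr0 divr1.
have h1 := @m_characteristic lam m t _ z g hm d0 gt hd t tt.
rewrite Zt -gE in h1; have {}h1 := h1 erefl 0 t00.
have Z0 : 0 < Im (m_path lam t z g 0) by have := hd 0 t00; lra.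
rewrite e0// in h1.
have := @m_characteristic lam m' t _ z g hm' d0 gt hd 0 t00 h1 t tt.
by rewrite Zt -gE => ->.
Qed.

End Flows.

(** * Continuity over [R[i]] and extension by conjugation *)

Section ComplexContinuity.
Context {R : realType}.
Implicit Types (f g : R[i] -> R[i]) (z c : R[i]).

Lemma cts_id z : {for z, continuous (fun x : R[i] => x)}.
Proof. exact: cvg_id. Qed.

Lemma cts_cst z c : {for z, continuous (fun _ : R[i] => c)}.
Proof. exact: (@cst_continuous _ _ c z). Qed.

Lemma cts_comp f g z : {for z, continuous f} -> {for f z, continuous g} ->
  {for z, continuous (fun x => g (f x))}.
Proof. by move=> cf cg; exact: (@continuous_comp _ _ _ f g z cf cg). Qed.

Lemma cts_eps f z : {for z, continuous f} -> forall e : R, 0 < e ->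
  exists2 d : R, 0 < d & forall w, cabs (z - w) < d -> cabs (f z - f w) < e.
Proof.
move=> cf e e0; have h : nbhs (f z) [set w | cabs (f z - w) < e].
  by apply/nbhs_cabsP; exists e.
by have /nbhs_cabsP[d d0 dH] := cf _ h; exists d.
Qed.

Lemma eps_cts f z : (forall e : R, 0 < e ->
  exists2 d : R, 0 < d & forall w, cabs (z - w) < d -> cabs (f z - f w) < e) ->
  {for z, continuous f}.
Proof.
move=> H A /nbhs_cabsP[e e0 eA]; have [d d0 dH] := H e e0.
by apply/nbhs_cabsP; exists d => // w /dH; exact: eA.
Qed.

Lemma ctsD f g z : {for z, continuous f} -> {for z, continuous g} ->
  {for z, continuous (fun x => f x + g x)}.
Proof.
move=> cf cg; apply: eps_cts => e e0; have e2 : 0 < e / 2 by lra.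
have [d1 d10 H1] := cts_eps cf e2; have [d2 d20 H2] := cts_eps cg e2.
exists (Num.min d1 d2); first by rewrite lt_min d10 d20.
move=> w; rewrite lt_min => /andP[/H1 w1 /H2 w2].
rewrite opprD addrACA; apply: le_lt_trans (cabsD _ _) _; lra.
Qed.

Lemma ctsM f g z : {for z, continuous f} -> {for z, continuous g} ->
  {for z, continuous (fun x => f x * g x)}.
Proof.
move=> cf cg; apply: eps_cts => e e0.
set U := cabs (f z); set V := cabs (g z).
have [U0 V0] : 0 <= U /\ 0 <= V by rewrite !cabs_ge0.
set N := U + V + 2; have N0 : 0 < N by rewrite /N; lra.
set e' := Num.min (e / N) 1.
have e'0 : 0 < e' by rewrite lt_min divr_gt0//= ltr01.
have [d1 d10 H1] := cts_eps cf e'0; have [d2 d20 H2] := cts_eps cg e'0.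
exists (Num.min d1 d2); first by rewrite lt_min d10 d20.
move=> w; rewrite lt_min => /andP[/H1 w1 /H2 w2].
have -> : f z * g z - f w * g w = (f z - f w) * g z +
   (f z * (g z - g w) - (f z - f w) * (g z - g w)) by ring.
have := cabsD ((f z - f w) * g z)
  (f z * (g z - g w) - (f z - f w) * (g z - g w)).
have := cabsB (f z * (g z - g w)) ((f z - f w) * (g z - g w)).
rewrite !cabsM -/U -/V.
have q1 := ler_wpM2r V0 (ltW w1); have q2 := ler_wpM2l U0 (ltW w2).
have q3 : cabs (f z - f w) * cabs (g z - g w) <= 1 * e'.
  apply: ler_pM; rewrite ?cabs_ge0// ltW//.
  by apply: lt_le_trans w1 _; rewrite /e' ge_min lexx orbT.
have : e' * N <= e by rewrite -ler_pdivlMr// /e' ge_min lexx.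
rewrite /N; lra.
Qed.

Lemma ctsB f g z : {for z, continuous f} -> {for z, continuous g} ->
  {for z, continuous (fun x => f x - g x)}.
Proof.
move=> cf cg; rewrite (_ : (fun x => _) = (fun x => f x + -1 * g x)).
  exact: ctsD cf (ctsM (@cts_cst z (-1)) cg).
by apply/funext => x; rewrite mulN1r.
Qed.

Lemma ctsV f z : {for z, continuous f} -> f z != 0 ->
  {for z, continuous (fun x => (f x)^-1)}.
Proof.
move=> cf fz; apply: eps_cts => e e0.
set U := cabs (f z); have U0 : 0 < U by rewrite cabs_gt0.
have U20 : 0 < U / 2 by lra.
have c0 : 0 < e * (U ^+ 2 / 2) by rewrite !mulr_gt0// exprn_gt0.
have [d1 d10 H1] := cts_eps cf U20; have [d2 d20 H2] := cts_eps cf c0.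
exists (Num.min d1 d2); first by rewrite lt_min d10 d20.
move=> w; rewrite lt_min => /andP[/H1 w1 /H2 w2].
have Uw : U / 2 <= cabs (f w).
  have := cabs_triB (f z) (f z - f w); rewrite subKr -/U; lra.
have fw : f w != 0 by rewrite -cabs_gt0; lra.
have -> : (f z)^-1 - (f w)^-1 = - (f z - f w) / (f z * f w).
  by field; rewrite fz fw.
rewrite cabsM cabsN cabsV cabsM -/U ltr_pdivrMr; last first.
  by rewrite mulr_gt0// cabs_gt0.
apply: lt_le_trans w2 _; apply: ler_wpM2l; first exact: ltW.
by rewrite expr2 -mulrA; apply: ler_wpM2l; first exact: ltW.
Qed.

Lemma lipschitz_cts f z (C r : R) : 0 < r ->
  (forall w, cabs (z - w) < r -> cabs (f z - f w) <= C * cabs (z - w)) ->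
  {for z, continuous f}.
Proof.
move=> r0 H; apply: eps_cts => e e0.
pose c := `|C| + 1; have c0 : 0 < c by rewrite /c; have := normr_ge0 C; lra.
exists (Num.min r (e / c)); first by rewrite lt_min r0 divr_gt0.
move=> w; rewrite lt_min => /andP[wr we]; apply: le_lt_trans (H _ wr) _.
move: we; rewrite ltr_pdivlMr//; apply: le_lt_trans.
rewrite mulrC ler_wpM2l ?cabs_ge0// /c; have := ler_norm C; lra.
Qed.

(* A continuous function commuting with conjugation that vanishes in the lower
   half of a disk vanishes on the whole disk. *)
Lemma conj_extend f (r : R) :
  (forall z, cabs z < r -> Im z < 0 -> f z = 0) ->
  (forall z, cabs z < r -> f (conjc z) = conjc (f z)) ->
  (forall z, cabs z < r -> {for z, continuous f}) ->
  forall z, cabs z < r -> f z = 0.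
Proof.
move=> f0 fJ fc z zr.
have [zlt|zgt|z0] := ltgtP (Im z) 0; first exact: f0.
  have Jr : cabs (conjc z) < r by rewrite !cabsE in zr *; case: (z) zr => a b /=; rewrite sqrrN.
  have Jz : Im (conjc z) < 0 by case: (z) zgt => a b /=; rewrite oppr_lt0.
  have := fJ _ Jr; rewrite (f0 _ Jr Jz) conjcK => ->.
  exact: conjc0.
(* On the real axis, [f z] is approached by [f (z - i h)], which vanishes. *)
apply: cabs_small => e e0; have [d d0 dH] := cts_eps (fc _ zr) e0.
pose h := Num.min (d / 2) ((r - cabs z) / 2).
have rz : 0 < r - cabs z by rewrite subr_gt0.
have h0 : 0 < h by rewrite lt_min !divr_gt0.
have hd : h < d by rewrite gt_min; apply/orP; left; lra.
have hr : h < r - cabs z by rewrite gt_min; apply/orP; right; lra.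
pose w := z - 'i%C * h%:C.
have ch : cabs ('i%C * h%:C) = h.
  by rewrite cabsM cabsr (gtr0_norm h0) cabsE/= expr0n/= add0r expr1n sqrtr1 mul1r.
have fw : f w = 0.
  apply: f0; first by apply: le_lt_trans (cabsB _ _) _; rewrite ch; lra.
  by rewrite /w ImD ImN ImM z0/= mul1r mul0r !add0r oppr_lt0.
have := dH w; rewrite fw subr0; apply.
by rewrite /w opprB addrC subrK ch.
Qed.

End ComplexContinuity.

(** * The transform [Psi] near 0 *)

Section PsiNearZero.
Context {R : realType}.
Implicit Types (mu : probability R R) (z w a b : R[i]) (M : R).

(** Keeps [1 - x a] of modulus at least 1/2 on the support, for [a] in any direction, real axis
    included. *)
Definition near0 M a := M * cabs a <= 1 / 2.

Lemma near0_den M a (x : R) : near0 M a -> `|x| <= M ->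
  1 / 2 <= cabs (1 - x%:C * a).
Proof.
move=> na xM; have := cabs_triB 1 (x%:C * a); rewrite cabs1 cabsM cabsr.
have := ler_wpM2r (cabs_ge0 a) xM; rewrite /near0 in na; lra.
Qed.

Lemma near0_neq0 M a (x : R) : near0 M a -> `|x| <= M -> 1 - x%:C * a != 0.
Proof. by move=> na xM; rewrite -cabs_gt0; have := near0_den na xM; lra. Qed.

Lemma near0_inv M a (x : R) : near0 M a -> `|x| <= M ->
  cabs (1 - x%:C * a)^-1 <= 2.
Proof.
move=> na xM; have H := near0_den na xM.
by rewrite cabsV -[leRHS]invrK lef_pV2 ?posrE//; lra.
Qed.

Lemma near0_lt M a : 0 <= M -> cabs a < (2 * (M + 1))^-1 -> near0 M a.
Proof.
move=> M0 H; rewrite /near0.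
have M1 : 0 < 2 * (M + 1) by lra.
have : cabs a * (2 * (M + 1)) < 1 by rewrite -ltr_pdivlMr// div1r.
have := cabs_ge0 a; lra.
Qed.

Lemma Psi_kernel_bound M a (x : R) : near0 M a -> `|x| <= M ->
  cabs (x%:C * a / (1 - x%:C * a)) <= 2 * M * cabs a.
Proof.
move=> na xM; rewrite cabsM mulrC -mulrA; apply: ler_pM; rewrite ?cabs_ge0//.
  exact: near0_inv na xM.
by rewrite cabsM cabsr ler_wpM2r ?cabs_ge0.
Qed.

Lemma cintegrable_Psi mu M a : supported_in mu M -> near0 M a ->
  cintegrable mu (fun x => x%:C * a / (1 - x%:C * a)).
Proof.
move=> mM na; apply: (cintegrable_supp mM); first by cmeas.
by exists (2 * M * cabs a) => x; exact: Psi_kernel_bound.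
Qed.

Lemma cabs_Psi mu M a : supported_in mu M -> near0 M a ->
  cabs (Psi mu a) <= 4 * M * cabs a.
Proof.
move=> mM na; apply: le_trans (_ : _ <= 2 * (2 * M * cabs a)) _; last by lra.
apply: (cabs_cintegral_supp mM); first by cmeas.
by move=> x; exact: Psi_kernel_bound.
Qed.

(** No half-plane is imposed on [a]: it is enough that [a^-1] be away from the support. *)
Lemma cauchy_Psi mu M a : supported_in mu M -> a != 0 -> near0 M a ->
  cauchyG mu a^-1 = a * (1 + Psi mu a).
Proof.
move=> mM a0 na; have ia := cintegrable_Psi mM na.
have i1 : cintegrable mu (fun=> 1).
  by apply: (cintegrable_supp mM); [cmeas|exists 1 => x _; rewrite cabs1].
rewrite -[1 in RHS](cintegral_cst mu 1) -cintegralD// -cintegralZ; last first.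
  exact: cintegrableD.
apply: (eq_cintegral_supp mM); [by cmeas|by cmeas|].
move=> x xM; have h := near0_neq0 na xM.
by field; rewrite a0 h.
Qed.

(** The divided difference of [Psi]; it tends to the mean as both points tend to 0, and local
    injectivity is read on it. *)
Definition Psi_slope mu a b :=
  cintegral mu (fun x => x%:C / ((1 - x%:C * a) * (1 - x%:C * b))).

Lemma Psi_sub mu M a b : supported_in mu M -> near0 M a -> near0 M b ->
  Psi mu a - Psi mu b = (a - b) * Psi_slope mu a b.
Proof.
move=> mM na nb; rewrite -cintegralB; [|exact: cintegrable_Psi mM _..].
rewrite -cintegralZ.
  apply: (eq_cintegral_supp mM); [by cmeas|by cmeas|].
  move=> x xM; have h := near0_neq0 na xM; have h' := near0_neq0 nb xM.
  by field; rewrite h h'.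
apply: (cintegrable_supp mM); first by cmeas.
exists (M * (2 * 2)) => x xM; rewrite cabsM invfM !cabsM cabsr.
apply: ler_pM; rewrite ?mulr_ge0 ?cabs_ge0//.
by apply: ler_pM; rewrite ?cabs_ge0//; exact: near0_inv _ xM.
Qed.

Lemma Psi_lipschitz mu M a b : supported_in mu M -> near0 M a -> near0 M b ->
  cabs (Psi mu a - Psi mu b) <= 8 * M * cabs (a - b).
Proof.
move=> mM na nb; rewrite (Psi_sub mM na nb) cabsM mulrC ler_wpM2r ?cabs_ge0//.
apply: le_trans (_ : _ <= 2 * (M * (2 * 2))) _; last by lra.
apply: (cabs_cintegral_supp mM); first by cmeas.
move=> x xM; rewrite cabsM invfM !cabsM cabsr.
apply: ler_pM; rewrite ?mulr_ge0 ?cabs_ge0//.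
by apply: ler_pM; rewrite ?cabs_ge0//; exact: near0_inv _ xM.
Qed.

Lemma Psi_cts mu M a : supported_in mu M -> cabs a < (2 * (M + 1))^-1 ->
  {for a, continuous (Psi mu)}.
Proof.
move=> mM ar; have M0 := supported_in_ge0 mM.
apply: (@lipschitz_cts _ _ _ (8 * M) ((2 * (M + 1))^-1 - cabs a)).
  by rewrite subr_gt0.
move=> w wr; apply: Psi_lipschitz => //; apply: near0_lt => //.
by have := cabs_triB w a; rewrite cabsBC; lra.
Qed.

Lemma conjcM a b : conjc (a * b) = conjc a * conjc b.
Proof. by case: a; case: b => c d e f; rewrite /conjc; simpc; congr (_ +i* _); ring. Qed.

Lemma conjcB a b : conjc (a - b) = conjc a - conjc b.
Proof. by case: a; case: b => c d e f; rewrite /conjc; simpc; congr (_ +i* _); ring. Qed.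

Lemma conjcD a b : conjc (a + b) = conjc a + conjc b.
Proof. by case: a; case: b => c d e f; rewrite /conjc; simpc; congr (_ +i* _); ring. Qed.

Lemma Psi_conj mu M a : supported_in mu M -> near0 M a ->
  Psi mu (conjc a) = conjc (Psi mu a).
Proof.
move=> mM na; have [i1 i2] := cintegrable_Psi mM na.
have e x : x%:C * conjc a / (1 - x%:C * conjc a) =
    conjc (x%:C * a / (1 - x%:C * a)).
  by rewrite conjcM conjc_inv conjcB conjcM conjc_real conjc1.
rewrite /Psi /cintegral; apply: complex_eqP => /=.
  by apply: eq_Rintegral => x _; rewrite e; case: (_ / _).
rewrite -mulN1r -RintegralZl//; apply: eq_Rintegral => x _.
by rewrite e mulN1r; case: (_ / _).
Qed.

End PsiNearZero.

(** * Transport of [Psi] from time [t] to time 0 *)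

Section PsiFlows.
Context {R : realType}.
Implicit Types (w m : R -> probability R R) (z a : R[i]).

Lemma conjc_r (x : R) : conjc (x%:C) = x%:C :> R[i].
Proof. exact: conjc_real. Qed.

Lemma cabs_lt_inv (K : R) a : 0 < K -> cabs a < K^-1 -> cabs a * K < 1.
Proof. by move=> K0; rewrite -[K^-1]div1r ltr_pdivlMr. Qed.

Lemma cabs_1B_ge a (e : R) : cabs a <= e -> 1 - e <= cabs (1 - a).
Proof. by move=> ae; have := cabs_triB 1 a; rewrite cabs1; lra. Qed.

Lemma neq0_1B a (e : R) : e < 1 -> cabs a <= e -> 1 - a != 0.
Proof. by move=> e1 /cabs_1B_ge H; rewrite -cabs_gt0; lra. Qed.

Lemma Psi_growth mu (M : R) a : supported_in mu M -> near0 M a ->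
  cabs (a * (1 + Psi mu a)) <= 3 * cabs a.
Proof.
move=> mM na; rewrite cabsM mulrC ler_wpM2r ?cabs_ge0//.
apply: le_trans (cabsD _ _) _; rewrite cabs1.
by have := cabs_Psi mM na; rewrite /near0 in na; lra.
Qed.

Lemma common_support (mu nu : probability R R) : bounded_support mu ->
  bounded_support nu -> exists M, supported_in mu M /\ supported_in nu M.
Proof.
move=> [M1 h1] [M2 h2]; exists (Num.max M1 M2); split.
  by apply: supported_in_le h1; rewrite le_max lexx.
by apply: supported_in_le h2; rewrite le_max lexx orbT.
Qed.

Lemma Im_inv_gt0 a : Im a < 0 -> 0 < Im a^-1.
Proof.
move=> ya; rewrite ImV divr_gt0 ?oppr_gt0// exprn_gt0// cabs_gt0.
by apply: contraTneq ya => ->; rewrite ltxx.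
Qed.

(* Since [G (1 / a) = a (1 + Psi a)], this is the characteristic from [1 / a]. *)
Lemma w_flow_Psi w (t : R) : w_process w -> 0 <= t ->
  exists2 r, 0 < r & forall a, cabs a < r ->
    let z := Psi (w t) a in let g := a * (1 + z) in
    [/\ cabs g <= 3 * cabs a, cabs (t%:C * g * a) <= 3 * t * cabs a ^+ 2,
        cabs (t%:C * g * a) <= 1 / 2 &
        Psi (w 0) (a / (1 - t%:C * g * a)) = z - t%:C * g ^+ 2].
Proof.
move=> hw t0; have [bs _ _] := hw.
have [M [m0 mt]] := common_support (bs 0 (lexx 0)) (bs t t0).
have M0 := supported_in_ge0 m0.
(* On the disk of radius [K^-1], the term [6 t] gives [3 t |a|^2 <= 1/2], so the transported point
   is at most [2 |a|]; then [4 (M + 1)] keeps it where [near0] holds. *)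
pose K := 4 * (M + 1) + 6 * t; have K0 : 0 < K by rewrite /K; lra.
have bnd a : cabs a < K^-1 -> [/\ near0 M a, near0 M a,
    cabs (a * (1 + Psi (w t) a)) <= 3 * cabs a &
    cabs (t%:C * (a * (1 + Psi (w t) a)) * a) <= 3 * t * cabs a ^+ 2 /\
    cabs (t%:C * (a * (1 + Psi (w t) a)) * a) <= 1 / 2].
  move=> /(cabs_lt_inv K0); rewrite /K => aK; have a0 := cabs_ge0 a.
  have ta : 0 <= cabs a * t by rewrite mulr_ge0.
  have Ma : 0 <= cabs a * M by rewrite mulr_ge0.
  have na : near0 M a by rewrite /near0; lra.
  have gb := Psi_growth mt na.
  have q : cabs (t%:C * (a * (1 + Psi (w t) a)) * a) <= 3 * t * cabs a ^+ 2.
    rewrite 2!cabsM cabsr ger0_norm//.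
    have := ler_wpM2r a0 (ler_wpM2l t0 gb).
    by rewrite (_ : t * (3 * cabs a) * cabs a = 3 * t * cabs a ^+ 2)//; ring.
  split => //; split => //; apply: le_trans q _.
  have a1 : cabs a <= 1 by lra.
  by have := ler_wpM2l ta a1; rewrite expr2; lra.
(* The defect of the identity. It vanishes for [Im a < 0], where [a^-1] lies in the domain of the
   equation; [conj_extend] covers the rest of the disk. *)
pose F a := Psi (w 0) (a / (1 - t%:C * (a * (1 + Psi (w t) a)) * a)) -
  (Psi (w t) a - t%:C * (a * (1 + Psi (w t) a)) ^+ 2).
have half1 : (1 / 2 : R) < 1 by lra.
have den a : cabs a < K^-1 ->
    1 - t%:C * (a * (1 + Psi (w t) a)) * a != 0 /\
    cabs (a / (1 - t%:C * (a * (1 + Psi (w t) a)) * a)) < (2 * (M + 1))^-1.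
  move=> aK; have [_ _ _ [_ q]] := bnd a aK; have d0 := neq0_1B half1 q.
  split => //; have := cabs_1B_ge q => dh.
  rewrite cabsM cabsV ltr_pdivrMr ?cabs_gt0//.
  have M1 : 0 < 2 * (M + 1) by lra.
  rewrite -ltr_pdivrMl ?invr_gt0// invrK.
  have := cabs_lt_inv K0 aK; rewrite /K; have := mulr_ge0 (cabs_ge0 a) t0.
  lra.
suff F0 a : cabs a < K^-1 -> F a = 0.
  exists K^-1; first by rewrite invr_gt0.
  move=> a aK /=; have [_ _ q1 [q2 q3]] := bnd a aK; split => //.
  by apply/eqP; rewrite -subr_eq0; apply/eqP; exact: F0.
have KM : K^-1 <= (2 * (M + 1))^-1.
  by rewrite lef_pV2 ?posrE// /K; lra.
apply: (@conj_extend _ F K^-1).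
- move=> {}a aK ya; have [na _ _ _] := bnd a aK.
  have a0 : a != 0 by apply: contraTneq ya => ->; rewrite ltxx.
  have yi := Im_inv_gt0 ya.
  have := cauchy_Psi mt a0 na; set g := a * (1 + _) => gE.
  have [A /andP[A0 _] Ag] := Im_cauchy mt yi (@separated_Im _ M _).
  have g0 : Im g <= 0.
    by rewrite -gE Ag mulNr oppr_le0 mulr_ge0// ltW.
  have tt : 0 <= t <= t by rewrite t0 lexx.
  have t00 : 0 <= (0 : R) <= t by rewrite lexx t0.
  have h1 := @w_characteristic _ w t a^-1 g hw yi g0 t tt.
  rewrite subrr mul0r subr0 in h1; have {}h1 := h1 gE 0 t00.
  have [d0 dr] := den a aK; rewrite -/g in d0 dr.
  rewrite subr0 in h1.
  set b := a / (1 - t%:C * g * a) in dr.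
  have b0 : b != 0 by rewrite mulf_neq0 ?invr_neq0.
  have bE : b^-1 = a^-1 - t%:C * g by rewrite /b; field; rewrite a0 d0.
  have nb : near0 M b by exact: near0_lt.
  have := cauchy_Psi m0 b0 nb; rewrite bE h1 => gb.
  rewrite /F -/g -/b.
  have -> : Psi (w 0) b = g / b - 1.
    by rewrite gb mulrC mulKf// addrC addKr.
  have -> : Psi (w t) a = g / a - 1.
    by rewrite /g mulrC mulKf// addrC addKr.
  by rewrite bE; field.
- move=> {}a aK; have [na _ _ _] := bnd a aK.
  have [_ dr] := den a aK.
  have nb := near0_lt M0 dr.
  pose g a := a * (1 + Psi (w t) a).
  have gJ : g (conjc a) = conjc (g a).
    by rewrite /g (Psi_conj mt na) conjcM conjcD conjc1.
  rewrite /F -!/(g _) gJ (Psi_conj mt na) !conjcB -(Psi_conj m0 nb).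
  by rewrite expr2 !(conjcM, conjc_inv, conjcB, conjc_r, conjc1) -expr2.
- move=> {}a aK; have [d0 dr] := den a aK.
  have ar := lt_le_trans aK KM.
  have cP : {for a, continuous (Psi (w t))} by exact: Psi_cts mt ar.
  have cg : {for a, continuous (fun a => a * (1 + Psi (w t) a))} :=
    ctsM (@cts_id R a) (ctsD (@cts_cst R a 1) cP).
  have cD : {for a, continuous
      (fun a => 1 - t%:C * (a * (1 + Psi (w t) a)) * a)} :=
    ctsB (@cts_cst R a 1)
      (ctsM (ctsM (@cts_cst R a t%:C) cg) (@cts_id R a)).
  have c2 : {for a, continuous (fun a => (a * (1 + Psi (w t) a)) ^+ 2)} :=
    ctsM cg cg.
  have cb := ctsM (@cts_id R a) (ctsV cD d0).
  exact (ctsB (cts_comp cb (Psi_cts m0 dr)) (ctsB cP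
    (ctsM (@cts_cst R a t%:C) c2))).
Qed.

(** The path through [1 / a] starts at time 0 from [u v / a], with value [g / u] there. Hence [Psi]
    at time 0 is [(g / u) (u v / a) - 1 = (1 + z) v - 1]. *)
Lemma m_flow_Psi (lam : R) m (t : R) : m_process lam m -> 0 <= t ->
  exists2 r, 0 < r & forall a, cabs a < r ->
    let z := Psi (m t) a in let g := a * (1 + z) in
    let u := 1 - g * t%:C in let v := u + (1 - lam)%:C * t%:C * a in
    [/\ cabs g <= 3 * cabs a, 1 / 2 <= cabs u, 1 / 2 <= cabs v &
        Psi (m 0) (a / (u * v)) = z - g * t%:C * (z + lam%:C)].
Proof.
move=> hm t0; have [bs' _ _] := hm.
have bs s : 0 <= s -> bounded_support (m s) by move=> /bs'[].
have [M [m0 mt]] := common_support (bs 0 (lexx 0)) (bs t t0).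
have M0 := supported_in_ge0 m0.
have [rho rho0 Hrho] := m_path_Im hm t0.
set k := `|1 - lam|.
have k0 : 0 <= k by exact: normr_ge0.
have kt : 0 <= k * t by rewrite mulr_ge0.
(* [12 t] and [4 k t] make the perturbations of 1 in [u] and [v] at most 1/4 each; then
   [|u v| >= 1/4] and [8 (M + 1)] keeps [a / (u v)] near 0, while [rho] makes [1 / a] large enough
   for [m_path_Im]. *)
pose K := 8 * (M + 1) + 12 * t + 4 * (k * t) + rho.
have K0 : 0 < K by rewrite /K; lra.
pose g a := a * (1 + Psi (m t) a).
pose u a := 1 - g a * t%:C.
pose v a := u a + (1 - lam)%:C * t%:C * a.
have bnd a : cabs a < K^-1 -> [/\ near0 M a, cabs (g a) <= 3 * cabs a,
    1 / 2 <= cabs (u a) & 1 / 2 <= cabs (v a)].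
  move=> /(cabs_lt_inv K0); rewrite /K => aK; have a0 := cabs_ge0 a.
  have ta : 0 <= cabs a * t by rewrite mulr_ge0.
  have kta : 0 <= cabs a * (k * t) by rewrite mulr_ge0.
  have Ma : 0 <= cabs a * M by rewrite mulr_ge0.
  have ra : 0 <= cabs a * rho by rewrite mulr_ge0// ltW.
  have na : near0 M a by rewrite /near0; lra.
  have gb := Psi_growth mt na.
  have q : cabs (g a * t%:C) <= 1 / 4.
    rewrite cabsM cabsr ger0_norm//; have := ler_wpM2r t0 gb.
    by rewrite /g; lra.
  split => //; first by have := cabs_1B_ge q; rewrite /u; lra.
  have hv : cabs (g a * t%:C - (1 - lam)%:C * t%:C * a) <= 1 / 2.
    apply: le_trans (cabsB _ _) _; rewrite (cabsM _ a) (cabsM (1 - lam)%:C).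
    by rewrite !cabsr (ger0_norm t0) -/k; lra.
  have -> : v a = 1 - (g a * t%:C - (1 - lam)%:C * t%:C * a).
    by rewrite /v /u; ring.
  by have := cabs_1B_ge hv; lra.
have u0 a : cabs a < K^-1 -> u a != 0.
  by move=> /bnd[_ _ h _]; rewrite -cabs_gt0; lra.
have v0 a : cabs a < K^-1 -> v a != 0.
  by move=> /bnd[_ _ _ h]; rewrite -cabs_gt0; lra.
have dr a : cabs a < K^-1 -> cabs (a / (u a * v a)) < (2 * (M + 1))^-1.
  move=> aK; have [_ _ h1 h2] := bnd a aK.
  rewrite cabsM cabsV cabsM ltr_pdivrMr ?mulr_gt0 ?cabs_gt0 ?u0 ?v0//.
  have M1 : 0 < 2 * (M + 1) by lra.
  rewrite -ltr_pdivrMl ?invr_gt0// invrK.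
  have h : 1 / 2 * (1 / 2) <= cabs (u a) * cabs (v a).
    by apply: ler_pM => //; lra.
  apply: lt_le_trans h.
  have := cabs_lt_inv K0 aK; rewrite /K; have := mulr_ge0 (cabs_ge0 a) t0.
  have := mulr_ge0 (cabs_ge0 a) kt; have := mulr_ge0 (cabs_ge0 a) (ltW rho0).
  lra.
pose F a := Psi (m 0) (a / (u a * v a)) -
  (Psi (m t) a - g a * t%:C * (Psi (m t) a + lam%:C)).
suff F0 a : cabs a < K^-1 -> F a = 0.
  exists K^-1; first by rewrite invr_gt0.
  move=> a aK /=; have [_ q1 q2 q3] := bnd a aK; split => //.
  by apply/eqP; rewrite -subr_eq0; apply/eqP; exact: F0.
have KM : K^-1 <= (2 * (M + 1))^-1.
  by rewrite lef_pV2 ?posrE// /K; lra.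
apply: (@conj_extend _ F K^-1).
- move=> {}a aK ya; have [na _ _ _] := bnd a aK.
  have a0 : a != 0 by apply: contraTneq ya => ->; rewrite ltxx.
  have yi := Im_inv_gt0 ya.
  have gE := cauchy_Psi mt a0 na; rewrite -/(g a) in gE.
  have ra : rho <= cabs a^-1.
    rewrite cabsV -[rho]invrK lef_pV2 ?posrE ?invr_gt0 ?cabs_gt0//.
    apply: le_trans (ltW aK) _; rewrite lef_pV2 ?posrE//.
    by rewrite /K; lra.
  have [gt hd] := Hrho _ yi ra; rewrite gE in gt hd.
  have d0 : 0 < Im a^-1 / 2 by lra.
  have tt : 0 <= t <= t by rewrite t0 lexx.
  have t00 : 0 <= (0 : R) <= t by rewrite lexx t0.
  have h1 := @m_characteristic _ lam m t _ a^-1 (g a) hm d0 gt hd t tt.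
  have Zt : m_path lam t a^-1 (g a) t = a^-1 by rewrite /m_path subrr; ring.
  rewrite Zt subrr mulr0 subr0 divr1 in h1; have {}h1 := h1 gE 0 t00.
  rewrite /m_path subr0 -/(u a) in h1.
  have u0a := u0 a aK; have v0a := v0 a aK.
  set b := a / (u a * v a).
  have b0 : b != 0 by rewrite mulf_neq0 ?invr_neq0// mulf_neq0.
  have bE : b^-1 = u a * (a^-1 * u a + (1 - lam)%:C * t%:C).
    have -> : b^-1 = u a * (v a / a) by rewrite /b; field; rewrite a0 u0a v0a.
    by rewrite /v; field.
  have nb : near0 M b by apply: near0_lt => //; exact: dr.
  have := cauchy_Psi m0 b0 nb; rewrite bE h1 => gb.
  rewrite /F -/b.
  have -> : Psi (m 0) b = g a / u a / b - 1.
    by rewrite gb mulrC mulKf// addrC addKr.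
  have gP : g a = a * (1 + Psi (m t) a) by [].
  have uP : u a = 1 - g a * t%:C by [].
  have Pg : Psi (m t) a = g a / a - 1.
    by rewrite gP mulrC mulKf// addrC addKr.
  rewrite bE Pg.
  have lE : (1 - lam)%:C = 1 - lam%:C :> R[i] by rewrite rmorphB.
  rewrite lE; apply/eqP; rewrite subr_eq0; apply/eqP.
  rewrite mulrA divfK// uP.
  by move: (g a) => h; field.
- move=> {}a aK; have [na _ _ _] := bnd a aK.
  have nb := near0_lt M0 (dr a aK).
  have gJ : g (conjc a) = conjc (g a).
    by rewrite /g (Psi_conj mt na) conjcM conjcD conjc1.
  have uJ : u (conjc a) = conjc (u a) by rewrite /u gJ conjcB (conjcM (g a)) (conjc_r t) conjc1.
  have vJ : v (conjc a) = conjc (v a).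
    by rewrite /v uJ (conjcD (u a)) (conjcM _ a) -rmorphM conjc_r.
  rewrite /F gJ uJ vJ (Psi_conj mt na) (conjcB (Psi (m 0) _)).
  rewrite (conjcB (Psi (m t) a)) -(Psi_conj m0 nb).
  rewrite (conjcM a (u a * v a)^-1) conjc_inv (conjcM (u a)).
  rewrite (conjcM (g a * t%:C)) (conjcM (g a) t%:C) (conjcD (Psi (m t) a)).
  by rewrite (conjc_r t) (conjc_r lam).
- move=> {}a aK.
  have ar := lt_le_trans aK KM.
  have cP : {for a, continuous (Psi (m t))} by exact: Psi_cts mt ar.
  have cg : {for a, continuous g} :=
    ctsM (@cts_id R a) (ctsD (@cts_cst R a 1) cP).
  have cgt : {for a, continuous (fun a => g a * t%:C)} :=
    ctsM cg (@cts_cst R a t%:C).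
  have cu : {for a, continuous u} := ctsB (@cts_cst R a 1) cgt.
  have cv : {for a, continuous v} :=
    ctsD cu (ctsM (@cts_cst R a ((1 - lam)%:C * t%:C)) (@cts_id R a)).
  have uv0 : u a * v a != 0 by rewrite mulf_neq0 ?u0 ?v0.
  have cb := ctsM (@cts_id R a) (ctsV (ctsM cu cv) uv0).
  exact (ctsB (cts_comp cb (Psi_cts m0 (dr a aK))) (ctsB cP
    (ctsM cgt (ctsD cP (@cts_cst R a lam%:C))))).
Qed.

End PsiFlows.

(** * Local injectivity of [Psi] near 0 *)

Section LocalInverse.
Context {R : realType}.
Implicit Types (mu : probability R R) (a b : R[i]) (M : R) (f : R -> R).

Lemma null_of_Rintegral mu M f (A : set R) : supported_in mu M ->
  measurable_fun [set: R] f -> (exists C, forall x, `|x| <= M -> `|f x| <= C) ->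
  (forall x, `|x| <= M -> 0 <= f x) -> \int[mu]_x f x = 0 ->
  measurable A -> (forall x, A x -> `|x| <= M -> 0 < f x) -> mu A = 0%E.
Proof.
move=> mM mf fb f0 If mA fA.
have iff := bounded_integrable mM mf fb.
have E0 : (\int[mu]_x `|(EFin \o f) x| = 0)%E.
  have : \int[mu]_x `|f x| = 0.
    rewrite -[RHS]If; apply: (eq_Rintegral_supp mM) => //.
      exact: measurableT_comp.
    by move=> x /f0 h; rewrite ger0_norm.
  rewrite /Rintegral => H.
  have fin : (\int[mu]_x (`|f x|%:E))%E \is a fin_num.
    apply: integrable_fin_num => //.
    by have := integrable_norm iff; apply: eq_integrable.
  by rewrite -[RHS]/(0%:E) -H fineK.
have mfE : measurable_fun [set: R] (EFin \o f) by exact/measurable_EFinP.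
have [N [mN N0 HN]] := (proj1 (ae_eq_integral_abs mu measurableT mfE)) E0.
apply/eqP; rewrite -measure_le0; apply: (@le_trans _ _ (mu (N `|` ~` `[- M, M]%classic))).
  apply: le_measure; rewrite ?inE//.
    by apply: measurableU => //; exact: measurableC.
  move=> x Ax; have [xM|xM] := leP `|x| M; last first.
    by right => /in_supp; rewrite leNgt xM.
  left; apply: HN => /= H; have := fA x Ax xM.
  by have [->] := H I; rewrite ltxx.
have e0 : (mu N + mu (~` `[(- M)%R, M]%classic))%E = 0%E.
  by rewrite N0 mM adde0.
by rewrite -e0; apply: measureU2 => //; exact: measurableC.
Qed.

Lemma cintegral_null mu (k : R -> R[i]) : mu [set~ 0] = 0%E ->
  cmeasurable k -> k 0 = 0 -> cintegral mu k = 0.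
Proof.
move=> m0 [k1 k2] k00.
have z (p : R -> R) : measurable_fun [set: R] p -> p 0 = 0 -> \int[mu]_x p x = 0.
  move=> mp p0; rewrite -(Rintegral_prob_cst mu 0); congr fine.
  apply: ae_eq_integral => //; first exact/measurable_EFinP.
  exists [set~ 0]; split => //; first exact: measurableC.
  by move=> x /= H x0; apply: H => _; rewrite x0 p0.
by apply: complex_eqP => /=; apply: z => //; rewrite k00.
Qed.

(** With second moment 0 the law is carried by 0, and then [Psi] is constant. *)
Lemma second_moment_gt0 mu M a b : supported_in mu M -> near0 M a ->
  near0 M b -> Psi mu a != Psi mu b -> 0 < \int[mu]_x (x ^+ 2).
Proof.
move=> mM na nb ab; rewrite lt_neqAle; apply/andP; split; last first.
  by apply: Rintegral_ge0 => x _; exact: sqr_ge0.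
apply: contra_neq ab => /esym I0.
have m0 : mu [set~ 0] = 0%E.
  apply: (@null_of_Rintegral mu M (fun x => x ^+ 2)) => //.
  - exists (M ^+ 2) => x xM; rewrite normrX.
    by rewrite lerXn2r ?nnegrE// (supported_in_ge0 mM).
  - by move=> x _; exact: sqr_ge0.
  - exact: measurableC.
  - by move=> x /= /eqP x0 _; rewrite exprn_even_gt0.
by rewrite /Psi !cintegral_null//; try (by rewrite mul0r mul0r); cmeas.
Qed.

Lemma cintegral_real mu f : cintegral mu (fun x => (f x)%:C) =
  (\int[mu]_x f x)%:C.
Proof. by apply: complex_eqP => //=; rewrite Rintegral_prob_cst. Qed.

Lemma slope_den M a b (x : R) : near0 M a -> near0 M b -> `|x| <= M ->
  cabs ((1 - x%:C * a) * (1 - x%:C * b))^-1 <= 4.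
Proof.
move=> na nb xM; rewrite invfM cabsM (_ : 4 = 2 * 2); last by ring.
by apply: ler_pM; rewrite ?cabs_ge0//; exact: near0_inv _ xM.
Qed.

Lemma cintegrable_slope mu M a b : supported_in mu M -> near0 M a ->
  near0 M b ->
  cintegrable mu (fun x => x%:C / ((1 - x%:C * a) * (1 - x%:C * b))).
Proof.
move=> mM na nb; apply: (cintegrable_supp mM); first by cmeas.
exists (M * 4) => x xM; rewrite cabsM cabsr.
by apply: ler_pM; rewrite ?cabs_ge0//; exact: slope_den na nb xM.
Qed.

Lemma cabs_rM_le M a (x : R) : `|x| <= M -> cabs (x%:C * a) <= M * cabs a.
Proof. by move=> xM; rewrite cabsM cabsr ler_wpM2r ?cabs_ge0. Qed.

(** First-order expansion of the slope at 0. The constant is the product of 2 for the complex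
    integral, 2 for the numerator and 4 for the denominators. *)
Lemma Psi_slope1 mu M a b : supported_in mu M -> near0 M a -> near0 M b ->
  cabs (Psi_slope mu a b - (\int[mu]_x x)%:C) <=
  16 * M ^+ 2 * (cabs a + cabs b).
Proof.
move=> mM na nb; have M0 := supported_in_ge0 mM.
have ix : cintegrable mu (fun x => x%:C).
  apply: (cintegrable_supp mM); first by cmeas.
  by exists M => x; rewrite cabsr.
rewrite -cintegral_real -cintegralB//; last exact: cintegrable_slope mM na nb.
set S := cabs a + cabs b.
apply: le_trans (_ : _ <= 2 * (M * (2 * (M * S) * 4))) _; last by lra.
apply: (cabs_cintegral_supp mM); first by cmeas.
move=> x xM; have h := near0_neq0 na xM; have h' := near0_neq0 nb xM.
have -> : x%:C / ((1 - x%:C * a) * (1 - x%:C * b)) - x%:C = x%:C *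
   ((x%:C * a + x%:C * b - (x%:C * a) * (x%:C * b)) /
   ((1 - x%:C * a) * (1 - x%:C * b))) by field; rewrite h h'.
rewrite cabsM cabsr; apply: ler_pM; rewrite ?cabs_ge0// cabsM.
apply: ler_pM; rewrite ?cabs_ge0//; last exact: slope_den na nb xM.
apply: le_trans (cabsB _ _) _; rewrite cabsM.
have := cabsD (x%:C * a) (x%:C * b).
have xa := cabs_rM_le a xM; have xb := cabs_rM_le b xM.
have q : cabs (x%:C * a) * cabs (x%:C * b) <= M * cabs a * 1.
  apply: ler_pM; rewrite ?cabs_ge0//; apply: le_trans xb _.
  by move: nb; rewrite /near0; lra.
have := mulr_ge0 M0 (cabs_ge0 b); rewrite /S; lra.
Qed.

(** Second-order expansion, for the case of mean 0. With [s = x a + x b] and [r = x a x b] the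
    remainder is [1 / (1 - s + r) - 1 - s = (s^2 - r - s r) / (1 - s + r)]. *)
Lemma Psi_slope2 mu M a b : supported_in mu M -> near0 M a -> near0 M b ->
  cabs (Psi_slope mu a b - (\int[mu]_x x)%:C -
        (a + b) * (\int[mu]_x (x ^+ 2))%:C) <=
  24 * M ^+ 3 * (cabs a + cabs b) ^+ 2.
Proof.
move=> mM na nb; have M0 := supported_in_ge0 mM.
have ix : cintegrable mu (fun x => x%:C).
  apply: (cintegrable_supp mM); first by cmeas.
  by exists M => x; rewrite cabsr.
have mx : cmeasurable (fun x : R => (x ^+ 2)%:C).
  by apply: cmeasurable_real; exact: measurable_funX.
have ix2 : cintegrable mu (fun x => (x ^+ 2)%:C).
  apply: (cintegrable_supp mM) => //.
  by exists (M ^+ 2) => x xM; rewrite cabsr normrX lerXn2r ?nnegrE.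
have is_ := cintegrable_slope mM na nb.
rewrite -!cintegral_real -cintegralB// -cintegralZ// -cintegralB; last 2 first.
- have := cintegrableD is_ (cintegrableZ (-1) ix).
  by under eq_fun do rewrite mulN1r.
- exact: cintegrableZ.
set S := cabs a + cabs b.
apply: le_trans (_ : _ <= 2 * (M * (3 * (M * S) ^+ 2 * 4))) _; last first.
  by rewrite exprMn; lra.
apply: (cabs_cintegral_supp mM).
  by apply: cmeasurableB; [cmeas|apply: cmeasurableM => //; cmeas].
move=> x xM; have h := near0_neq0 na xM; have h' := near0_neq0 nb xM.
set s := x%:C * a + x%:C * b; set r := (x%:C * a) * (x%:C * b).
have -> : x%:C / ((1 - x%:C * a) * (1 - x%:C * b)) - x%:C -
   (a + b) * (x ^+ 2)%:C = x%:C *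
   ((s ^+ 2 - (r + s * r)) / ((1 - x%:C * a) * (1 - x%:C * b))).
  by rewrite /s /r; field; rewrite h h'.
rewrite cabsM cabsr; apply: ler_pM; rewrite ?cabs_ge0// cabsM.
apply: ler_pM; rewrite ?cabs_ge0//; last exact: slope_den na nb xM.
apply: le_trans (cabsB _ _) _; rewrite cabsX.
have xa := cabs_rM_le a xM; have xb := cabs_rM_le b xM.
have sS : cabs s <= M * S by have := cabsD (x%:C * a) (x%:C * b); rewrite /S /s; lra.
have MS : M * S <= 1 by move: na nb; rewrite /near0 /S; lra.
have MS0 : 0 <= M * S by rewrite mulr_ge0 ?addr_ge0 ?cabs_ge0.
have rS : cabs r <= (M * S) ^+ 2.
  rewrite /r cabsM expr2; apply: ler_pM; rewrite ?cabs_ge0//.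
    by apply: le_trans xa _; rewrite ler_wpM2l// /S lerDl cabs_ge0.
  by apply: le_trans xb _; rewrite ler_wpM2l// /S lerDr cabs_ge0.
have s2 : cabs s ^+ 2 <= (M * S) ^+ 2 by rewrite lerXn2r ?nnegrE ?cabs_ge0.
have sr : cabs (s * r) <= 1 * (M * S) ^+ 2.
  rewrite cabsM; apply: ler_pM; rewrite ?cabs_ge0//; exact: le_trans MS.
have := cabsD r (s * r); lra.
Qed.

(** Two distinct preimages would make the slope vanish, although near 0 it is closer to the mean
    than the mean is to 0. *)
Lemma Psi_locally_injective mu : bounded_support mu -> \int[mu]_x x != 0 ->
  exists2 r, 0 < r & forall a b, cabs a < r -> cabs b < r ->
    Psi mu a = Psi mu b -> a = b.
Proof.
move=> [M mM] m10; have M0 := supported_in_ge0 mM.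
set m1 := \int[mu]_x x in m10 *.
have c0 : 0 < `|m1| by rewrite normr_gt0.
pose q := 32 * (M ^+ 2 + 1).
have q0 : 0 < q by rewrite /q; have := sqr_ge0 M; lra.
exists (Num.min (2 * (M + 1))^-1 (`|m1| / q)).
  by rewrite lt_min divr_gt0// invr_gt0 andbT; lra.
move=> a b; rewrite !lt_min => /andP[a1 a2] /andP[b1 b2] ab.
have na := near0_lt M0 a1; have nb := near0_lt M0 b1.
have := Psi_sub mM na nb; rewrite ab subrr => /esym/eqP.
rewrite mulf_eq0 => /orP[|/eqP s0]; first by rewrite subr_eq0 => /eqP.
have := Psi_slope1 mM na nb; rewrite s0 sub0r cabsN cabsr -/m1.
move: a2 b2; rewrite !ltr_pdivlMr// /q => a2 b2 H; exfalso.
have := cabs_ge0 a; have := cabs_ge0 b; lra.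
Qed.

(** For mean 0 the slope is [(a + b)] times the second moment up to second order; a vanishing slope
    makes [a] and [b] nearly opposite. *)
Lemma Psi_locally_two_to_one mu : bounded_support mu -> \int[mu]_x x = 0 ->
  0 < \int[mu]_x (x ^+ 2) ->
  exists C r, [/\ 0 <= C, 0 < r & forall a b, cabs a < r -> cabs b < r ->
    Psi mu a = Psi mu b -> a != b ->
    cabs (a + b) <= C * (cabs a + cabs b) ^+ 2].
Proof.
move=> [M mM] m10; have M0 := supported_in_ge0 mM.
set m2 := \int[mu]_x (x ^+ 2) => m20.
exists (24 * M ^+ 3 / m2), (2 * (M + 1))^-1; split.
- by rewrite divr_ge0 ?(ltW m20)// mulr_ge0// exprn_ge0.
- by rewrite invr_gt0; lra.
move=> a b a1 b1 ab anb.
have na := near0_lt M0 a1; have nb := near0_lt M0 b1.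
have := Psi_sub mM na nb; rewrite ab subrr => /esym/eqP.
rewrite mulf_eq0 subr_eq0 (negbTE anb)/= => /eqP s0.
have := Psi_slope2 mM na nb; rewrite s0 m10 subrr sub0r cabsN cabsM cabsr -/m2.
by rewrite (gtr0_norm m20) -ler_pdivlMr// mulrAC.
Qed.

End LocalInverse.

Lemma measurable_cabs (R : realType) (f : R -> R[i]) : cmeasurable f ->
  measurable_fun [set: R] (fun x => cabs (f x)).
Proof.
move=> [f1 f2]; under eq_fun do rewrite cabsE.
apply: (measurableT_comp (continuous_measurable_fun (@sqrt_continuous R))).
by apply: measurable_funD; exact: measurable_funX.
Qed.

Lemma measurable_funV (R : realType) (f : R -> R) :
  measurable_fun [set: R] f -> measurable_fun [set: R] (fun x => (f x)^-1).
Proof. by move=> mf; exact: (measurableT_comp (@measurable_inv R)). Qed.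

Lemma cmeasurable_abs (R : realType) : cmeasurable (fun x : R => `|x|%:C).
Proof. by apply: cmeasurable_real; exact: measurable_abs. Qed.

Ltac rmeas := repeat match goal with
  | |- cmeasurable (fun=> ?c) => exact: cmeasurable_cst
  | |- cmeasurable (fun x => (Num.norm x)%:C) => exact: cmeasurable_abs
  | |- cmeasurable (fun x => _ + _) => apply: cmeasurableD
  | |- cmeasurable (fun x => - _) => apply: cmeasurableN
  | |- cmeasurable (fun x => _ * _) => apply: cmeasurableM
  | |- cmeasurable (fun x => _ ^+ _) => apply: cmeasurableX
  | |- cmeasurable (fun x => _^-1) => apply: cmeasurableV
  | |- measurable_fun _ (fun=> ?c) => exact: measurable_cst
  | |- measurable_fun _ (fun x => cabs _) => apply: measurable_cabs
  | |- measurable_fun _ (fun x => x) => exact: measurable_id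
  | |- measurable_fun _ (fun x => Num.norm x) => exact: measurable_abs
  | |- measurable_fun _ (@Num.norm _ _) => exact: measurable_abs
  | |- measurable_fun _ (fun x => Num.min _ _) => apply: measurable_minr
  | |- measurable_fun _ (fun x => _ + _) => apply: measurable_funD
  | |- measurable_fun _ (fun x => - _) => apply: measurable_funN
  | |- measurable_fun _ (fun x => _ * _) => apply: measurable_funM
  | |- measurable_fun _ (fun x => _ ^+ _) => apply: measurable_funX
  | |- measurable_fun _ (fun x => _^-1) => apply: measurable_funV
  end.

(** * Comparison and dominated convergence on the support *)

Section RealIntegrals.
Context {R : realType}.
Implicit Types (mu : probability R R) (M C : R) (f g : R -> R).

Lemma le_Rintegral_supp mu M f g C : supported_in mu M ->
  measurable_fun [set: R] f -> measurable_fun [set: R] g ->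
  (forall x, `|x| <= M -> `|f x| <= C) -> (forall x, `|x| <= M -> `|g x| <= C) ->
  (forall x, `|x| <= M -> f x <= g x) -> \int[mu]_x f x <= \int[mu]_x g x.
Proof.
move=> mM mf mg fC gC fg.
have mfg : measurable_fun [set: R] (fun x => Num.min (f x) (g x)) by rmeas.
rewrite (@eq_Rintegral_supp _ mu M f (fun x => Num.min (f x) (g x)))//.
  apply: le_Rintegral => //.
  - apply: (bounded_integrable mM mfg); exists C => x xM.
    by rewrite min_l ?fg// fC.
  - by apply: (bounded_integrable mM mg); exists C.
  - by move=> x _; rewrite ge_min lexx orbT.
by move=> x /fg h; rewrite min_l.
Qed.

Lemma Rintegral_dct mu M (f_ : nat -> R -> R) f C : supported_in mu M ->
  (forall n, measurable_fun [set: R] (f_ n)) -> measurable_fun [set: R] f ->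
  (forall n x, `|x| <= M -> `|f_ n x| <= C) ->
  (forall x, `|x| <= M -> f_ ^~ x @ \oo --> f x) ->
  \int[mu]_x f_ n x @[n --> \oo] --> \int[mu]_x f x.
Proof.
move=> mM mf_ mf fC fcvg.
have ae (P : R -> Prop) : (forall x, `|x| <= M -> P x) -> {ae mu, forall x, P x}.
  move=> HP; exists (~` `[- M, M]%classic); split => //; first exact: measurableC.
  by move=> x /= H; apply: contra_not H => /in_supp; exact: HP.
have cE x : `|x| <= M -> [set: R] x ->
    (fun n => (f_ n x)%:E) @ \oo --> (f x)%:E.
  by move=> xM _; apply: cvg_EFin; [exact: nearW|exact: fcvg].
have bE x : `|x| <= M -> forall n, [set: R] x -> (`|(f_ n x)%:E| <= C%:E)%E.
  by move=> xM n _; exact: fC.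
have iC : mu.-integrable [set: R] (fun=> C%:E).
  by apply: (integrable_all_bounded mu (f := fun=> C)) => //; exists `|C|.
have [iff _ H] := @dominated_convergence _ _ _ mu [set: R] measurableT
  (fun n => EFin \o f_ n) (EFin \o f) (fun=> C%:E)
  (fun n => proj2 (measurable_EFinP _ _) (mf_ n))
  (proj2 (measurable_EFinP _ _) mf)
  (ae _ cE)
  iC
  (ae _ bE).
have fin : (\int[mu]_x (EFin \o f) x)%E \is a fin_num by exact: integrable_fin_num.
apply: fine_cvg; rewrite fineK//.
Qed.

End RealIntegrals.

(** * [Psi] on the left half-plane, for laws on the half-line *)

Section HalfLinePsi.
Context {R : realType}.
Implicit Types (mu : probability R R) (a b : R[i]) (M C x : R) (f : R -> R).

Lemma halfline_pos_mass mu : on_halfline mu -> (mu [set 0%R] < 1)%E ->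
  mu `]0, +oo[%classic != 0%E.
Proof.
move=> hm m0; apply/eqP => mp; have : mu [set: R] = 1%E by rewrite probability_setT.
have sub : [set: R] `<=` ([set 0] `|` `]-oo, 0[%classic) `|` `]0, +oo[%classic.
  move=> x _; rewrite /= !in_itv/= andbT.
  by have [x0|x0|->] := ltgtP x 0; [left; right|right|left; left].
move=> e1; move: m0; rewrite -e1 ltNge => /negP; apply.
have m1 : measurable ([set 0] `|` `]-oo, 0[%classic : set R) by exact: measurableU.
have e0 : (mu [set 0%R] + mu `]-oo, 0%R[%classic + mu `]0%R, +oo[%classic)%E
    = mu [set 0%R] by rewrite mp hm !adde0.
rewrite -e0; apply: le_trans (_ : _ <= mu (([set 0%R] `|` `]-oo, 0%R[%classic)
    `|` `]0%R, +oo[%classic))%E _.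
  by apply: le_measure => //; rewrite inE//; exact: measurableU.
apply: le_trans (measureU2 _ _ _) _ => //.
by apply: leeD => //; exact: measureU2.
Qed.

Lemma Rintegral_halfline_gt0 mu M f C : supported_in mu M -> on_halfline mu ->
  (mu [set 0%R] < 1)%E -> measurable_fun [set: R] f ->
  (forall x, 0 <= x <= M -> `|f x| <= C) -> (forall x, 0 <= x -> 0 <= f x) ->
  (forall x, 0 < x -> 0 < f x) -> 0 < \int[mu]_x f x.
Proof.
move=> mM hm m0 mf fC f0 fpos; rewrite Rintegral_halfline//.
rewrite lt_neqAle Rintegral_ge0 ?andbT; last by move=> x _; exact: f0.
apply: contra_neq (halfline_pos_mass hm m0) => /esym I0.
apply: (@null_of_Rintegral _ mu M (fun x => f `|x|)) => //.
- exact: (measurableT_comp mf measurable_abs).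
- by exists C => x xM; apply: fC; rewrite normr_ge0.
- by move=> x _; exact: f0.
- by move=> x; rewrite /= in_itv/= andbT => x0 _; rewrite gtr0_norm// fpos.
Qed.

Lemma cintegral_halfline mu (k : R -> R[i]) : on_halfline mu -> cmeasurable k ->
  cintegral mu k = cintegral mu (fun x => k `|x|).
Proof. by move=> hm [k1 k2]; apply: complex_eqP => /=; exact: Rintegral_halfline. Qed.

Lemma left_den a x : Re a < 0 -> 0 <= x -> 1 <= Re (1 - x%:C * a).
Proof.
move=> ra x0; rewrite ReD ReN RerM/=.
have : x * Re a <= 0 by rewrite mulr_ge0_le0// ltW.
lra.
Qed.

Lemma left_den_cabs a x : Re a < 0 -> 0 <= x -> 1 <= cabs (1 - x%:C * a).
Proof.
by move=> ra x0; apply: le_trans (left_den ra x0) (le_trans (ler_norm _) (cabs_Re _)).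
Qed.

Lemma left_den_neq0 a x : Re a < 0 -> 0 <= x -> 1 - x%:C * a != 0.
Proof. by move=> ra x0; rewrite -cabs_gt0; have := left_den_cabs ra x0; lra. Qed.

Lemma left_inv a x : Re a < 0 -> 0 <= x -> cabs (1 - x%:C * a)^-1 <= 1.
Proof.
move=> ra x0; rewrite cabsV invf_le1 ?left_den_cabs//.
by have := left_den_cabs ra x0; lra.
Qed.

(** With [|x|] the denominator has real part at least 1 for every real [x], so the bounds hold off
    the half-line too. *)
Definition left_kernel a x : R[i] := `|x|%:C * a / (1 - `|x|%:C * a).

Lemma Psi_left mu a : on_halfline mu -> Psi mu a = cintegral mu (left_kernel a).
Proof. by move=> hm; rewrite /Psi (cintegral_halfline hm)//; cmeas. Qed.

Lemma cmeasurable_left a : cmeasurable (left_kernel a).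
Proof. by rewrite /left_kernel; rmeas. Qed.

Lemma left_kernel_bound M a x : Re a < 0 -> `|x| <= M ->
  cabs (left_kernel a x) <= M * cabs a.
Proof.
move=> ra xM; rewrite /left_kernel cabsM -[leRHS]mulr1.
apply: ler_pM; rewrite ?cabs_ge0 ?left_inv//.
by rewrite cabsM cabsr normr_id ler_wpM2r ?cabs_ge0.
Qed.

Lemma cintegrable_left mu M a : supported_in mu M -> Re a < 0 ->
  cintegrable mu (left_kernel a).
Proof.
move=> mM ra; apply: (cintegrable_supp mM); first exact: cmeasurable_left.
by exists (M * cabs a) => x; exact: left_kernel_bound.
Qed.

(** The real part of the kernel dominates its squared modulus and keeps a constant sign: no
    cancellation occurs in [Psi]. *)
Lemma left_kernel_Re a x : Re a < 0 -> 0 <= x ->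
  (x * cabs a / cabs (1 - x%:C * a)) ^+ 2 <= - Re (x%:C * a / (1 - x%:C * a)).
Proof.
move=> ra x0; have p0 := left_den_neq0 ra x0.
have -> : x%:C * a / (1 - x%:C * a) = (1 - x%:C * a)^-1 - 1 by field.
rewrite ReD ReN ReV opprD opprK/=.
have c0 : 0 < cabs (1 - x%:C * a) ^+ 2 by rewrite exprn_gt0// cabs_gt0.
rewrite exprMn exprVn ler_pdivrMr// mulrDl mulNr divfK ?gt_eqF// mul1r.
rewrite !cabs_sqr exprMn cabs_sqr !(ReD, ReN, RerM, ImD, ImN, ImrM)/=.
have : x * Re a <= 0 by rewrite mulr_ge0_le0// ltW.
nra.
Qed.

(** [- Re Psi] is at least the integral of [|k|^2], and [|k| >= |x| d / (1 + |x| d)] since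
    [s / (1 + s)] increases with [s]. Hence small values of [Psi] are taken only at small points,
    which makes [chi] tend to 0. *)
Lemma Psi_left_lower mu (d : R) : bounded_support mu -> on_halfline mu ->
  (mu [set 0%R] < 1)%E -> 0 < d ->
  exists2 c, 0 < c & forall a, Re a < 0 -> d <= cabs a ->
    c <= cabs (Psi mu a).
Proof.
move=> [M mM] hm m0 d0; have M0 := supported_in_ge0 mM.
pose f (x : R) := (d * `|x| / (1 + d * `|x|)) ^+ 2.
have mf : measurable_fun [set: R] f by rewrite /f; rmeas.
have dx (x : R) : 0 <= d * `|x| by rewrite mulr_ge0// ltW.
have f1 x : 0 <= d * `|x| / (1 + d * `|x|) <= 1.
  rewrite divr_ge0 ?addr_ge0//= ler_pdivrMr ?mul1r; first by rewrite lerDr.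
  by have := dx x; lra.
have f2 x : `|f x| <= 1.
  rewrite /f ger0_norm ?sqr_ge0// -[leRHS](expr1n _ 2).
  by have /andP[h1 h2] := f1 x; rewrite lerXn2r ?nnegrE.
exists (\int[mu]_x f x).
  apply: (Rintegral_halfline_gt0 (M := M) (C := 1) mM hm m0 mf) => [x _|x _|x x0] //.
    exact: sqr_ge0.
  rewrite /f exprn_gt0// divr_gt0//; first by rewrite mulr_gt0// normr_gt0 gt_eqF.
  by have := dx x; lra.
move=> a ra da; rewrite Psi_left//.
apply: le_trans (le_trans (ler_norm _) (_ : `|- Re (cintegral mu (left_kernel a))| <= _)); last first.
  by rewrite normrN cabs_Re.
have [ml _] := cmeasurable_left a; have [il _] := cintegrable_left mM ra.
rewrite /= -mulN1r -RintegralZl//.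
apply: (@le_Rintegral_supp _ mu M _ _ (1 + M * cabs a)) => //.
- by rmeas.
- by move=> x _; apply: le_trans (f2 x) _; rewrite lerDl mulr_ge0 ?cabs_ge0.
- move=> x xM; rewrite mulN1r normrN; apply: le_trans (cabs_Re _) _.
  by apply: le_trans (left_kernel_bound ra xM) _; lra.
- move=> x xM; rewrite mulN1r.
  apply: le_trans (left_kernel_Re ra (normr_ge0 x)).
  have /andP[h1 _] := f1 x; rewrite /f lerXn2r ?nnegrE//.
    by rewrite divr_ge0 ?mulr_ge0 ?cabs_ge0.
  have p1 := left_den_cabs ra (normr_ge0 x).
  have p0 : 0 < cabs (1 - `|x|%:C * a) by lra.
  have q0 : 0 < 1 + d * `|x| by have := dx x; lra.
  rewrite ler_pdivrMr// mulrAC ler_pdivlMr//.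
  have pb : cabs (1 - `|x|%:C * a) <= 1 + `|x| * cabs a.
    by have := cabsB 1 (`|x|%:C * a); rewrite cabs1 cabsM cabsr normr_id.
  have h := ler_wpM2l (dx x) pb.
  have h' := ler_wpM2r (normr_ge0 x) da.
  lra.
Qed.

Lemma Psi_left_small mu (d : R) : bounded_support mu -> on_halfline mu ->
  (mu [set 0%R] < 1)%E -> 0 < d ->
  exists2 c, 0 < c & forall a, Re a < 0 -> cabs (Psi mu a) < c ->
    cabs a < d.
Proof.
move=> bs hm m0 d0; have [c c0 H] := Psi_left_lower bs hm m0 d0.
exists c => // a ra; apply: contraTT; rewrite -!leNgt; exact: H.
Qed.

Definition left_slope mu a b := cintegral mu
  (fun x => `|x|%:C / ((1 - `|x|%:C * a) * (1 - `|x|%:C * b))).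

Lemma left_slope_bound M a b x : Re a < 0 -> Re b < 0 ->
  `|x| <= M -> cabs (`|x|%:C / ((1 - `|x|%:C * a) * (1 - `|x|%:C * b))) <= M.
Proof.
move=> ra rb xM; rewrite cabsM invfM cabsr normr_id -[leRHS]mulr1.
apply: ler_pM; rewrite ?cabs_ge0// cabsM -[leRHS]mulr1.
by apply: ler_pM; rewrite ?cabs_ge0 ?left_inv.
Qed.

Lemma cmeasurable_left_slope a b : cmeasurable
  (fun x => `|x|%:C / ((1 - `|x|%:C * a) * (1 - `|x|%:C * b))).
Proof. by rmeas. Qed.

Lemma cintegrable_left_slope mu M a b : supported_in mu M ->
  Re a < 0 -> Re b < 0 -> cintegrable mu
  (fun x => `|x|%:C / ((1 - `|x|%:C * a) * (1 - `|x|%:C * b))).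
Proof.
move=> mM ra rb; apply: (cintegrable_supp mM); first exact: cmeasurable_left_slope.
by exists M => x; exact: left_slope_bound.
Qed.

Lemma Psi_left_sub mu a b : bounded_support mu -> on_halfline mu ->
  Re a < 0 -> Re b < 0 ->
  Psi mu a - Psi mu b = (a - b) * left_slope mu a b.
Proof.
move=> [M mM] hm ra rb; rewrite !Psi_left// -cintegralB;
  [|exact: cintegrable_left mM _..].
rewrite -cintegralZ; last exact: cintegrable_left_slope mM ra rb.
congr cintegral; apply/funext => x; rewrite /left_kernel.
have h := left_den_neq0 ra (normr_ge0 x); have h' := left_den_neq0 rb (normr_ge0 x).
by field; rewrite h h'.
Qed.

Lemma Im_left_kernel a x : Re a < 0 ->
  Im (left_kernel a x) =
  Im a * (`|x| * cabs (1 - `|x|%:C * a) ^- 2).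
Proof.
move=> ra; rewrite /left_kernel.
have p0 := left_den_neq0 ra (normr_ge0 x).
have -> : `|x|%:C * a / (1 - `|x|%:C * a) = (1 - `|x|%:C * a)^-1 - 1 by field.
by rewrite ImD ImN ImV ImD ImN ImrM/=; ring.
Qed.

(** Two points with the same image are thus on the same side of the real axis, the situation in
    which the slope can be bounded below. *)
Lemma Im_Psi_left mu a : bounded_support mu -> on_halfline mu ->
  (mu [set 0%R] < 1)%E -> Re a < 0 ->
  exists2 c, 0 < c & Im (Psi mu a) = Im a * c.
Proof.
move=> [M mM] hm m0 ra; have M0 := supported_in_ge0 mM.
pose f (x : R) := `|x| * cabs (1 - `|x|%:C * a) ^- 2.
have mf : measurable_fun [set: R] f by rewrite /f; rmeas.
have fb (x : R) : `|x| <= M -> `|f x| <= M.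
  move=> xM; rewrite /f normrM normr_id -[leRHS]mulr1; apply: ler_pM => //.
  rewrite ger0_norm ?invr_ge0 ?sqr_ge0// -exprVn -cabsV -[leRHS](expr1n _ 2).
  by rewrite lerXn2r ?nnegrE ?cabs_ge0 ?left_inv.
exists (\int[mu]_x f x).
  apply: (Rintegral_halfline_gt0 (M := M) (C := M) mM hm m0 mf) => [x /andP[x0 xM]|x _|x x0].
  - by apply: fb; rewrite ger0_norm.
  - by rewrite mulr_ge0// invr_ge0 sqr_ge0.
  - by rewrite mulr_gt0// ?normr_gt0 ?gt_eqF// invr_gt0 exprn_gt0// cabs_gt0
       left_den_neq0.
rewrite Psi_left//= -RintegralZl//; last first.
  by apply: (bounded_integrable mM mf); exists M.
by apply: eq_Rintegral => x _; exact: Im_left_kernel.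
Qed.

Lemma left_slope_Re a b x :
  Re (`|x|%:C / ((1 - `|x|%:C * a) * (1 - `|x|%:C * b))) =
  `|x| * (Re (1 - `|x|%:C * a) * Re (1 - `|x|%:C * b) -
          (`|x| * Im a) * (`|x| * Im b)) /
  (cabs (1 - `|x|%:C * a) ^+ 2 * cabs (1 - `|x|%:C * b) ^+ 2).
Proof.
rewrite RerM invfM ReM !ReV !ImV (invfM (cabs (1 - `|x|%:C * a) ^+ 2)).
have e c : Im (1 - `|x|%:C * c) = - (`|x| * Im c).
  by rewrite ImD ImN ImrM/= sub0r.
by rewrite !e !opprK; ring.
Qed.

Lemma left_slope_Im a b x :
  Im (`|x|%:C / ((1 - `|x|%:C * a) * (1 - `|x|%:C * b))) =
  `|x| * (Re (1 - `|x|%:C * a) * (`|x| * Im b) +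
          Re (1 - `|x|%:C * b) * (`|x| * Im a)) /
  (cabs (1 - `|x|%:C * a) ^+ 2 * cabs (1 - `|x|%:C * b) ^+ 2).
Proof.
rewrite ImrM invfM ImM !ReV !ImV (invfM (cabs (1 - `|x|%:C * a) ^+ 2)).
have e c : Im (1 - `|x|%:C * c) = - (`|x| * Im c).
  by rewrite ImD ImN ImrM/= sub0r.
by rewrite !e !opprK; ring.
Qed.

Lemma left_den_le M a x : `|x| <= M -> cabs (1 - `|x|%:C * a) <= 1 + M * cabs a.
Proof.
move=> xM; apply: le_trans (cabsB _ _) _; rewrite cabs1 cabsM cabsr normr_id.
by rewrite lerD2l ler_wpM2r ?cabs_ge0.
Qed.

Lemma left_den_split a x : 0 <= Re (1 - `|x|%:C * a) ->
  cabs (1 - `|x|%:C * a) <= Re (1 - `|x|%:C * a) + `|x| * `|Im a|.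
Proof.
move=> h; apply: le_trans (cabs_le _) _; rewrite ger0_norm// lerD2l.
by rewrite ImD ImN ImrM/= sub0r normrN normrM normr_id.
Qed.

(* The kernel is a product [x / (p q)] with [p], [q] of real part at least 1 and
   imaginary parts of the same sign [- s], the argument of [q] being bounded
   away from a right angle: [Re + L s Im] is positive on it for large [L]. *)
Lemma left_slope_lower mu M b : supported_in mu M -> on_halfline mu ->
  (mu [set 0%R] < 1)%E -> Re b < 0 ->
  exists2 c, 0 < c & forall a, Re a < 0 ->
    0 <= Im a * Im b ->
    c <= (1 + M * cabs a) * cabs (left_slope mu a b).
Proof.
move=> mM hm m0 rb; have M0 := supported_in_ge0 mM.
have qc x := left_den_cabs rb (normr_ge0 x).
pose f (x : R) := `|x| / cabs (1 - `|x|%:C * b) ^+ 2.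
have mf : measurable_fun [set: R] f by rewrite /f; rmeas.
have fb (x : R) : `|x| <= M -> 0 <= f x <= M.
  move=> xM; rewrite /f divr_ge0 ?sqr_ge0//=.
  have q1 : 1 <= cabs (1 - `|x|%:C * b) ^+ 2 by rewrite exprn_ege1.
  by rewrite ler_pdivrMr; [have := ler_wpM2l M0 q1; lra|lra].
(* Chosen for [1 + B <= L] below: [L] exceeds the tangent of the argument of every denominator
   [1 - |x| b] on the support. *)
pose L := 1 + M * `|Im b|.
have Mb : 0 <= M * `|Im b| by rewrite mulr_ge0.
have L1 : 1 <= L by rewrite /L; lra.
exists (\int[mu]_x f x / (1 + L)).
  rewrite divr_gt0//; last lra.
  apply: (Rintegral_halfline_gt0 (M := M) (C := M) mM hm m0 mf) => [x /andP[x0 xM]|x _|x x0].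
  - have /andP[h1 h2] : 0 <= f x <= M by apply: fb; rewrite ger0_norm.
    by rewrite ger0_norm.
  - by rewrite /f divr_ge0 ?sqr_ge0.
  - rewrite /f divr_gt0 ?normr_gt0 ?gt_eqF// exprn_gt0//.
    by have := qc x; lra.
move=> a ra ab; set D := 1 + M * cabs a.
have D1 : 1 <= D by rewrite /D lerDl mulr_ge0 ?cabs_ge0.
have D0 : 0 < D by lra.
pose k (x : R) := `|x|%:C / ((1 - `|x|%:C * a) * (1 - `|x|%:C * b)).
have [s s1 [sa sb]] : exists2 s : R, `|s| = 1 &
    s * Im a = `|Im a| /\ s * Im b = `|Im b|.
  have [a0|a0] := leP 0 (Im a).
    have [b0|b0] := leP 0 (Im b).
      by exists 1; rewrite ?normr1// !mul1r !ger0_norm.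
    have a00 : Im a = 0.
      by apply/eqP; rewrite eq_le a0 andbT; move: ab; rewrite nmulr_lge0.
    exists (-1); first by rewrite normrN normr1.
    by rewrite a00 mulr0 normr0 mulN1r ltr0_norm.
  have b0 : Im b <= 0 by move: ab; rewrite nmulr_rge0.
  by exists (-1); rewrite ?normrN ?normr1// !mulN1r (ltr0_norm a0) ler0_norm.
have ss : s * s = 1.
  by rewrite -expr2 -real_normK ?num_real// s1 expr1n.
have [mk1 mk2] := cmeasurable_left_slope a b.
have [ik1 ik2] := cintegrable_left_slope mM ra rb.
have step : \int[mu]_x f x <=
    D * \int[mu]_x (Re (k x)) + D * L * s * \int[mu]_x (Im (k x)).
  rewrite -Rintegral_lin//.
  apply: (@le_Rintegral_supp _ mu M _ _ (M + D * M + D * L * M)) => //.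
  - by apply: measurable_funD; apply: measurable_funM => //; exact: measurable_cst.
  - move=> x /fb /andP[h1 h2]; rewrite ger0_norm//; apply: le_trans h2 _.
    have := mulr_ge0 (ltW D0) M0; have : 0 <= D * L * M by rewrite !mulr_ge0//; lra.
    lra.
  - move=> x xM; have kM := left_slope_bound ra rb xM.
    have k1 := le_trans (cabs_Re _) kM; have k2 := le_trans (cabs_Im _) kM.
    have DL : 0 <= D * L by rewrite mulr_ge0//; lra.
    apply: le_trans (ler_normD _ _) _.
    rewrite (normrM D) (normrM (D * L * s)) (normrM (D * L)) s1 mulr1.
    rewrite (gtr0_norm D0) (ger0_norm DL).
    have := ler_wpM2l (ltW D0) k1; have := ler_wpM2l DL k2.
    rewrite -/(k x); lra.
  - move=> x xM; rewrite /k left_slope_Re left_slope_Im.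
    set p := cabs (1 - `|x|%:C * a); set q := cabs (1 - `|x|%:C * b).
    set P := Re (1 - `|x|%:C * a); set Q := Re (1 - `|x|%:C * b).
    have p0 : 0 < p by have := left_den_cabs ra (normr_ge0 x); rewrite /p; lra.
    have q0 : 0 < q by have := qc x; rewrite /q; lra.
    have pD : p <= D by exact: left_den_le.
    have P1 : 1 <= P by exact: left_den ra (normr_ge0 x).
    have Q1 : 1 <= Q by exact: left_den rb (normr_ge0 x).
    pose A := `|x| * `|Im a|; pose B := `|x| * `|Im b|.
    have A0 : 0 <= A by rewrite mulr_ge0.
    have B0 : 0 <= B by rewrite mulr_ge0.
    have BL : 1 + B <= L by rewrite /L lerD2l ler_wpM2r.
    have ps : p <= P + A by apply: left_den_split; rewrite -/P; lra.
    have -> : D * (`|x| * (P * Q - (`|x| * Im a) * (`|x| * Im b)) /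
           (p ^+ 2 * q ^+ 2)) +
         D * L * s * (`|x| * (P * (`|x| * Im b) +
           Q * (`|x| * Im a)) / (p ^+ 2 * q ^+ 2)) =
         `|x| / q ^+ 2 * (D * (P * Q - A * B + L * (P * B + Q * A)) / p ^+ 2).
      rewrite /A /B -sa -sb -[X in P * Q - X]mul1r -ss.
      by field; rewrite !gt_eqF.
    rewrite /f -/q -[leLHS]mulr1 ler_wpM2l ?divr_ge0 ?sqr_ge0//.
    rewrite ler_pdivlMr ?exprn_gt0// mul1r expr2.
    apply: ler_pM => //; rewrite ?(ltW p0)//; apply: le_trans ps _.
    (* The chain is [P + A <= P Q + L A - A B <= P Q - A B + L Q A], by [1 + B <= L] and
       [1 <= Q]. *)
    have L0 : 0 <= L by lra.
    have h1 : P * 1 <= P * Q by rewrite ler_wpM2l//; lra.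
    have h2 : A * (1 + B) <= A * L by rewrite ler_wpM2l.
    have h3 : L * A * 1 <= L * A * Q by rewrite ler_wpM2l// mulr_ge0.
    have h4 : 0 <= L * (P * B) by rewrite !mulr_ge0//; lra.
    lra.
rewrite ler_pdivrMr; last lra.
apply: le_trans step _.
have -> : \int[mu]_x Re (k x) = Re (left_slope mu a b) by [].
have -> : \int[mu]_x Im (k x) = Im (left_slope mu a b) by [].
have h1 := le_trans (ler_norm _) (cabs_Re (left_slope mu a b)).
have h2 : s * Im (left_slope mu a b) <= cabs (left_slope mu a b).
  by apply: le_trans (ler_norm _) _; rewrite normrM s1 mul1r cabs_Im.
have DL : 0 <= D * L by rewrite mulr_ge0//; lra.
have := ler_wpM2l (ltW D0) h1; have := ler_wpM2l DL h2.
lra.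
Qed.

End HalfLinePsi.

(** * The inverse [chi] on the left half-plane *)

Section LeftInverse.
Context {R : realType}.
Implicit Types (mu : probability R R) (a b z : R[i]) (M : R).

Lemma chi_in (mu : {measure set R -> \bar R}) (U : set R[i]) z :
  Sdom mu U z -> U (chi mu U z) /\ Psi mu (chi mu U z) = z.
Proof.
move=> zU; split; last by rewrite /chi pinvK// inE.
have surj : set_surj U (Sdom mu U) (Psi mu) by [].
have sub := surjpinv_image_sub surj.
by apply: sub; exists z.
Qed.

(** Equal images give imaginary parts of the same sign, and then the slope cannot vanish. *)
Lemma Psi_left_inj mu : bounded_support mu -> on_halfline mu ->
  (mu [set 0%R] < 1)%E -> forall a b, Re a < 0 -> Re b < 0 ->
  Psi mu a = Psi mu b -> a = b.
Proof.
move=> bs hm m0 a b ra rb ab; have [M mM] := bs.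
have [c1 c10 e1] := Im_Psi_left bs hm m0 ra.
have [c2 c20 e2] := Im_Psi_left bs hm m0 rb.
have Iab : 0 <= Im a * Im b.
  have h : Im a * Im b * (c1 * c2) =
      Im (Psi mu b) * Im (Psi mu b) by rewrite -{1}ab e1 e2; ring.
  by rewrite -(pmulr_lge0 _ (mulr_gt0 c10 c20)) h -expr2 sqr_ge0.
have [c c0 H] := left_slope_lower mM hm m0 rb.
have := H a ra Iab; have := Psi_left_sub bs hm ra rb.
rewrite ab subrr => /esym/eqP; rewrite mulf_eq0 subr_eq0 => /orP[/eqP//|/eqP->].
by rewrite cabs0 mulr0 leNgt c0.
Qed.

(** The lower bound on the slope degrades as [a] grows, so [|a|] is bounded by [|a - b| + |b|] and
    the resulting term in [|a - b|] is absorbed. *)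
Lemma Psi_left_inverse_continuous mu : bounded_support mu -> on_halfline mu ->
  (mu [set 0%R] < 1)%E -> forall b, Re b < 0 -> forall e : R, 0 < e ->
  exists2 d, 0 < d & forall a, Re a < 0 ->
    cabs (Psi mu a - Psi mu b) < d -> cabs (a - b) < e.
Proof.
move=> bs hm m0 b rb e e0; have [M mM] := bs; have M0 := supported_in_ge0 mM.
have [c2 c20 e2] := Im_Psi_left bs hm m0 rb.
have [c c0 H] := left_slope_lower mM hm m0 rb.
have cb := cabs_ge0 b.
have Mb : 0 <= M * cabs b by rewrite mulr_ge0.
(* Within this distance of [Psi b], the imaginary part of [Psi a] does not take the opposite sign;
   for real [b] there is nothing to ensure. *)
pose I := if Im b == 0 then 1 else `|Im (Psi mu b)|.
have I0 : 0 < I.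
  by rewrite /I; case: ifP => // /negbT h; rewrite normr_gt0 e2 mulf_neq0// gt_eqF.
(* With [s] the distance of the images and [X = |a - b|], the second bound gives [M X s <= c X / 2]
   and the third [(1 + M |b|) s < c e / 2]. *)
pose D := Num.min I (Num.min (c / (2 * (M + 1))) (c * e / (2 * (1 + M * cabs b)))).
have M1 : 0 < 2 * (M + 1) by lra.
have M2 : 0 < 2 * (1 + M * cabs b) by lra.
exists D; first by rewrite !lt_min I0 !divr_gt0// mulr_gt0.
move=> a ra; rewrite !lt_min => /and3P[h1 h2 h3].
have [c1 c10 e1] := Im_Psi_left bs hm m0 ra.
have Iab : 0 <= Im a * Im b.
  move: h1; rewrite /I; have [->|b0 h1] := eqVneq (Im b) 0.
    by rewrite mulr0.
  have h4 : `|Im (Psi mu a) - Im (Psi mu b)| < `|Im (Psi mu b)|.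
    apply: le_lt_trans h1; rewrite -ImN -ImD; exact: cabs_Im.
  have h5 : 0 <= Im (Psi mu a) * Im (Psi mu b).
    move: h4; have [p|p] := leP 0 (Im (Psi mu b)).
      by rewrite (ger0_norm p) ltr_norml => /andP[q _]; rewrite mulr_ge0//; lra.
    rewrite (ltr0_norm p) ltr_norml => /andP[_ q]; rewrite mulr_le0//; lra.
  have h : Im a * Im b * (c1 * c2) =
      Im (Psi mu a) * Im (Psi mu b) by rewrite e1 e2; ring.
  by rewrite -(pmulr_lge0 _ (mulr_gt0 c10 c20)) h.
have S := H a ra Iab.
set s := cabs (Psi mu a - Psi mu b) in h1 h2 h3.
have sE : s = cabs (a - b) * cabs (left_slope mu a b).
  by rewrite /s (Psi_left_sub bs hm ra rb) cabsM.
set X := cabs (a - b) in sE *.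
have X0 : 0 <= X by exact: cabs_ge0.
have s0 : 0 <= s by exact: cabs_ge0.
have k : c * X <= (1 + M * cabs a) * s.
  by rewrite sE mulrCA (mulrC c); exact: ler_wpM2l.
have ab : cabs a <= X + cabs b by have := cabs_triB a b; rewrite -/X; lra.
have k2 : c * X <= (1 + M * cabs b + M * X) * s.
  apply: le_trans k _; apply: ler_wpM2r => //.
  by have := ler_wpM2l M0 ab; lra.
move: h2; rewrite ltr_pdivlMr// => h2; move: h3; rewrite ltr_pdivlMr// => h3.
have k3 : M * s <= c / 2 by lra.
have k4 := ler_wpM2r X0 k3.
rewrite -(ltr_pM2l c0); lra.
Qed.

Lemma chi_left_small mu (d : R) : bounded_support mu -> on_halfline mu ->
  (mu [set 0%R] < 1)%E -> 0 < d ->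
  exists2 c, 0 < c & forall z, Sdom mu left_half z -> cabs z < c ->
    cabs (chi mu left_half z) < d.
Proof.
move=> bs hm m0 d0; have [c c0 H] := Psi_left_small bs hm m0 d0.
by exists c => // z /chi_in[zl zE] zc; apply: H => //; rewrite zE.
Qed.

Lemma chi_left_continuous mu : bounded_support mu -> on_halfline mu ->
  (mu [set 0%R] < 1)%E -> forall z, Sdom mu left_half z ->
  forall e : R, 0 < e -> exists2 d, 0 < d & forall z', Sdom mu left_half z' ->
    cabs (z - z') < d -> cabs (chi mu left_half z - chi mu left_half z') < e.
Proof.
move=> bs hm m0 z /chi_in[zl zE] e e0.
have [d d0 H] := Psi_left_inverse_continuous bs hm m0 zl e0.
exists d => // z' /chi_in[zl' zE']; rewrite cabsBC (cabsBC (chi _ _ _)) => h.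
by apply: H => //; rewrite zE zE'.
Qed.

Definition left_real_kernel (a x : R) := `|x| * a / (1 - `|x| * a).

Lemma left_real_slope M (a b x : R) : a <= 0 -> b <= 0 -> `|x| <= M ->
  `|left_real_kernel a x - left_real_kernel b x| <= M * `|a - b|.
Proof.
move=> a0 b0 xM; rewrite /left_real_kernel.
have pa (c : R) : c <= 0 -> 1 <= 1 - `|x| * c.
  move=> c0; have : `|x| * c <= 0 by rewrite mulr_ge0_le0.
  lra.
have nz (c : R) : c <= 0 -> 1 - `|x| * c != 0.
  by move=> /pa h; rewrite gt_eqF//; lra.
have -> : `|x| * a / (1 - `|x| * a) - `|x| * b / (1 - `|x| * b) =
  (`|x| / ((1 - `|x| * a) * (1 - `|x| * b))) * (a - b).
  by field; rewrite !nz.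
rewrite normrM ler_wpM2r// normrM normr_id -[leRHS]mulr1.
apply: ler_pM => //; rewrite ger0_norm; last first.
  by rewrite invr_ge0 mulr_ge0//; have := pa a a0; have := pa b b0; lra.
have pab : 1 <= (1 - `|x| * a) * (1 - `|x| * b).
  by rewrite -[leLHS]mulr1; apply: ler_pM => //; [exact: pa|exact: pa].
by rewrite invf_le1//; lra.
Qed.

(** Intermediate values on the negative axis: [Psi] tends to 0 at 0 and, by dominated convergence,
    to the mass at 0 minus 1 at minus infinity. *)
Lemma Psi_left_real_range mu : bounded_support mu -> on_halfline mu ->
  (mu [set 0%R] < 1)%E -> forall v : R, fine (mu [set 0%R]) - 1 < v < 0 ->
  exists2 a : R, a < 0 & Psi mu a%:C = v%:C.
Proof.
move=> [M mM] hm m0 v /andP[v1 v0]; have M0 := supported_in_ge0 mM.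
pose k := left_real_kernel.
pose f (a : R) := \int[mu]_x k a x.
have mk (a : R) : measurable_fun [set: R] (k a) by rewrite /k /left_real_kernel; rmeas.
have k0 x : k 0 x = 0 by rewrite /k /left_real_kernel mulr0 mul0r.
have kb (a x : R) : a <= 0 -> `|x| <= M -> `|k a x| <= M * `|a|.
  move=> a0 xM; have := left_real_slope a0 (lexx 0) xM.
  by rewrite -/(k a x) -/(k 0 x) k0 !subr0.
have PsiE (a : R) : a < 0 -> Psi mu a%:C = (f a)%:C.
  move=> a0; rewrite Psi_left// -cintegral_real; congr cintegral.
  by apply/funext => x; rewrite /left_kernel /k /left_real_kernel; rewrite !(rmorphM, fmorphV, rmorphB).
have flip (a b : R) : a <= 0 -> b <= 0 -> `|f a - f b| <= M * `|a - b|.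
  move=> a0 b0; rewrite /f -RintegralB//.
  - apply: (Rintegral_le_supp mM).
      by apply: measurable_funB.
    by move=> x xM; exact: left_real_slope.
  - by apply: (bounded_integrable mM (mk a)); exists (M * `|a|) => x; exact: kb.
  - by apply: (bounded_integrable mM (mk b)); exists (M * `|b|) => x; exact: kb.
have f0 : f 0 = 0.
  rewrite /f -[RHS](Rintegral_prob_cst mu 0); apply: eq_Rintegral => x _.
  exact: k0.
have fc (n : R) : {within `[- n, 0], continuous f}.
  apply/subspace_continuousP => a; rewrite /= in_itv/= => /andP[_ a0].
  apply/cvgrPdist_lt => e e0.
  have M1 : 0 < M + 1 by lra.
  rewrite near_withinE; apply/nbhs_ballP; exists (e / (M + 1)); first by rewrite /= divr_gt0.
  move=> b /=; rewrite /ball/= => ab; rewrite in_itv/= => /andP[_ b0].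
  apply: le_lt_trans (flip a b a0 b0) _.
  by move: ab; rewrite ltr_pdivlMr//; have := normr_ge0 (a - b); lra.
(* The kernel at [- n] is 0 for [x = 0] and tends to -1 elsewhere. *)
have cv : f (- n%:R) @[n --> \oo] --> \int[mu]_x (- \1_[set~ 0] x).
  apply: (@Rintegral_dct _ mu M (fun n => k (- n%:R)) _ 1 mM) => //.
  - by apply: measurable_funN; apply: measurable_indic; exact: measurableC.
  - move=> n x xM; have h : 0 <= `|x| * n%:R by rewrite mulr_ge0.
    rewrite /k /left_real_kernel mulrN opprK mulNr normrN ger0_norm; last by rewrite divr_ge0// addr_ge0.
    by rewrite ler_pdivrMr ?mul1r; lra.
  - move=> x xM; have [->|x0] := eqVneq x 0.
      rewrite indicE memNset/=; last by move=> /(_ erefl).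
      rewrite oppr0; apply: cvg_near_cst; apply: nearW => n.
      by rewrite /k /left_real_kernel normr0 !mul0r.
    have ax : 0 < `|x| by rewrite normr_gt0.
    rewrite indicE mem_set/=; last exact/eqP.
    apply/cvgrPdist_lt => e e0.
    near=> n.
    have nb : e^-1 / `|x| < n%:R.
      near: n; exists (Num.truncn (e^-1 / `|x|)).+1 => // n /= hn.
      apply: lt_le_trans (_ : _ < (Num.truncn (e^-1 / `|x|)).+1%:R) _.
        exact: truncnS_gt.
      by rewrite ler_nat.
    have h : e^-1 < n%:R * `|x| by rewrite -ltr_pdivrMr.
    have h0 : 0 < 1 + `|x| * n%:R by rewrite ltr_pwDl// mulr_ge0.
    rewrite /k /left_real_kernel mulrN opprK.
    have -> : - 1 - - (`|x| * n%:R) / (1 + `|x| * n%:R) = - (1 + `|x| * n%:R)^-1.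
      by field; rewrite gt_eqF.
    rewrite normrN gtr0_norm ?invr_gt0// -[ltRHS]invrK ltf_pV2 ?posrE ?invr_gt0//.
    by rewrite mulrC; lra.
have IE : \int[mu]_x (- \1_[set~ 0] x) = fine (mu [set 0%R]) - 1.
  have -> : \int[mu]_x (- \1_[set~ 0] x) = \int[mu]_x (\1_[set 0] x - 1).
    apply: eq_Rintegral => x _; rewrite !indicE.
    have [->|x0] := eqVneq x 0.
      rewrite memNset/=; last by move=> /(_ erefl).
      by rewrite mem_set//= subrr oppr0.
    rewrite mem_set/=; last exact/eqP.
    by rewrite memNset/= ?sub0r//; exact/eqP.
  rewrite RintegralB//.
  - rewrite Rintegral_prob_cst; congr (_ - _); rewrite /Rintegral.
    by rewrite integral_indic// setIT.
  - apply: integrable_all_bounded => //.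
    exists 1 => x; rewrite indicE; case: (_ \in _) => /=; rewrite ?normr1 ?normr0//.
  - by apply: integrable_all_bounded => //; exists `|1|.
rewrite IE in cv.
have [n fn] : exists n : nat, f (- n%:R) < v.
  have := cvgr_lt (fine (mu [set 0%R]) - 1) cv v v1.
  by move=> [n _ H]; exists n; apply: H => /=.
have n0 : - n%:R <= 0 :> R by rewrite oppr_le0.
have sd : Num.min (f (- n%:R)) (f 0) <= v <= Num.max (f (- n%:R)) (f 0).
  by rewrite f0 ge_min le_max (ltW fn) (ltW v0) orbT.
have [a aI fa] := @IVT _ f (- n%:R) 0 v n0 (fc n%:R) sd.
have a0 : a <= 0 by move: aI; rewrite in_itv/= => /andP[].
exists a; last first.
  rewrite PsiE ?fa// lt_neqAle a0 andbT; apply: contra_ltN v0 => /eqP aE.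
  by rewrite -fa aE f0.
by rewrite lt_neqAle a0 andbT; apply: contra_ltN v0 => /eqP aE; rewrite -fa aE f0.
Unshelve. all: by end_near.
Qed.

End LeftInverse.

(** * A law of bounded support is determined by its transform near infinity *)

Section Determinacy.
Context {R : realType}.
Implicit Types (mu nu : probability R R) (M a x : R) (p : {poly R}).

Lemma monomial_bound M x k : `|x| <= M -> `|x ^+ k| <= M ^+ k.
Proof.
move=> xM; rewrite normrX lerXn2r ?nnegrE//.
exact: le_trans xM.
Qed.

(** With [h k] the integral of [x^k / (z - x)] one has [z h k = m k + h (k + 1)], and [h (k + 1)]
    tends to 0 at infinity. So [h k] determines the moment [m k], then [h (k + 1)]. *)
Lemma eq_moments mu nu M r : supported_in mu M -> supported_in nu M ->
  (forall z, 0 < Im z -> r <= cabs z -> cauchyG mu z = cauchyG nu z) ->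
  forall k, \int[mu]_x (x ^+ k) = \int[nu]_x (x ^+ k).
Proof.
move=> mM nM E; have M0 := supported_in_ge0 mM.
pose h (rho : probability R R) k z := cintegral rho (fun x => (x ^+ k)%:C * (z - x%:C)^-1).
pose m (rho : probability R R) k := \int[rho]_x (x ^+ k).
have cm k : cmeasurable (fun x : R => (x ^+ k)%:C).
  by apply: cmeasurable_real; exact: measurable_funX.
have cmh k z : cmeasurable (fun x : R => (x ^+ k)%:C * (z - x%:C)^-1).
  by apply: cmeasurableM => //; cmeas.
have bnd k z : M < cabs z -> forall x, `|x| <= M ->
    cabs ((x ^+ k)%:C * (z - x%:C)^-1) <= M ^+ k * (cabs z - M)^-1.
  move=> zM x xM; rewrite cabsM cabsr; apply: ler_pM; rewrite ?cabs_ge0//.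
    exact: monomial_bound.
  by apply: separated_inv (@separated_cabs _ M z) _ xM; rewrite subr_gt0.
have rec (rho : probability R R) k z : supported_in rho M -> M < cabs z ->
    z * h rho k z = (m rho k)%:C + h rho k.+1 z.
  move=> rM zM; rewrite /h /m -cintegral_real -cintegralD; last 2 first.
  - apply: (cintegrable_supp rM) => //.
    by exists (M ^+ k) => x xM; rewrite cabsr monomial_bound.
  - apply: (cintegrable_supp rM) => //.
    by exists (M ^+ k.+1 * (cabs z - M)^-1); exact: bnd.
  rewrite -cintegralZ; last first.
    apply: (cintegrable_supp rM) => //.
    by exists (M ^+ k * (cabs z - M)^-1); exact: bnd.
  apply: (eq_cintegral_supp rM).
  - by apply: cmeasurableM => //; exact: cmeasurable_cst.
  - exact: cmeasurableD.
  move=> x xM; have d0 : 0 < cabs z - M by rewrite subr_gt0.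
  have z0 := separated_neq0 d0 (@separated_cabs _ M z) xM.
  by rewrite exprS rmorphM; field.
pose r1 := Num.max r (M + 1).
have P k : (forall z, 0 < Im z -> r1 <= cabs z -> h mu k z = h nu k z) ->
    m mu k = m nu k.
  move=> hk; apply/eqP; rewrite -subr_eq0; apply/eqP.
  have : (m mu k - m nu k)%:C = 0 :> R[i].
    apply: cabs_small => e e0.
    pose c := 4 * M ^+ k.+1.
    have c0 : 0 <= c by rewrite mulr_ge0// exprn_ge0.
    (* On the imaginary axis at height [y] the two remainders add up to at most
       [c / (y - M) < e]. *)
    pose y := r1 + M + c / e + 1.
    have r11 : M + 1 <= r1 by rewrite le_max lexx orbT.
    have ce : 0 <= c / e by rewrite divr_ge0// ltW.
    have y0 : 0 < y by rewrite /y; lra.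
    pose z : R[i] := 'i%C * y%:C.
    have Iz : Im z = y by rewrite /z ImM/= mul0r add0r mul1r.
    have cz : cabs z = y.
      by rewrite /z cabsM cabsr (gtr0_norm y0) cabsE/= expr0n/= add0r expr1n sqrtr1 mul1r.
    have zM : M < cabs z by rewrite cz /y; lra.
    have e1 := rec mu k z mM zM; have e2 := rec nu k z nM zM.
    have hz : h mu k z = h nu k z.
      by apply: hk; [rewrite Iz|rewrite cz /y; lra].
    have -> : (m mu k - m nu k)%:C = h nu k.+1 z - h mu k.+1 z.
      have q1 : (m mu k)%:C = z * h mu k z - h mu k.+1 z by rewrite e1 addrK.
      have q2 : (m nu k)%:C = z * h nu k z - h nu k.+1 z by rewrite e2 addrK.
      transitivity ((m mu k)%:C - (m nu k)%:C : R[i]); first exact: rmorphB.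
      by rewrite q1 q2 hz; ring.
    have b1 := cabs_cintegral_supp nM (cmh k.+1 z) (bnd k.+1 z zM).
    have b2 := cabs_cintegral_supp mM (cmh k.+1 z) (bnd k.+1 z zM).
    apply: le_lt_trans (cabsB _ _) _.
    apply: le_lt_trans (lerD b1 b2) _.
    have -> : 2 * (M ^+ k.+1 * (cabs z - M)^-1) + 2 * (M ^+ k.+1 * (cabs z - M)^-1)
       = c / (cabs z - M) by rewrite /c; ring.
    have yM : 0 < y - M by rewrite /y; lra.
    rewrite cz ltr_pdivrMr// mulrC -ltr_pdivrMr// /y; lra.
  by case.
suff H k : forall z, 0 < Im z -> r1 <= cabs z -> h mu k z = h nu k z.
  by move=> k; exact: P (H k).
elim: k => [|k ih] z z0 zr.
  have rz : r <= cabs z by apply: le_trans zr; rewrite le_max lexx.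
  have h0 rho : h rho 0%N z = cauchyG rho z.
    rewrite /h; congr cintegral; apply/funext => x.
    by rewrite expr0 (_ : 1%:C = 1)// mul1r.
  by rewrite !h0; exact: E.
have zM : M < cabs z.
  by apply: lt_le_trans zr; rewrite lt_max; apply/orP; right; lra.
have e1 := rec mu k z mM zM; have e2 := rec nu k z nM zM.
apply: (@addrI _ (m mu k)%:C); rewrite -e1 (P k ih) -e2 ih//.
Qed.

Lemma poly_bound_measurable M p : 0 <= M ->
  measurable_fun [set: R] (fun x => p.[x]) /\
  exists C, forall x, `|x| <= M -> `|p.[x]| <= C.
Proof.
move=> M0; elim/poly_ind: p => [|p c [mp [C HC]]].
  split; first by under eq_fun do rewrite horner0; exact: measurable_cst.
  by exists 0 => x _; rewrite horner0 normr0.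
split.
  under eq_fun do rewrite hornerMXaddC.
  by apply: measurable_funD => //; exact: measurable_funM.
exists (C * M + `|c|) => x xM; rewrite hornerMXaddC.
apply: le_trans (ler_normD _ _) _; rewrite lerD2r normrM.
by apply: ler_pM => //; exact: HC.
Qed.

Lemma eq_poly_integral mu nu M p : supported_in mu M -> supported_in nu M ->
  (forall k, \int[mu]_x (x ^+ k) = \int[nu]_x (x ^+ k)) ->
  \int[mu]_x p.[x] = \int[nu]_x p.[x].
Proof.
move=> mM nM E; have M0 := supported_in_ge0 mM.
(* The extra power absorbs the factor ['X] produced by the induction on polynomials. *)
suff H : forall k, \int[mu]_x (x ^+ k * p.[x]) = \int[nu]_x (x ^+ k * p.[x]).
  have := H 0%N; under eq_Rintegral do rewrite expr0 mul1r.
  by under [in RHS]eq_Rintegral do rewrite expr0 mul1r.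
elim/poly_ind: p => [|p c ih] k.
  under eq_Rintegral do rewrite horner0 mulr0.
  under [in RHS]eq_Rintegral do rewrite horner0 mulr0.
  by rewrite !Rintegral_prob_cst.
have [mp [C HC]] := poly_bound_measurable p M0.
have stepE (rho : probability R R) : supported_in rho M ->
    \int[rho]_x (x ^+ k * (p * 'X + c%:P).[x]) =
    1 * \int[rho]_x (x ^+ k.+1 * p.[x]) + c * \int[rho]_x (x ^+ k).
  move=> rM; rewrite -Rintegral_lin.
  - by apply: eq_Rintegral => x _; rewrite hornerMXaddC exprS; ring.
  - apply: (bounded_integrable rM).
      by apply: measurable_funM => //; exact: measurable_funX.
    exists (M ^+ k.+1 * C) => x xM; rewrite normrM.
    by apply: ler_pM => //; [exact: monomial_bound|exact: HC].
  - apply: (bounded_integrable rM); first exact: measurable_funX.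
    by exists (M ^+ k) => x; exact: monomial_bound.
by rewrite !stepE// ih E.
Qed.

Lemma bernoulli_ineq (u : R) n : -1 <= u -> 1 + n%:R * u <= (1 + u) ^+ n.
Proof.
move=> u1; elim: n => [|n ih]; first by rewrite mul0r addr0 expr0.
have u0 : 0 <= 1 + u by lra.
rewrite exprS; apply: le_trans (ler_wpM2l u0 ih).
have : 0 <= n%:R * u ^+ 2 :> R by rewrite mulr_ge0 ?sqr_ge0.
rewrite -natr1 expr2; lra.
Qed.

(* Approximation of the indicator of a half-line: [(1 - y^n)^(2^n)] tends to 1
   for [y < 1/2] and to 0 for [y > 1/2]; the second factor removes the point
   [y = 1/2]. *)
Definition ray_poly (a K : R) (n : nat) : {poly R} :=
  (1 - ((1 / 2)%:P + (2 * K)^-1 *: ('X - a%:P)) ^+ n) ^+ (2 ^ n)%N *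
  (1 - (1 - (K^-1 *: ('X - a%:P)) ^+ 2) ^+ n).

Lemma ray_polyE a K n x : (ray_poly a K n).[x] =
  (1 - (1 / 2 + (2 * K)^-1 * (x - a)) ^+ n) ^+ (2 ^ n)%N *
  (1 - (1 - (K^-1 * (x - a)) ^+ 2) ^+ n).
Proof. by rewrite /ray_poly !(hornerE, horner_exp). Qed.

Lemma expr_ge0_le1 (u : R) n : 0 <= u <= 1 -> 0 <= u ^+ n <= 1.
Proof. by move=> /andP[u0 u1]; rewrite exprn_ge0// exprn_ile1. Qed.

Lemma onem01 (u : R) : 0 <= u <= 1 -> 0 <= 1 - u <= 1.
Proof. by lra. Qed.

Lemma ray_poly_cvg M a x : let K := M + `|a| + 1 in 0 <= M -> `|x| <= M ->
  (forall n, `|(ray_poly a K n).[x]| <= 1) /\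
  (ray_poly a K n).[x] @[n --> \oo] --> (\1_(`]-oo, a[%classic) x : R).
Proof.
move=> K M0 xM; have K0 : 0 < K by rewrite /K; have := normr_ge0 a; lra.
pose d := K^-1 * (x - a).
(* [K] exceeds [|x - a|], which puts [y] between 0 and 1. *)
have d1 : `|d| < 1.
  rewrite /d normrM gtr0_norm ?invr_gt0// mulrC ltr_pdivrMr// mul1r.
  by apply: le_lt_trans (ler_normB _ _) _; rewrite /K; lra.
pose y := 1 / 2 + (2 * K)^-1 * (x - a).
have yE : y = 1 / 2 + d / 2 by rewrite /y /d; field; rewrite gt_eqF.
have y01 : 0 <= y <= 1 by rewrite yE; move: d1; rewrite ltr_norml; lra.
have d2 : 0 <= d ^+ 2 <= 1.
  rewrite sqr_ge0/= -real_normK ?num_real// -[leRHS](expr1n _ 2).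
  by rewrite lerXn2r ?nnegrE// ltW.
have pE n : (ray_poly a K n).[x] =
    (1 - y ^+ n) ^+ (2 ^ n)%N * (1 - (1 - d ^+ 2) ^+ n) by rewrite ray_polyE.
have A01 n : 0 <= (1 - y ^+ n) ^+ (2 ^ n)%N <= 1.
  exact/expr_ge0_le1/onem01/expr_ge0_le1.
have B01 n : 0 <= 1 - (1 - d ^+ 2) ^+ n <= 1.
  exact/onem01/expr_ge0_le1/onem01.
split.
  move=> n; rewrite pE; have /andP[a0 a1] := A01 n; have /andP[b0 b1] := B01 n.
  by rewrite ger0_norm ?mulr_ge0// -[leRHS]mulr1; apply: ler_pM.
rewrite (_ : (fun n => _) = (fun n => (1 - y ^+ n) ^+ (2 ^ n)%N *
    (1 - (1 - d ^+ 2) ^+ n))); last by apply/funext => n; rewrite pE.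
have dsign : d * K = x - a by rewrite /d mulrAC mulVf ?mul1r// gt_eqF.
have [xa|xa|xa] := ltgtP x a.
- rewrite indicE mem_set/=; last by rewrite in_itv.
  have dn : d < 0 by rewrite -(pmulr_llt0 _ K0) dsign subr_lt0.
  have c1 : (1 - d ^+ 2) ^+ n @[n --> \oo] --> (0 : R).
    apply: cvg_expr; have : 0 < d ^+ 2 by rewrite exprn_even_gt0//= lt_eqF.
    by rewrite ltr_norml; lra.
  have c2 : (2 * y) ^+ n @[n --> \oo] --> (0 : R).
    by apply: cvg_expr; rewrite ger0_norm; lra.
  (* By Bernoulli, [(1 - y^n)^(2^n) >= 1 - (2 y)^n], with [2 y < 1]. *)
  have c3 : (1 - y ^+ n) ^+ (2 ^ n)%N @[n --> \oo] --> (1 : R).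
    apply: (@squeeze_cvgr _ _ _ _ (fun n => 1 - (2 * y) ^+ n) (fun=> 1)).
    + apply: nearW => n; have /andP[_ ->] := A01 n; rewrite andbT.
      have := @bernoulli_ineq (- y ^+ n) (2 ^ n)%N.
      have /andP[h0 h1] := expr_ge0_le1 n y01.
      rewrite natrX exprMn mulrN; apply; lra.
    + by rewrite -[X in _ --> X]subr0; apply: cvgB => //; exact: cvg_cst.
    + exact: cvg_cst.
  rewrite (_ : 1%:R = 1 * (1 - 0)); last by rewrite subr0 mulr1.
  by apply: cvgM => //; apply: cvgB => //; exact: cvg_cst.
- rewrite indicE memNset/=; last by rewrite in_itv/= ltNge ltW.
  have dp : 0 < d by rewrite -(pmulr_lgt0 _ K0) dsign subr_gt0.
  have y2 : 1 < 2 * y by lra.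
  have y20 : 0 < 2 * y by lra.
  have c2 : (2 * y)^-1 ^+ n @[n --> \oo] --> (0 : R).
    apply: cvg_expr; rewrite gtr0_norm ?invr_gt0//.
    by rewrite invf_lt1.
  apply: (@squeeze_cvgr _ _ _ _ (fun=> 0) (fun n => (2 * y)^-1 ^+ n)) => //; last first.
    exact: cvg_cst.
  apply: nearW => n; have /andP[a0 a1] := A01 n; have /andP[b0 b1] := B01 n.
  rewrite mulr_ge0//=; apply: le_trans (_ : (1 - y ^+ n) ^+ (2 ^ n)%N * 1 <= _).
    by rewrite ler_wpM2l.
  rewrite mulr1; have /andP[h0 h1] := expr_ge0_le1 n y01.
  (* With [N = 2^n], [(1 - y^n)^N (1 + y^n)^N <= 1], and Bernoulli bounds the second factor below by
     [(2 y)^n]. *)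
  have hb := @bernoulli_ineq (y ^+ n) (2 ^ n)%N.
  rewrite natrX -exprMn in hb.
  have pn : 0 < (2 * y) ^+ n by rewrite exprn_gt0.
  have hb' : (2 * y) ^+ n <= (1 + y ^+ n) ^+ (2 ^ n)%N.
    by apply: le_trans (hb _); [rewrite lerDr|lra].
  have pq : 0 < (1 + y ^+ n) ^+ (2 ^ n)%N by rewrite exprn_gt0//; lra.
  apply: le_trans (_ : ((1 + y ^+ n) ^+ (2 ^ n)%N)^-1 <= _).
    rewrite -[leRHS]mul1r ler_pdivlMr// -exprMn exprn_ile1//.
      by rewrite mulr_ge0; lra.
    have -> : (1 - y ^+ n) * (1 + y ^+ n) = 1 - (y ^+ n) ^+ 2 by ring.
    by rewrite gerBl sqr_ge0.
  by rewrite exprVn lef_pV2 ?posrE.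
- rewrite indicE memNset/=; last by rewrite in_itv/= xa ltxx.
  have d0 : d = 0 by rewrite /d xa subrr mulr0.
  apply: cvg_near_cst; apply: nearW => n.
  by rewrite d0 expr0n/= subr0 expr1n subrr mulr0.
Qed.

Lemma eq_ray_measure mu nu M a : supported_in mu M -> supported_in nu M ->
  (forall k, \int[mu]_x (x ^+ k) = \int[nu]_x (x ^+ k)) ->
  mu `]-oo, a[%classic = nu `]-oo, a[%classic.
Proof.
move=> mM nM E; have M0 := supported_in_ge0 mM.
pose K := M + `|a| + 1.
have lim (rho : probability R R) : supported_in rho M ->
    \int[rho]_x (ray_poly a K n).[x] @[n --> \oo] -->
    fine (rho `]-oo, a[%classic).
  move=> rM.
  have -> : fine (rho `]-oo, a[%classic) = \int[rho]_x (\1_(`]-oo, a[%classic) x).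
    by rewrite /Rintegral integral_indic// setIT.
  apply: (Rintegral_dct (C := 1) rM).
  - by move=> n; have [] := poly_bound_measurable (ray_poly a K n) M0.
  - exact: measurable_indic.
  - by move=> n x xM; have [+ _] := ray_poly_cvg a M0 xM; apply.
  - by move=> x xM; have [_] := ray_poly_cvg a M0 xM.
have h1 := lim mu mM; have h2 := lim nu nM.
have e : (fun n => \int[mu]_x (ray_poly a K n).[x]) =
         (fun n => \int[nu]_x (ray_poly a K n).[x]).
  by apply/funext => n; exact: eq_poly_integral mM nM E.
rewrite e in h1.
have := cvg_unique _ h1 h2 => /(_ (@Rhausdorff R)) => h.
by rewrite -[LHS]fineK ?fin_num_measure// h// fineK ?fin_num_measure.
Qed.

Lemma measure_determined mu nu r : bounded_support mu -> bounded_support nu ->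
  (forall z, 0 < Im z -> r <= cabs z -> cauchyG mu z = cauchyG nu z) ->
  forall A, measurable A -> mu A = nu A.
Proof.
move=> bm bn E A mA; have [M [mM nM]] := common_support bm bn.
have Em := eq_moments mM nM E.
apply: (@measure_unique _ R _ (@RGenInftyO.G R) (fun n => `]-oo, n%:R[%classic)
  _ _ _ _ mu nu) => //.
- exact: RGenInftyO.measurableE.
- move=> _ _ [x ->] [y ->]; exists (Num.min x y); apply/seteqP; split => z /=;
    by rewrite !in_itv/= lt_min => /andP.
- by move=> n; exists n%:R.
- apply/seteqP; split => // x _; exists (Num.truncn `|x|).+1 => //=.
  by rewrite in_itv/= (le_lt_trans (ler_norm _))// truncnS_gt.
- by move=> _ [x ->]; exact: eq_ray_measure mM nM Em.
- by move=> n; rewrite (le_lt_trans (probability_le1 _ _))// ltry.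
Qed.

End Determinacy.

(** * Symmetric laws and their images under squaring *)

Section Squaring.
Context {R : realType}.
Implicit Types (mu nu : probability R R) (z : R[i]) (M : R).

(** Named so that it can carry the structure of measurable function that [distribution] expects. *)
Definition sqfun (x : R) : R := x ^+ 2.

Lemma measurable_sqfun : measurable_fun [set: R] sqfun.
Proof. exact: measurable_funX. Qed.

HB.instance Definition _ :=
  isMeasurableFun.Build _ _ _ _ sqfun measurable_sqfun.

Lemma measurable_oppfun : measurable_fun [set: R] (fun x : R => - x).
Proof. exact: measurable_funN. Qed.

Definition oppfun (x : R) : R := - x.

HB.instance Definition _ :=
  isMeasurableFun.Build _ _ _ _ oppfun measurable_oppfun.

Definition squared mu : probability R R := distribution mu sqfun.

Lemma eq_cintegral_measure (mu nu : {measure set R -> \bar R}) (k : R -> R[i]) :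
  (forall A, measurable A -> mu A = nu A) -> cintegral mu k = cintegral nu k.
Proof.
move=> E; apply: complex_eqP => /=; congr fine;
  by apply: eq_measure_integral => A mA _; exact: E.
Qed.

Lemma Rintegral_squared mu (f : R -> R) : measurable_fun [set: R] f ->
  mu.-integrable [set: R] (EFin \o (fun x => f (x ^+ 2))) ->
  \int[squared mu]_x f x = \int[mu]_x f (x ^+ 2).
Proof.
move=> mf intf; congr fine; rewrite (@integral_distribution _ _ _ _ _ mu sqfun (EFin \o f))//.
exact/measurable_EFinP.
Qed.

Lemma cintegral_squared mu (k : R -> R[i]) : cmeasurable k ->
  cintegrable mu (fun x => k (x ^+ 2)) ->
  cintegral (squared mu) k = cintegral mu (fun x => k (x ^+ 2)).
Proof.
move=> [m1 m2] [i1 i2]; apply: complex_eqP => /=.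
  exact: (Rintegral_squared m1 i1).
exact: (Rintegral_squared m2 i2).
Qed.

Lemma cintegral_opp mu (k : R -> R[i]) : symmetric_law mu -> cmeasurable k ->
  cintegrable mu (fun x => k (- x)) ->
  cintegral mu k = cintegral mu (fun x => k (- x)).
Proof.
move=> sym [m1 m2] [i1 i2].
rewrite (@eq_cintegral_measure mu (distribution mu oppfun)); last first.
  by move=> A mA; exact/esym/(sym A mA).
apply: complex_eqP => /=; congr fine.
  rewrite (@integral_distribution _ _ _ _ _ mu oppfun
    (EFin \o (fun x => Re (k x))))//; exact/measurable_EFinP.
rewrite (@integral_distribution _ _ _ _ _ mu oppfun
  (EFin \o (fun x => Im (k x))))//; exact/measurable_EFinP.
Qed.

Lemma squared_supported mu M : supported_in mu M -> supported_in (squared mu) (M ^+ 2).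
Proof.
move=> mM; have M0 := supported_in_ge0 mM.
apply: (subset_measure0 (mu := mu) _ _ _ mM).
- rewrite -[X in measurable X]setTI; apply: measurable_sqfun => //.
  exact: measurableC.
- exact: measurableC.
- move=> x; apply: contra_not => /in_supp xM; apply/in_supp.
  by rewrite /sqfun normrX lerXn2r ?nnegrE.
Qed.

Lemma squared_bounded mu : bounded_support mu -> bounded_support (squared mu).
Proof. by move=> [M mM]; exists (M ^+ 2); exact: squared_supported. Qed.

Lemma squared_halfline mu : on_halfline (squared mu).
Proof.
have e : sqfun @^-1` `]-oo, 0[%classic = set0.
  by apply/seteqP; split => // x /=; rewrite in_itv/= ltNge /sqfun sqr_ge0.
by rewrite /on_halfline -[LHS]/(mu (sqfun @^-1` `]-oo, 0%R[%classic)) e measure0.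
Qed.

Lemma squared_mass0 mu : squared mu [set 0%R] = mu [set 0%R].
Proof.
congr (mu _); apply/seteqP; split => x /=; rewrite /sqfun.
  by move=> /eqP; rewrite expf_eq0/= => /eqP.
by move=> ->; rewrite expr0n.
Qed.

(* The half-sum of a kernel and its reflection is even: this turns the
   transforms of a symmetric law into those of its image by squaring. *)
Lemma cintegral_even mu M (k l : R -> R[i]) : symmetric_law mu ->
  supported_in mu M -> cmeasurable k -> cmeasurable l ->
  (exists C, forall x, `|x| <= M -> cabs (k x) <= C) ->
  (forall x, `|x| <= M -> k x + k (- x) = 2 * l (x ^+ 2)) ->
  cintegral mu k = cintegral (squared mu) l.
Proof.
move=> sym mM mk ml [C kC] kl.
have mko : cmeasurable (fun x => k (- x)).
  have [m1 m2] := mk; split.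
    exact: (measurableT_comp m1 measurable_oppfun).
  exact: (measurableT_comp m2 measurable_oppfun).
have mlq : cmeasurable (fun x => l (x ^+ 2)).
  have [m1 m2] := ml; split.
    exact: (measurableT_comp m1 measurable_sqfun).
  exact: (measurableT_comp m2 measurable_sqfun).
have ik : cintegrable mu k by apply: (cintegrable_supp mM) => //; exists C.
have iko : cintegrable mu (fun x => k (- x)).
  by apply: (cintegrable_supp mM) => //; exists C => x xM; apply: kC; rewrite normrN.
have ilq : cintegrable mu (fun x => l (x ^+ 2)).
  apply: (cintegrable_supp mM) => //; exists (C + C) => x xM.
  have h : cabs (2 * l (x ^+ 2)) <= C + C.
    rewrite -kl//; apply: le_trans (cabsD _ _) _.
    by apply: lerD; apply: kC; rewrite ?normrN.
  rewrite cabsM (_ : cabs 2 = 2) in h; last by rewrite -(rmorph_nat (real_complex R)) cabsr ger0_norm.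
  by have := cabs_ge0 (l (x ^+ 2)); lra.
rewrite (cintegral_squared ml ilq).
have two : (2 : R[i]) != 0 by rewrite pnatr_eq0.
apply: (mulfI two); rewrite -[RHS]cintegralZ//.
transitivity (cintegral mu k + cintegral mu (fun x => k (- x))).
  by rewrite -(cintegral_opp sym mk iko); ring.
rewrite -cintegralD//; apply: (eq_cintegral_supp mM).
- exact: cmeasurableD.
- by apply: cmeasurableM => //; exact: cmeasurable_cst.
- exact: kl.
Qed.

(** The second identity is the derivative of the first, but is obtained by the same averaging of [x]
    and [- x]. *)
Lemma cauchy_squared mu z : bounded_support mu -> symmetric_law mu ->
  0 < Im z -> 0 < Im (z ^+ 2) ->
  cauchyG mu z = z * cauchyG (squared mu) (z ^+ 2) /\
  cauchy2 mu z = 2 * z ^+ 2 * cauchy2 (squared mu) (z ^+ 2) -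
    cauchyG (squared mu) (z ^+ 2).
Proof.
move=> [M mM] sym y0 y20; have sM := squared_supported mM.
have sepz := @separated_Im _ M z; have seps := @separated_Im _ (M ^+ 2) (z ^+ 2).
have i1 := cintegrable_kernel sM y20 seps.
have i2 := cintegrable_kernel2 sM y20 seps.
have nz x : `|x| <= M -> [/\ z - x%:C != 0, z + x%:C != 0 &
    z ^+ 2 - (x ^+ 2)%:C != 0].
  move=> xM; have h1 := separated_neq0 y0 sepz xM.
  have h2 : z + x%:C != 0.
    rewrite -[x%:C]opprK -rmorphN; apply: (separated_neq0 y0 sepz).
    by rewrite normrN.
  split => //; rewrite rmorphXn (_ : _ - _ = (z - x%:C) * (z + x%:C)); last by ring.
  exact: mulf_neq0.
have nzN x : (- x)%:C = - x%:C :> R[i] by rewrite rmorphN.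
split.
  rewrite -cintegralZ//; apply: (cintegral_even sym mM).
  - by cmeas.
  - by cmeas.
  - by exists (Im z)^-1; exact: separated_inv y0 sepz.
  - move=> x xM; have [h1 h2 h3] := nz x xM.
    rewrite nzN rmorphXn opprK in h3 *.
    by field; rewrite ?h1 ?h2 ?h3.
have i2' : cintegrable (squared mu) (fun x => 2 * z ^+ 2 * (z ^+ 2 - x%:C)^-1 ^+ 2).
  exact: cintegrableZ.
rewrite -cintegralZ// -cintegralB//; apply: (cintegral_even sym mM).
- by cmeas.
- by cmeas.
- exists ((Im z)^-1 ^+ 2) => x xM; rewrite cabsX.
  rewrite lerXn2r ?nnegrE ?cabs_ge0 ?invr_ge0 ?(ltW y0)//.
  exact: separated_inv y0 sepz _ xM.
- move=> x xM; have [h1 h2 h3] := nz x xM.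
  rewrite nzN rmorphXn opprK in h3 *.
  by field; rewrite ?h1 ?h2 ?h3.
Qed.

Lemma eps_time_derivative (f : R -> R[i]) (t : R) (l : R[i]) :
  (forall e : R, 0 < e -> exists2 d : R, 0 < d &
    forall h : R, `|h| < d -> 0 <= t + h ->
      cabs (f (t + h) - f t - h%:C * l) <= e * `|h|) ->
  is_time_derivative f t l.
Proof.
move=> H; apply/cvg_cabsP => e e0; have e2 : 0 < e / 2 by lra.
have [d d0 dH] := H _ e2.
rewrite near_withinE /dnbhs near_withinE; apply/nbhs_ballP; exists d => // h.
rewrite /ball/= sub0r normrN => hd h0 th.
have hC : h%:C != 0 :> R[i] by apply/eqP => -[] /eqP; rewrite (negbTE h0).
have -> : l - (h^-1)%:C * (f (t + h) - f t) =
    - (h%:C)^-1 * (f (t + h) - f t - h%:C * l) by rewrite fmorphV; field.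
rewrite cabsM cabsN cabsV cabsr mulrC ltr_pdivrMr ?normr_gt0//.
apply: le_lt_trans (dH h hd th) _; rewrite ltr_pM2r ?normr_gt0//; lra.
Qed.

Lemma eps_is_derive (f : R[i] -> R[i]) z (l : R[i]) :
  (forall e : R, 0 < e -> exists2 d : R, 0 < d &
    forall h : R[i], cabs h < d ->
      cabs (f (z + h) - f z - h * l) <= e * cabs h) ->
  is_derive z 1 f l.
Proof.
move=> H.
have cl : h^-1 *: ((f \o shift z) (h *: 1) - f z) @[h --> (0 : R[i])^'] --> l.
  apply/cvg_cabsP => e e0; have e2 : 0 < e / 2 by lra.
  have [d d0 dH] := H _ e2.
  apply: (@near_punctured _ 0 _ d d0) => h h0; rewrite sub0r cabsN => hd.
  have -> : l - h^-1 *: ((f \o shift z) (h *: 1) - f z) =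
      - h^-1 * (f (z + h) - f z - h * l).
    have -> : h^-1 *: ((f \o shift z) (h *: 1) - f z) = h^-1 * (f (z + h) - f z).
      by rewrite /= (_ : h *: 1 = h) ?[h + z]addrC//; exact: mulr1.
    by field.
  rewrite cabsM cabsN cabsV mulrC ltr_pdivrMr ?cabs_gt0//.
  by apply: le_lt_trans (dH h hd) _; rewrite ltr_pM2r ?cabs_gt0//; lra.
split; last exact: cvg_lim cl.
by apply/cvg_ex; exists l.
Qed.

Lemma cauchy_is_derive mu z : bounded_support mu -> 0 < Im z ->
  is_derive z 1 (cauchyG mu) (- cauchy2 mu z).
Proof.
move=> [M mM] y0; apply: eps_is_derive => e e0.
pose d := Im z / 2; have d0 : 0 < d by rewrite /d; lra.
pose c := 2 * d^-1 ^+ 3; have c0 : 0 < c by rewrite /c mulr_gt0// exprn_gt0 ?invr_gt0.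
exists (Num.min d (e / c)); first by rewrite lt_min d0 divr_gt0.
move=> h; rewrite lt_min => /andP[hd he].
have sz : separated M d z.
  by apply: separated_le (@separated_Im _ _ _); rewrite /d; lra.
have sw : separated M d (z + h).
  apply: separated_le (@separated_Im _ _ _); rewrite ImD.
  have := cabs_Im h; rewrite ler_norml => /andP[]; rewrite /d in hd *; lra.
have := cauchy_taylor mM d0 sz sw.
rewrite (_ : z + h - z = h); last by ring.
rewrite mulrN opprK => H; apply: le_trans H _.
rewrite mulrA -/c expr2 mulrA ler_wpM2r ?cabs_ge0//.
by rewrite mulrC -ler_pdivlMr// ltW.
Qed.

Lemma upper_sqrt (y : R[i]) : 0 < Im y ->
  exists2 z, 0 < Im z & z ^+ 2 = y.
Proof.
move=> y0; have sq := sqr_sqrtc y.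
have [p|p|p] := ltgtP (Im (sqrtc y)) 0.
- by exists (- sqrtc y); rewrite ?ImN ?oppr_gt0// sqrrN.
- by exists (sqrtc y).
- by move: y0; rewrite -sq expr2 ImM p mulr0 mul0r addr0 ltxx.
Qed.

(** A point [y] of the upper half-plane is [z^2] with [z] in the upper half-plane. There the
    transform of [wl] is [z] times that of the squared law at [y], and dividing the equation at [z]
    by [z] gives the equation at [y]. *)
Lemma squared_process (lam : R) (wl : R -> probability R R) :
  wl_process lam wl -> m_process lam (fun t => squared (wl t)).
Proof.
move=> [bs wc pde]; split.
- move=> t t0; have [b _] := bs t t0; split; first exact: squared_bounded.
  exact: squared_halfline.
- move=> f fc fb.
  have fq : continuous (fun x : R => f (x ^+ 2)).
    move=> x; apply: (@continuous_comp R R R (fun x : R => x ^+ 2) f x).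
      exact: exprn_continuous.
    exact: fc.
  have fqb : bounded_fun (fun x : R => f (x ^+ 2)).
    have [C [Cr HC]] := fb; exists C; split => // y Cy x _; exact: HC.
  have := wc _ fq fqb.
  rewrite (_ : (fun t => \int[squared (wl t)]_x f x) =
    (fun t => \int[wl t]_x f (x ^+ 2)))//.
  apply/funext => t; apply: Rintegral_squared.
    exact: continuous_measurable_fun.
  apply: integrable_all_bounded; first exact: continuous_measurable_fun.
  have [C [_ HC]] := fqb; exists (C + 1) => x; apply: (HC _ _ x I).
  by rewrite ltrDl.
- move=> t y t0 y0; have [z z0 zy] := upper_sqrt y0.
  have [b sym] := bs t t0.
  have [dt [dz [Hdt Hdz E]]] := pde t z t0 z0.
  have zn : z != 0 by apply: contraTneq z0 => ->; rewrite ltxx.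
  have y2 : 0 < Im (z ^+ 2) by rewrite zy.
  exists (dt / z), (- cauchy2 (squared (wl t)) y); split.
  + apply: eps_time_derivative => e e0.
    have ez : 0 < e * cabs z by rewrite mulr_gt0// cabs_gt0.
    have [d d0 dH] := time_derivativeP Hdt ez.
    exists d => // h hd th; have := dH h hd th.
    have [bh symh] := bs _ th.
    have [-> _] := cauchy_squared bh symh z0 y2.
    have [-> _] := cauchy_squared b sym z0 y2.
    rewrite zy => H.
    rewrite (_ : _ - _ - _ = (z * cauchyG (squared (wl (t + h))) y -
      z * cauchyG (squared (wl t)) y - h%:C * dt) / z); last by field.
    rewrite cabsM cabsV ler_pdivrMr ?cabs_gt0//.
    by rewrite mulrAC.
  + exact: cauchy_is_derive (squared_bounded b) y0.
  + have [M mM] := b; rewrite (cauchy_derive_val mM z0 Hdz) in E.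
    have [E1 E2] := cauchy_squared b sym z0 y2.
    move: E; rewrite E1 E2 -zy.
    set G := cauchyG _ _; set G2 := cauchy2 _ _ => E.
    apply: (mulfI zn); rewrite mulr0 -E; field.
    by rewrite zn.
Qed.

Lemma Hcone_Im z : Hcone z -> Im z != 0.
Proof. by move=> [h _]; rewrite lt_eqF. Qed.

Lemma Hcone_sqr z : Hcone z -> Re (z ^+ 2) < 0.
Proof.
move=> [h1]; rewrite expr2 ReM => h2.
have : `|Re z| ^+ 2 < `|Im z| ^+ 2 by rewrite ltrXn2r ?nnegrE.
rewrite !real_normK ?num_real// !expr2; lra.
Qed.

Lemma Hcone_sqrt y : Re y < 0 -> exists2 z : R[i], Hcone z & z ^+ 2 = y.
Proof.
move=> y0; have sq := sqr_sqrtc y.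
have cone z : z ^+ 2 = y -> `|Re z| < `|Im z|.
  move=> zy; move: y0; rewrite -zy expr2 ReM => h.
  rewrite -(ltr_pXn2r (n := 2)) ?nnegrE// !real_normK ?num_real// !expr2; lra.
have c := cone _ sq.
have [p|p|p] := ltgtP (Im (sqrtc y)) 0.
- by exists (sqrtc y) => //; split.
- exists (- sqrtc y); last by rewrite sqrrN.
  by split; rewrite ?ImN ?oppr_lt0// !ReN !normrN.
- by move: c; rewrite p normr0 ltNge normr_ge0.
Qed.

(** The kernels at [x] and [- x] add up to twice the kernel for [z^2] at [x^2]; no smallness of [z]
    is needed, as [z] is not real. *)
Lemma Psi_squared mu z : bounded_support mu -> symmetric_law mu ->
  Hcone z -> Psi mu z = Psi (squared mu) (z ^+ 2).
Proof.
move=> [M mM] sym hz; have y0 := Hcone_Im hz; have r2 := Hcone_sqr hz.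
have hm := squared_halfline mu.
have zn : z != 0 by apply: contra_neq y0 => ->.
have den (x : R) : cabs z * `|Im z^-1| <= cabs (1 - x%:C * z).
  have -> : 1 - x%:C * z = z * (z^-1 - x%:C) by field.
  rewrite cabsM ler_wpM2l ?cabs_ge0//; apply: le_trans (cabs_Im _).
  by rewrite ImD ImN/= subr0.
set c := cabs z * `|Im z^-1| in den.
have c0 : 0 < c.
  rewrite mulr_gt0 ?cabs_gt0// normr_gt0 ImV mulf_neq0 ?oppr_eq0//.
  by rewrite invr_eq0 expf_eq0/= cabs_eq0.
have dn (x : R) : 1 - x%:C * z != 0 by rewrite -cabs_gt0; exact: lt_le_trans (den x).
rewrite (Psi_left _ hm); apply: (cintegral_even sym mM).
- by cmeas.
- exact: cmeasurable_left.
- exists (M * cabs z * c^-1) => x xM; rewrite cabsM; apply: ler_pM; rewrite ?cabs_ge0//.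
    by rewrite cabsM cabsr ler_wpM2r ?cabs_ge0.
  by rewrite cabsV lef_pV2 ?posrE// cabs_gt0.
- move=> x xM; rewrite /left_kernel (ger0_norm (sqr_ge0 x)).
  have h1 := dn x; have h2 := dn (- x).
  have h3 := left_den_neq0 r2 (sqr_ge0 x).
  have e : (- x)%:C = - x%:C :> R[i] by rewrite rmorphN.
  rewrite e rmorphXn mulNr opprK in h2 h3 *.
  field; apply/and3P; split; [rewrite exprMn; exact: h3|exact: h2|exact: h1].
Qed.

End Squaring.

(** * Branches of the square roots in (i) *)

Section SymmetrizedTransform.
Context {R : realType}.
Implicit Types (mu : probability R R) (a b z : R[i]) (M x : R).

Lemma left_kernel_sqr a x : Re a < 0 ->
  - Re (left_kernel a x) = cabs (left_kernel a x) ^+ 2 +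
    `|x| * - Re a / cabs (1 - `|x|%:C * a) ^+ 2.
Proof.
move=> ra; have p0 := left_den_neq0 ra (normr_ge0 x).
have kE : left_kernel a x = (1 - `|x|%:C * a)^-1 - 1.
  by rewrite /left_kernel; field.
have c0 : cabs (1 - `|x|%:C * a) ^+ 2 != 0 by rewrite expf_neq0// cabs_eq0.
rewrite [in LHS]kE ReD ReN ReV/= /left_kernel cabsM cabsV exprMn exprVn.
apply: (mulIf c0); rewrite mulrDl !divfK// mulNr mulrBl divfK// mul1r opprB.
by rewrite !cabs_sqr !(ReD, ReN, RerM, ImD, ImN, ImrM)/=; ring.
Qed.

(* Integrating [|k - Psi a|^2 >= 0] bounds [|Psi a|^2] by the integral of
   [|k|^2], which is smaller than that of [- Re k]. *)
Lemma Psi_left_disk mu a : bounded_support mu -> on_halfline mu ->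
  (mu [set 0%R] < 1)%E -> Re a < 0 ->
  Re (Psi mu a) + cabs (Psi mu a) ^+ 2 < 0.
Proof.
move=> [M mM] hm m0 ra; have M0 := supported_in_ge0 mM.
set w := Psi mu a; set P := Re w; set Q := Im w.
pose k := left_kernel a.
pose f x := (-1 - 2 * P) * Re (k x) + (- (2 * Q)) * Im (k x) + (P ^+ 2 + Q ^+ 2) * 1.
have [mk1 mk2] := cmeasurable_left a; have [ik1 ik2] := cintegrable_left mM ra.
have fE x : f x = (Re (k x) - P) ^+ 2 + (Im (k x) - Q) ^+ 2 +
    `|x| * - Re a / cabs (1 - `|x|%:C * a) ^+ 2.
  have := left_kernel_sqr x ra; rewrite -/(k x) cabs_sqr /f.
  set q := _ / cabs _ ^+ 2; move=> h.
  have -> : q = - Re (k x) - (Re (k x) ^+ 2 + Im (k x) ^+ 2).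
    by rewrite h addrC addKr.
  ring.
have rest0 x : 0 <= `|x| * - Re a / cabs (1 - `|x|%:C * a) ^+ 2.
  by rewrite divr_ge0 ?sqr_ge0// mulr_ge0// oppr_ge0 ltW.
have kb x : `|x| <= M -> `|Re (k x)| <= M * cabs a /\
    `|Im (k x)| <= M * cabs a.
  move=> xM; have h := left_kernel_bound ra xM.
  by split; apply: le_trans h; [exact: cabs_Re|exact: cabs_Im].
have mf : measurable_fun [set: R] f.
  apply: measurable_funD; last exact: measurable_cst.
  by apply: measurable_funD; apply: measurable_funM => //; exact: measurable_cst.
have fpos : 0 < \int[mu]_x f x.
  apply: (Rintegral_halfline_gt0 (M := M) (C := `|-1 - 2 * P| * (M * cabs a) +
     `|- (2 * Q)| * (M * cabs a) + `|P ^+ 2 + Q ^+ 2|) mM hm m0 mf).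
  - move=> x /andP[x0 xM]; rewrite -(ger0_norm x0) in xM; have [k1 k2] := kb x xM.
    apply: le_trans (ler_normD _ _) _; rewrite mulr1 lerD2r.
    apply: le_trans (ler_normD _ _) _; rewrite !(normrM _ (Re _), normrM _ (Im _)).
    by apply: lerD; apply: ler_wpM2l.
  - by move=> x _; rewrite fE addr_ge0// addr_ge0 ?sqr_ge0.
  - move=> x x0; rewrite fE ltr_wpDl ?addr_ge0 ?sqr_ge0// divr_gt0//.
      by rewrite mulr_gt0 ?oppr_gt0// normr_gt0 gt_eqF.
    by rewrite exprn_gt0// cabs_gt0 left_den_neq0.
have i1 : mu.-integrable [set: R] (EFin \o (fun x => (1 : R))).
  by apply: integrable_all_bounded => //; exists 1 => x; rewrite normr1.
have i2 := integrable_lin (-1 - 2 * P) (- (2 * Q)) ik1 ik2.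
have e : \int[mu]_x f x = - P - (P ^+ 2 + Q ^+ 2).
  have -> : \int[mu]_x f x = 1 * \int[mu]_x ((-1 - 2 * P) * Re (k x) +
      (- (2 * Q)) * Im (k x)) + (P ^+ 2 + Q ^+ 2) * \int[mu]_x 1.
    rewrite -Rintegral_lin//; apply: eq_Rintegral => x _; by rewrite mul1r.
  rewrite Rintegral_lin// Rintegral_prob_cst.
  have -> : \int[mu]_x Re (k x) = P by rewrite /P /w Psi_left.
  have -> : \int[mu]_x Im (k x) = Q by rewrite /Q /w Psi_left.
  ring.
by move: fpos; rewrite e cabs_sqr -/P -/Q; lra.
Qed.

Lemma Re_div a b : Re (a / b) =
  (Re a * Re b + Im a * Im b) / cabs b ^+ 2.
Proof. by rewrite ReM ReV ImV; ring. Qed.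

(** The condition describes the open disk of diameter [-1, 0], the image of the left half-plane
    under [a / (1 - a)], whose inverse is [z / (1 + z)]. *)
Lemma disk_left z : Re z + cabs z ^+ 2 < 0 ->
  [/\ z != 0, 1 + z != 0 & Re (z / (1 + z)) < 0].
Proof.
move=> h; have z0 : z != 0.
  by apply: contraTneq h => ->; rewrite cabs0 expr0n/= addr0 ltxx.
have z1 : 1 + z != 0.
  apply: contraTneq h => /eqP; rewrite addrC addr_eq0 => /eqP ->.
  by rewrite cabsN cabs1 ReN/= expr1n addNr ltxx.
split => //; rewrite Re_div.
rewrite pmulr_llt0; last by rewrite invr_gt0 exprn_gt0// cabs_gt0.
by move: h; rewrite cabs_sqr ReD ImD/= !expr2; lra.
Qed.

(** Both arguments are within a quarter of [pi] of the same axis, so they differ by less than a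
    right angle. *)
Lemma Hcone_ratio a b : Hcone a -> Hcone b -> 0 < Re (a / b).
Proof.
move=> ha hb; have hbI := Hcone_Im hb; move: ha hb => [a1 a2] [b1 b2].
have b0 : b != 0 by apply: contra_neq hbI => ->.
rewrite Re_div.
rewrite pmulr_lgt0; last by rewrite invr_gt0 exprn_gt0// cabs_gt0.
have h : `|Re a * Re b| < Im a * Im b.
  rewrite normrM; apply: lt_le_trans (_ : `|Im a| * `|Im b| <= _).
    by apply: ltr_pM.
  by rewrite !ltr0_norm// mulrNN.
by move: h; rewrite ltr_norml => /andP[]; lra.
Qed.

Lemma Re_sqrtc_ge0 z : 0 <= Re (sqrtc z).
Proof. by case: z => c d; exact: sqrtr_ge0. Qed.

Lemma sqrtc_unique a z : a ^+ 2 = z -> 0 < Re a -> sqrtc z = a.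
Proof.
move=> az ra; have : sqrtc z ^+ 2 = a ^+ 2 by rewrite sqr_sqrtc.
move=> /eqP; rewrite eqf_sqr => /orP[/eqP//|/eqP e].
by have := Re_sqrtc_ge0 z; rewrite e ReN oppr_ge0 leNgt ra.
Qed.

(* The S-transform of a law on the half-line is a quotient of two numbers of
   the left half-plane, so that its principal square root is a quotient of two
   elements of [Hcone]. *)
Lemma Strans_left_sqrt mu z : bounded_support mu -> on_halfline mu ->
  (mu [set 0%R] < 1)%E -> Sdom mu left_half z ->
  [/\ z != 0, 1 + z != 0, 0 < Re (sqrtc (Strans mu left_half z)) &
    forall a b, Hcone a -> Hcone b -> a ^+ 2 = chi mu left_half z ->
      b ^+ 2 = z / (1 + z) -> sqrtc (Strans mu left_half z) = a / b].
Proof.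
move=> bs hm m0 /chi_in[zl zE].
have := Psi_left_disk bs hm m0 zl; rewrite zE => /disk_left[z0 z1 vz].
have uniq a b : Hcone a -> Hcone b -> a ^+ 2 = chi mu left_half z ->
    b ^+ 2 = z / (1 + z) -> sqrtc (Strans mu left_half z) = a / b.
  move=> ha hb a2 b2; apply: sqrtc_unique; last exact: Hcone_ratio.
  by rewrite exprMn exprVn a2 b2 /Strans; field; rewrite z0 z1.
have [a ha a2] := Hcone_sqrt zl; have [b hb b2] := Hcone_sqrt vz.
by split => //; rewrite (uniq a b)//; exact: Hcone_ratio.
Qed.

(** The principal root jumps across the negative axis, but here its values have positive real part:
    in [(s - s') (s + s') = s^2 - s'^2] the second factor has modulus at least [Re s]. *)
Lemma sqrtc_Strans_continuous mu : bounded_support mu -> on_halfline mu ->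
  (mu [set 0%R] < 1)%E -> {within Sdom mu left_half,
    continuous (fun z => sqrtc (Strans mu left_half z))}.
Proof.
move=> bs hm m0; apply: within_continuousP => z zD e e0.
have [z0 z1 rz _] := Strans_left_sqrt bs hm m0 zD.
set s := sqrtc _ in rz *; set r := Re s in rz.
have er : 0 < e * r by rewrite mulr_gt0.
pose g w : R[i] := (1 + w) / w.
have cg : {for z, continuous g} :=
  ctsM (ctsD (@cts_cst R z 1) (@cts_id R z)) (ctsV (@cts_id R z) z0).
pose c := chi mu left_half.
pose N := cabs (g z) + cabs (c z) + 1.
have [gz0 cz0] := (cabs_ge0 (g z), cabs_ge0 (c z)).
have N0 : 0 < N by rewrite /N; lra.
have e'0 : 0 < Num.min 1 (e * r / (2 * N)).
  by rewrite lt_min ltr01 divr_gt0// mulr_gt0.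
have [d1 d10 H1] := cts_eps cg e'0.
have [d2 d20 H2] := chi_left_continuous bs hm m0 zD e'0.
exists (Num.min d1 d2); first by rewrite lt_min d10 d20.
move=> w wD; rewrite lt_min => /andP[w1 w2].
have [_ _ rw _] := Strans_left_sqrt bs hm m0 wD.
have {}H1 := H1 w w1; have {}H2 := H2 w wD w2; rewrite -/(c z) -/(c w) in H2.
set s' := sqrtc _ in rw *.
have ss : (s - s') * (s + s') = g z * c z - g w * c w.
  have -> : (s - s') * (s + s') = s ^+ 2 - s' ^+ 2 by ring.
  by rewrite !sqr_sqrtc.
have sr : r <= cabs (s + s').
  by apply: le_trans (le_trans (ler_norm _) (cabs_Re _)); rewrite ReD /r; lra.
have gc : cabs (g z * c z - g w * c w) < e * r.
  have -> : g z * c z - g w * c w =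
    g z * (c z - c w) + (c z * (g z - g w) - (g z - g w) * (c z - c w)) by ring.
  apply: le_lt_trans (cabsD _ _) _.
  apply: le_lt_trans (lerD (lexx _) (cabsB _ _)) _.
  rewrite (cabsM (g z) (c z - c w)) (cabsM (c z)) (cabsM (g z - g w)).
  move: H1 H2; rewrite !lt_min => /andP[h1 h2] /andP[h3 h4].
  set e' := e * r / (2 * N) in h2 h4.
  have k1 := ler_wpM2l gz0 (ltW h4); have k2 := ler_wpM2l cz0 (ltW h2).
  have k3 : cabs (g z - g w) * cabs (c z - c w) <= 1 * e'.
    by apply: ler_pM; rewrite ?cabs_ge0 ?ltW.
  have : e' * N < e * r.
    have -> : e' * N = e * r / 2 by rewrite /e'; field; rewrite gt_eqF.
    lra.
  rewrite /N; lra.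
rewrite -(ltr_pM2r rz); apply: le_lt_trans gc; rewrite -ss cabsM.
by rewrite ler_wpM2l ?cabs_ge0.
Qed.

(** On this interval [chi] is real and negative, by [Psi_left_real_range] and injectivity, and so is
    [(1 + x) / x]. *)
Lemma sqrtc_Strans_gt0 mu x : bounded_support mu -> on_halfline mu ->
  (mu [set 0%R] < 1)%E -> fine (mu [set 0%R]) - 1 < x < 0 ->
  0 < sqrtc (Strans mu left_half x%:C).
Proof.
move=> bs hm m0 xm; have [a a0 ax] := Psi_left_real_range bs hm m0 xm.
have xD : Sdom mu left_half x%:C by exists a%:C.
have [cl cE] := chi_in xD.
have ca : chi mu left_half x%:C = a%:C.
  by apply: (Psi_left_inj bs hm m0) => //; rewrite cE ax.
have /andP[x1 x0] := xm.
have m00 : 0 <= fine (mu [set 0%R]) by exact: fine_ge0.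
have s0 : 0 < Strans mu left_half x%:C.
  rewrite /Strans ca (_ : (1 + x%:C) / x%:C * a%:C = ((1 + x) / x * a)%:C); last first.
    by rewrite rmorphM fmorph_div rmorphD rmorph1.
  by rewrite ltcR nmulr_lgt0// pmulr_rlt0 ?invr_lt0//; lra.
by rewrite lt_def sqrtc_eq0 gt_eqF//= sqrtc_ge0 ltW.
Qed.

Lemma integral_dmeas (f : R -> R) : measurable_fun [set: R] f ->
  \int[dmeas]_x f x = (f (-1) + f 1) / 2.
Proof.
have pos (g : R -> R) : measurable_fun [set: R] g -> (forall x, 0 <= g x) ->
    (\int[dmeas]_x (g x)%:E = ((g (-1) + g 1) / 2)%:E)%E.
  move=> mg g0; have mgE := (proj2 (measurable_EFinP _ _) mg).
  have g0E x : [set: R] x -> (0 <= (EFin \o g) x)%E by move=> _; rewrite lee_fin.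
  rewrite (ge0_integral_mscale (measure_add \d_(-1 : R) \d_(1 : R)) measurableT
    (2^-1)%:nng mgE g0E).
  rewrite (ge0_integral_measure_add \d_(-1 : R) \d_(1 : R) measurableT g0E mgE).
  rewrite !(integral_dirac _ measurableT mgE) !diracT !mul1e/= -EFinD -EFinM.
  by congr EFin; rewrite mulrC.
move=> mf; rewrite /Rintegral integralE.
have -> : funepos (fun x => (f x)%:E) = (fun x => (Num.max (f x) 0)%:E).
  by apply/funext => x; rewrite funeposE EFin_max.
have -> : funeneg (fun x => (f x)%:E) = (fun x => (Num.max (- f x) 0)%:E).
  by apply/funext => x; rewrite funenegE EFin_max.
rewrite !pos//=.
- have ms (u : R) : Num.max u 0 - Num.max (- u) 0 = u.
    by case: (leP u 0) => h; case: (leP (- u) 0) => h'; lra.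
  by have := ms (f (-1)); have := ms (f 1); lra.
- by apply: measurable_maxr => //; exact: measurable_funN.
- by move=> x; rewrite le_max lexx orbT.
- exact: measurable_maxr.
- by move=> x; rewrite le_max lexx orbT.
Qed.

Lemma Psi_dmeas z : Hcone z -> Psi dmeas z = z ^+ 2 / (1 - z ^+ 2).
Proof.
move=> hz; have y0 := Hcone_Im hz.
have [m1 m2] : cmeasurable (fun x : R => x%:C * z / (1 - x%:C * z)) by cmeas.
have n1 : 1 - z != 0.
  by apply: contra_neq y0 => /eqP; rewrite subr_eq0 => /eqP <-.
have n2 : 1 + z != 0.
  by apply: contra_neq y0 => /eqP; rewrite addrC addr_eq0 => /eqP ->; rewrite ImN/= oppr0.
have -> : z ^+ 2 / (1 - z ^+ 2) =
    2^-1%:C * ((- z) / (1 + z) + z / (1 - z)).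
  rewrite fmorphV rmorph_nat.
  have n3 : 1 - z ^+ 2 != 0.
    by rewrite (_ : 1 - z ^+ 2 = (1 - z) * (1 + z)) ?mulf_neq0//; ring.
  by field; rewrite n1 n2 n3.
apply: complex_eqP; rewrite /Psi /cintegral/=.
  rewrite integral_dmeas// RerM ReD rmorphN rmorph1 !mulN1r !mul1r opprK.
  by rewrite mulrC.
rewrite integral_dmeas// ImrM ImD rmorphN rmorph1 !mulN1r !mul1r opprK.
by rewrite mulrC.
Qed.

Lemma chi_dmeas z : Sdom dmeas Hcone z -> 1 + z != 0 ->
  Hcone (chi dmeas Hcone z) /\ chi dmeas Hcone z ^+ 2 = z / (1 + z).
Proof.
move=> /chi_in[hc]; rewrite Psi_dmeas//; set c := chi _ _ _ => cE z1.
split => //; have rc := Hcone_sqr hc.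
have n : 1 - c ^+ 2 != 0.
  by apply: contraTneq rc => /eqP; rewrite subr_eq0 => /eqP <-; rewrite /= ltr10.
by rewrite -cE; field; rewrite n subrK oner_neq0.
Qed.

End SymmetrizedTransform.

(** * Transport of the inverse [chi], and the identities (iii) and (iv) *)

Section Transport.
Context {R : realType}.
Implicit Types (w m wl : R -> probability R R) (mu : probability R R)
  (a b z : R[i]) (U : set R[i]).

Lemma halfline_mean_gt0 mu : bounded_support mu -> on_halfline mu ->
  (mu [set 0%R] < 1)%E -> 0 < \int[mu]_x x.
Proof.
move=> [M mM] hm m0; apply: (Rintegral_halfline_gt0 (C := M) mM hm m0) => //.
by move=> x /andP[x0 xM]; rewrite ger0_norm.
Qed.

(* When xi is the value at z' of the inverse of Psi at time 0, it is the point
   reached from a by the characteristic. *)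
Lemma m_transport (lam : R) m (t : R) : m_process lam m -> 0 <= t ->
  (m 0%R [set 0%R] < 1)%E ->
  exists2 r, 0 < r & forall a, cabs a < r ->
    let z := Psi (m t) a in let g := a * (1 + z) in
    let u := 1 - g * t%:C in let z' := z - g * t%:C * (z + lam%:C) in
    [/\ cabs g <= 3 * cabs a, 1 / 2 <= cabs u, cabs z <= 1 / 2 &
      forall xi, Re xi < 0 -> Psi (m 0) xi = z' ->
        xi * (1 + z') = g / u].
Proof.
move=> hm t0 m00; have [bs' _ _] := hm.
have [b0 h0] := bs' 0 (lexx 0); have [[M mM] _] := bs' t t0.
have M0 := supported_in_ge0 mM.
have mean : \int[m 0]_x x != 0 by rewrite gt_eqF// halfline_mean_gt0.
have [r1 r10 inj] := Psi_locally_injective b0 mean.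
have [c c0 small] := Psi_left_small b0 h0 m00 r10.
have [r2 r20 flow] := m_flow_Psi hm t0.
pose L := `|lam|; have L0 : 0 <= L by exact: normr_ge0.
have tL : 0 <= t * (1 + L) by rewrite mulr_ge0//; lra.
(* The three terms give in turn [|z| <= 1/2], [|z'| < c] so that [xi] is small, and [4 |a| < r1] so
   that [a / (u v)] is small. *)
pose K := (8 * M + 1) + (4 * M + 3 * (t * (1 + L))) / c + 4 / r1.
have K0 : 0 < K.
  have h1 : 0 < 4 / r1 by rewrite divr_gt0.
  have h2 : 0 <= (4 * M + 3 * (t * (1 + L))) / c by rewrite divr_ge0 ?(ltW c0)//; lra.
  by rewrite /K; lra.
exists (Num.min r2 K^-1); first by rewrite lt_min r20 invr_gt0.
move=> a; rewrite lt_min => /andP[ar2 aK] /=.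
have := flow a ar2; cbv zeta; set z := Psi (m t) a; set g := a * (1 + z).
set u := 1 - g * t%:C; set v := u + _; set z' := z - _ => -[gb ub vb E].
have a0 := cabs_ge0 a; have aK' := cabs_lt_inv K0 aK.
have k1 : 0 <= cabs a * ((4 * M + 3 * (t * (1 + L))) / c).
  by rewrite mulr_ge0// divr_ge0 ?(ltW c0)//; lra.
have k2 : 0 <= cabs a * (4 / r1) by rewrite mulr_ge0// divr_ge0// ltW.
have k3 : 0 <= cabs a * M by rewrite mulr_ge0.
rewrite /K in aK'.
have na : near0 M a by rewrite /near0; lra.
have zb : cabs z <= 4 * M * cabs a by exact: cabs_Psi.
have z1 : cabs z <= 1 / 2 by lra.
split => // xi rxi xiE.
have ac : (4 * M + 3 * (t * (1 + L))) * cabs a < c.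
  have : cabs a * ((4 * M + 3 * (t * (1 + L))) / c) < 1 by lra.
  by rewrite mulrA ltr_pdivrMr// mul1r mulrC.
have ar1 : 4 * cabs a < r1.
  have : cabs a * (4 / r1) < 1 by lra.
  by rewrite mulrA ltr_pdivrMr// mul1r mulrC.
have z'c : cabs z' < c.
  apply: le_lt_trans ac; apply: le_trans (cabsB _ _) _.
  rewrite (cabsM (g * _)) (cabsM g) cabsr (ger0_norm t0).
  have zl : cabs (z + lam%:C) <= 1 + L.
    by apply: le_trans (cabsD _ _) _; rewrite cabsr /L; lra.
  have h1 := ler_wpM2r t0 gb.
  have h2 : cabs g * t * cabs (z + lam%:C) <= 3 * cabs a * t * (1 + L).
    by apply: ler_pM; rewrite ?mulr_ge0 ?cabs_ge0.
  lra.
have xr : cabs xi < r1 by apply: small => //; rewrite xiE.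
have u0 : u != 0 by rewrite -cabs_gt0; lra.
have v0 : v != 0 by rewrite -cabs_gt0; lra.
have br : cabs (a / (u * v)) < r1.
  rewrite cabsM cabsV cabsM ltr_pdivrMr ?mulr_gt0 ?cabs_gt0//.
  have uv : 1 / 4 <= cabs u * cabs v.
    apply: le_trans (_ : _ <= 1 / 2 * (1 / 2)) _; first lra.
    by apply: ler_pM => //; lra.
  have := ler_wpM2l (ltW r10) uv; lra.
(* The transported point may leave the left half-plane, so injectivity is used on the ball of radius
   [r1]. Then [1 + z' = (1 + z) v] cancels the factor [v]. *)
have -> : xi = a / (u * v) by apply: inj => //; rewrite xiE E.
have zE : 1 + z' = (1 + z) * v.
  rewrite /z' /v /u; have lE : (1 - lam)%:C = 1 - lam%:C :> R[i] by rewrite rmorphB.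
  by rewrite lE /g; ring.
by rewrite zE /g; field; rewrite u0 v0.
Qed.

(** With [a = chi z] one has [S = g / z], hence [1 - q = u] and [z (1 - q') = z']: the identity is
    [m_transport] divided by [z']. *)
Lemma m_Strans (lam : R) m (t : R) : m_process lam m -> 0 <= t ->
  (m 0%R [set 0%R] < 1)%E -> (m t [set 0%R] < 1)%E ->
  \forall z \near (0 : R[i])^',
    let S := Strans (m t) left_half z in
    let q := S * inv_Sw0_sq t z in
    let q' := S * inv_Sm0 lam t z in
    Sdom (m t) left_half z -> Sdom (m 0) left_half (z * (1 - q')) ->
    S / ((1 - q) * (1 - q')) = Strans (m 0) left_half (z * (1 - q')).
Proof.
move=> hm t0 m00 mt0; have [bs _ _] := hm; have [bt ht] := bs t t0.
have [r r0 H] := m_transport hm t0 m00.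
have [c c0 small] := chi_left_small bt ht mt0 r0.
apply: (@near_punctured _ 0 _ c c0) => z z0; rewrite sub0r cabsN => zc.
set S := Strans (m t) left_half z; set q := S * inv_Sw0_sq t z.
set q' := S * inv_Sm0 lam t z => zD zD0; have [cl cE] := chi_in zD.
set a := chi (m t) left_half z in cl cE.
have ar : cabs a < r by exact: small.
have := H a ar; cbv zeta; rewrite cE; set g := a * (1 + z); set u := 1 - g * t%:C.
have SE : S = g / z by rewrite /S /Strans -/a /g; ring.
have z'E : z * (1 - q') = z - g * t%:C * (z + lam%:C).
  by rewrite /q' /inv_Sm0 SE; field.
have qE : 1 - q = u by rewrite /q /inv_Sw0_sq SE /u; field.
rewrite -z'E; set z' := z * (1 - q') in zD0 *.
move=> [_ ub _ Hxi]; have [xl xE] := chi_in zD0.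
have u0 : u != 0 by rewrite -cabs_gt0; lra.
have {}Hxi := Hxi _ xl xE.
(* When [z' = 0], also [1 - q' = 0], and both sides are 0 since [0^-1 = 0]. *)
have [z'0|z'0] := eqVneq z' 0.
  move/eqP: (z'0); rewrite /z' mulf_eq0 (negbTE z0)/= => /eqP q0.
  by rewrite /z' q0 !mulr0 invr0 mulr0 /Strans invr0 mulr0 mul0r.
have q'0 : 1 - q' != 0 by apply: contra_neq z'0 => h; rewrite /z' h mulr0.
rewrite /Strans (_ : (1 + z') / z' * _ = chi (m 0) left_half z' * (1 + z') / z');
  last by ring.
by rewrite Hxi qE SE /z'; field; rewrite u0 q'0 z0.
Qed.

(** Transport of the squared process controls only [x^2] and [y^2], for the values [x], [y] of [chi]
    at times [t] and 0. The root is therefore the explicit quotient that makes the identity hold;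
    [x] and [y] being both in [Hcone] selects the branch tending to 1. *)
Lemma wl_Strans (lam : R) wl (t : R) : wl_process lam wl ->
  (wl 0%R [set 0%R] < 1)%E -> 0 <= t -> (wl t [set 0%R] < 1)%E ->
  let S := Strans (wl t) Hcone in
  let q := fun z => S z ^+ 2 * inv_Sw0_sq t z in
  let q' := fun z => S z ^+ 2 * inv_Swl0_sq lam t z in
  let D := [set z | Sdom (wl t) Hcone z /\
                    Sdom (wl 0) Hcone (z * (1 - q' z))] in
  exists root : R[i] -> R[i],
    [/\ \forall z \near (0 : R[i])^', D z ->
          root z ^+ 2 = (1 - z / (1 + z) * q' z) / (1 - z / (1 + z) * q z),
        root z @[z --> within D 0^'] --> (1 : R[i]) &
        \forall z \near (0 : R[i])^', D z ->
          root z * (S z / (1 - q' z)) = Strans (wl 0) Hcone (z * (1 - q' z))].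
Proof.
move=> hwl m00 t0 mt0 S q q' D; have [bs _ _] := hwl.
have [bt symt] := bs t t0; have [b0 sym0] := bs 0 (lexx 0).
pose m s := squared (wl s).
have hm : m_process lam m by exact: squared_process.
have m00' : (m 0%R [set 0%R] < 1)%E by rewrite squared_mass0.
have mt0' : (m t [set 0%R] < 1)%E by rewrite squared_mass0.
have bmt := squared_bounded bt; have hmt := squared_halfline (wl t).
have [r r0 H] := m_transport hm t0 m00'.
pose x z := chi (wl t) Hcone z.
pose z' z := z * (1 - q' z).
pose y z := chi (wl 0) Hcone (z' z).
pose g z := x z ^+ 2 * (1 + z).
pose u z := 1 - g z * t%:C.
have [c c0 small] := Psi_left_small bmt hmt mt0' r0.
have core z : z != 0 -> cabs z < c -> D z ->
    [/\ Hcone (x z) /\ Hcone (y z), 1 + z != 0 /\ cabs z <= 1 / 2,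
      z' z = z - g z * t%:C * (z + lam%:C), cabs (g z) <= 3 * cabs (x z ^+ 2) &
      1 / 2 <= cabs (u z) /\ y z ^+ 2 * (1 + z' z) = g z / u z].
  move=> z0 zc [zD zD0]; have [xc xE] := chi_in zD; have [yc yE] := chi_in zD0.
  rewrite -/(x z) in xc xE; rewrite -/(y z) in yc yE.
  have x2 := Hcone_sqr xc; have y2 := Hcone_sqr yc.
  rewrite (Psi_squared bt symt xc) in xE; rewrite (Psi_squared b0 sym0 yc) in yE.
  have xr : cabs (x z ^+ 2) < r by apply: small => //; rewrite xE.
  have := H _ xr; cbv zeta; rewrite xE -/(g z) -/(u z) => -[gb ub zb Hxi].
  have z1 : 1 + z != 0.
    rewrite -[z]opprK; apply: (@neq0_1B _ (- z) (1 / 2)); first lra.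
    by rewrite cabsN.
  have z'E : z' z = z - g z * t%:C * (z + lam%:C).
    by rewrite /z' /q' /inv_Swl0_sq /S /Strans -/(x z) /g; field; rewrite z0 z1.
  by rewrite -z'E in Hxi; split => //; split => //; exact: Hxi.
pose root z := (1 + z' z) * y z / ((1 + z) * x z).
have sqr z : z != 0 -> cabs z < c -> D z -> root z ^+ 2 = (1 + z' z) / ((1 + z) * u z).
  move=> z0 zc Dz; have [[xc yc] [z1 _] _ _ [ub Y]] := core z z0 zc Dz.
  have x0 : x z != 0 by have := Hcone_Im xc; apply: contra_neq => ->.
  have u0 : u z != 0 by rewrite -cabs_gt0; lra.
  have -> : root z ^+ 2 = (1 + z' z) * (y z ^+ 2 * (1 + z' z)) / ((1 + z) * x z) ^+ 2.
    by rewrite /root; field; rewrite z1 x0.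
  by rewrite Y /g; field; rewrite x0 z1 u0.
exists root; split.
- apply: (@near_punctured _ 0 _ c c0) => z z0; rewrite sub0r cabsN => zc Dz.
  have [[xc yc] [z1 _] z'E _ [ub Y]] := core z z0 zc Dz.
  rewrite sqr//.
  have u0 : u z != 0 by rewrite -cabs_gt0; lra.
  have -> : 1 - z / (1 + z) * q' z = (1 + z' z) / (1 + z) by rewrite /z'; field.
  have -> : 1 - z / (1 + z) * q z = u z.
    by rewrite /q /inv_Sw0_sq /S /Strans -/(x z) /u /g; field; rewrite z0 z1.
  by field; rewrite z1 u0.
- apply/cvg_withinP => e e0.
  pose k := `|1 - lam|; pose L := `|lam|.
  have [k0 L0] : 0 <= k /\ 0 <= L by rewrite !normr_ge0.
  have tk : 0 <= t * k by rewrite mulr_ge0.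
  have tL : 0 <= t * (1 + L) by rewrite mulr_ge0//; lra.
  (* [12 t (1 + L)] gives [|cc - 1| <= 1/2] below, and the first term the final bound
     [24 X t k < e]. *)
  pose K := 24 * (t * k) / e + 12 * (t * (1 + L)) + 1.
  have K0 : 0 < K.
    have h : 0 <= 24 * (t * k) / e by rewrite divr_ge0 ?(ltW e0)//; lra.
    by rewrite /K; lra.
  have K1 : 0 < K^-1 by rewrite invr_gt0.
  have [c' c'0 small'] := Psi_left_small bmt hmt mt0' K1.
  exists (Num.min c c'); first by rewrite lt_min c0.
  move=> z z0 Dz; rewrite sub0r cabsN lt_min => /andP[zc zc'].
  have [[xc yc] [z1 zb] z'E gb [ub Y]] := core z z0 zc Dz.
  have u0 : u z != 0 by rewrite -cabs_gt0; lra.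
  have zb1 : 1 / 2 <= cabs (1 + z).
    have := @cabs_1B_ge _ (- z) (1 / 2); rewrite cabsN opprK => h; have := h zb; lra.
  have xK : cabs (x z ^+ 2) < K^-1.
    apply: small'; first exact: Hcone_sqr.
    by rewrite -(Psi_squared bt symt xc) (chi_in Dz.1).2.
  have xK' := cabs_lt_inv K0 xK; set X := cabs (x z ^+ 2) in gb xK xK'.
  have X0 : 0 <= X by exact: cabs_ge0.
  rewrite /K in xK'.
  have p1 : 0 <= X * (24 * (t * k) / e) by rewrite mulr_ge0// divr_ge0 ?(ltW e0)//; lra.
  have p2 : 0 <= X * (t * (1 + L)) by rewrite mulr_ge0.
  have gt : cabs (g z * t%:C) <= 3 * X * t.
    by rewrite cabsM cabsr (ger0_norm t0) ler_wpM2r.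
  pose cc := (1 + z' z) / (1 + z); pose rho := y z / x z.
  have x0 : x z != 0 by have := Hcone_Im xc; apply: contra_neq => ->.
  have rE : root z = cc * rho by rewrite /root /cc /rho; field; rewrite z1 x0.
  have c1 : cabs (cc - 1) <= 1 / 2.
    have -> : cc - 1 = - (g z * t%:C * (z + lam%:C)) / (1 + z).
      by rewrite /cc z'E; field.
    rewrite cabsM cabsN cabsV cabsM ler_pdivrMr ?cabs_gt0//.
    have zl : cabs (z + lam%:C) <= 1 + L.
      by apply: le_trans (cabsD _ _) _; rewrite cabsr /L; lra.
    have h : cabs (g z * t%:C) * cabs (z + lam%:C) <= 3 * X * t * (1 + L).
      by apply: ler_pM; rewrite ?cabs_ge0.
    lra.
  have Rrho : 0 < Re rho by exact: Hcone_ratio.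
  have rho1 : 1 <= cabs (rho + 1) /\ cabs rho <= cabs (rho + 1).
    split.
      apply: le_trans (le_trans (ler_norm _) (cabs_Re _)); rewrite ReD/=; lra.
    rewrite -(ler_pXn2r (n := 2)) ?nnegrE ?cabs_ge0// !cabs_sqr ReD ImD/=.
    rewrite addr0 sqrrD; lra.
  (* The square of the root is near 1, and the root must be kept away from -1. It is [cc rho] with
     [cc] within 1/2 of 1 and [Re rho > 0], so [rho + 1] outweighs the perturbation
     [(cc - 1) rho]. *)
  have root1 : 1 / 2 <= cabs (root z + 1).
    have -> : root z + 1 = (rho + 1) - (- ((cc - 1) * rho)) by rewrite rE; ring.
    have := cabs_triB (rho + 1) (- ((cc - 1) * rho)).
    rewrite cabsN cabsM; have [q1 q2] := rho1.
    have : cabs (cc - 1) * cabs rho <= 1 / 2 * cabs (rho + 1).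
      by apply: ler_pM; rewrite ?cabs_ge0.
    lra.
  have sq : cabs (root z ^+ 2 - 1) <= 12 * X * (t * k).
    rewrite sqr//.
    have -> : (1 + z' z) / ((1 + z) * u z) - 1 = g z * t%:C * (1 - lam)%:C / ((1 + z) * u z).
      rewrite z'E (_ : (1 - lam)%:C = 1 - lam%:C); last by rewrite rmorphB.
      apply: (mulIf (mulf_neq0 z1 u0)); rewrite mulrBl !divfK ?mulf_neq0// /u; ring.
    rewrite cabsM cabsV (cabsM (1 + z)) (cabsM (g z * _)) cabsr -/k.
    rewrite ler_pdivrMr ?mulr_gt0 ?cabs_gt0//.
    have h : cabs (g z * t%:C) * k <= 3 * X * t * k by rewrite ler_wpM2r.
    have h' : 1 / 2 * (1 / 2) <= cabs (1 + z) * cabs (u z) by apply: ler_pM => //; lra.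
    have p3 : 0 <= 12 * X * (t * k) by rewrite mulr_ge0// mulr_ge0.
    have := ler_wpM2l p3 h'; lra.
  have fin : cabs (1 - root z) * (1 / 2) <= 12 * X * (t * k).
    apply: le_trans sq.
    have -> : root z ^+ 2 - 1 = - ((1 - root z) * (root z + 1)) by ring.
    by rewrite cabsN cabsM ler_wpM2l ?cabs_ge0.
  have : X * (24 * (t * k) / e) < 1 by lra.
  rewrite mulrA ltr_pdivrMr// mul1r; lra.
- apply: (@near_punctured _ 0 _ c c0) => z z0; rewrite sub0r cabsN => zc Dz.
  have [[xc yc] [z1 _] z'E _ [ub Y]] := core z z0 zc Dz.
  rewrite -/(z' z).
  have [z'0|z'0] := eqVneq (z' z) 0.
    move/eqP: (z'0); rewrite /z' mulf_eq0 (negbTE z0)/= => /eqP q0.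
    by rewrite /z' q0 invr0 !mulr0 /Strans invr0 mulr0 mul0r.
  have q'0 : 1 - q' z != 0 by apply: contra_neq z'0 => h; rewrite /z' h mulr0.
  have x0 : x z != 0 by have := Hcone_Im xc; apply: contra_neq => ->.
  rewrite /root /S /Strans -/(y z) -/(x z) /z'.
  by field; rewrite z0 z1 x0 q'0.
Qed.

End Transport.

(** * Identity (i), and (iv) for [lam = 1] *)

Section Identification.
Context {R : realType}.
Implicit Types (w m wl : R -> probability R R) (U : set R[i]).

Lemma Psi_eq_measure (mu nu : {measure set R -> \bar R}) :
  (forall A, measurable A -> mu A = nu A) -> Psi mu = Psi nu.
Proof. by move=> E; apply/funext => z; exact: eq_cintegral_measure. Qed.

Lemma Strans_eq_measure (mu nu : {measure set R -> \bar R}) U :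
  (forall A, measurable A -> mu A = nu A) -> Strans mu U = Strans nu U.
Proof.
by move=> /Psi_eq_measure E; apply/funext => z; rewrite /Strans /chi E.
Qed.

Lemma symmetrization_process (lam : R) m wl (t : R) : m_process lam m ->
  wl_process lam wl -> is_symmetrization (m 0) (wl 0) -> 0 <= t ->
  forall A, measurable A -> squared (wl t) A = m t A.
Proof.
move=> hm hwl [_ _ sq] t0.
have hs := squared_process hwl.
have e0 A : measurable A -> squared (wl 0) A = m 0 A.
  move=> mA; rewrite -(sq A mA); congr (wl 0 _).
  by apply/seteqP; split => x /=; rewrite /sqfun real_normK ?num_real.
have [r _ E] := m_unique hs hm (fun z _ => eq_cintegral_measure _ e0) t0.
have [bs _ _] := hs; have [bs' _ _] := hm.
exact: (measure_determined (bs t t0).1 (bs' t t0).1 E).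
Qed.

(** The principal root serves. By injectivity on the left half-plane, [chi] for [wl t] squares to
    [chi] for [m t]; as it lies in [Hcone] together with [chi] for [dmeas], their quotient is the
    root with positive real part. *)
Lemma Strans_symmetrization (lam : R) m wl (t : R) : m_process lam m ->
  wl_process lam wl -> is_symmetrization (m 0) (wl 0) -> 0 <= t ->
  (m t [set 0%R] < 1)%E ->
  exists sqrtS : R[i] -> R[i],
    [/\ {within Sdom (m t) left_half, continuous sqrtS},
        forall z, Sdom (m t) left_half z ->
          sqrtS z ^+ 2 = Strans (m t) left_half z,
        forall x : R, fine (m t [set 0%R]) - 1 < x < 0 ->
          0 < sqrtS x%:C &
        forall z, Sdom (wl t) Hcone z -> Sdom (m t) left_half z ->
          Sdom dmeas Hcone z ->
          Strans (wl t) Hcone z = Strans dmeas Hcone z * sqrtS z].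
Proof.
move=> hm hwl sym t0 m0; have [bs _ _] := hm; have [bm hf] := bs t t0.
have [bs' _ _] := hwl; have [bw sw] := bs' t t0.
exists (fun z => sqrtc (Strans (m t) left_half z)); split.
- exact: sqrtc_Strans_continuous.
- by move=> z _; exact: sqr_sqrtc.
- by move=> x; exact: sqrtc_Strans_gt0.
move=> z zw zm zd; have [xc xE] := chi_in zw; have [yl yE] := chi_in zm.
have [z0 z1 _ ratio] := Strans_left_sqrt bm hf m0 zm.
have [dc dE] := chi_dmeas zd z1.
have x2 : chi (wl t) Hcone z ^+ 2 = chi (m t) left_half z.
  apply: (Psi_left_inj bm hf m0 (Hcone_sqr xc) yl).
  rewrite yE -(Psi_eq_measure (symmetrization_process hm hwl sym t0)).
  by rewrite -(Psi_squared bw sw xc).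
have d0 : chi dmeas Hcone z != 0 by have := Hcone_Im dc; apply: contra_neq => ->.
rewrite (ratio _ _ xc dc x2 dE) /Strans.
by field; rewrite z0 d0.
Qed.

Lemma wl1_w_process wl : wl_process 1 wl -> w_process wl.
Proof.
move=> [bs wc pde]; split => // [t t0|t z t0 z0]; first by have [] := bs t t0.
have [dt [dz [H1 H2 H3]]] := pde t z t0 z0; exists dt, dz; split => //.
by move: H3; rewrite subrr !mul0r subr0.
Qed.

Lemma wl1_eq_w w wl (t : R) : w_process w -> wl_process 1 wl ->
  (forall A, measurable A -> wl 0 A = w 0 A) -> 0 <= t ->
  forall A, measurable A -> wl t A = w t A.
Proof.
move=> hw /wl1_w_process hwl e0 t0.
have E := w_unique hwl hw (fun z _ => eq_cintegral_measure _ e0).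
have [bs _ _] := hwl; have [bs' _ _] := hw.
apply: (measure_determined (r := 0) (bs t t0) (bs' t t0)) => z z0 _.
exact: E.
Qed.

Lemma wl1_Strans w wl (t : R) : w_process w -> wl_process 1 wl ->
  (forall A, measurable A -> wl 0 A = w 0 A) -> 0 <= t ->
  (wl t [set 0%R] < 1)%E ->
  \forall z \near (0 : R[i])^', Sdom (wl t) Hcone z ->
    let S1 := Strans (wl t) Hcone z in
    let S := Strans (w t) Hcone z in
    let q1' := S1 ^+ 2 * inv_Swl0_sq 1 t z in
    let q1 := S1 ^+ 2 * inv_Sw0_sq t z in
    let q := S ^+ 2 * inv_Sw0_sq t z in
    [/\ (1 - z / (1 + z) * q1') / (1 - z / (1 + z) * q1) = 1,
        S1 / (1 - q1') = S / (1 - q) &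
        Strans (wl 0) Hcone (z * (1 - q1')) =
        Strans (w 0) Hcone (z * (1 - q))].
Proof.
move=> hw hwl e0 t0 m0; have [bs _ _] := hwl; have [bt sym] := bs t t0.
have m0' : (squared (wl t) [set 0%R] < 1)%E by rewrite squared_mass0.
have T0 : 0 < (4 * (t + 1))^-1 by rewrite invr_gt0; lra.
have [c c0 small] :=
  Psi_left_small (squared_bounded bt) (squared_halfline (wl t)) m0' T0.
apply: (@near_punctured _ 0 _ (Num.min c (1 / 2))).
  by rewrite lt_min c0; lra.
move=> z z0; rewrite sub0r cabsN lt_min => /andP[zc z2] zD.
cbv zeta; rewrite -(Strans_eq_measure _ (wl1_eq_w hw hwl e0 t0)).
rewrite -(Strans_eq_measure _ e0).
have z1 : 1 + z != 0.
  rewrite -[z]opprK; apply: (@neq0_1B _ (- z) (1 / 2)); first lra.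
  by rewrite cabsN ltW.
have -> : inv_Swl0_sq 1 t z = inv_Sw0_sq t z.
  by rewrite /inv_Swl0_sq /inv_Sw0_sq addrC mulfK.
(* Numerator and denominator coincide; the quotient is 1 provided that they do not vanish, which
   holds for small [z]. *)
split => //; apply: mulfV.
have [xc xE] := chi_in zD; set x := chi (wl t) Hcone z in xc xE.
have xs : cabs (x ^+ 2) < (4 * (t + 1))^-1.
  apply: small; first exact: Hcone_sqr.
  by rewrite -(Psi_squared bt sym xc) xE.
have T1 : 0 < 4 * (t + 1) by lra.
have xT := cabs_lt_inv T1 xs.
have -> : z / (1 + z) * (Strans (wl t) Hcone z ^+ 2 * inv_Sw0_sq t z) =
    x ^+ 2 * (1 + z) * t%:C.
  by rewrite /Strans -/x /inv_Sw0_sq; field; rewrite z0 z1.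
apply: (@neq0_1B _ _ (1 / 2)); first lra.
rewrite (cabsM _ t%:C) (cabsM _ (1 + z)) cabsr (ger0_norm t0).
have zz : cabs (1 + z) <= 2.
  by apply: le_trans (cabsD _ _) _; rewrite cabs1; lra.
have x0 := cabs_ge0 (x ^+ 2).
have p : cabs (x ^+ 2) * t * cabs (1 + z) <= cabs (x ^+ 2) * t * 2.
  by rewrite ler_wpM2l// mulr_ge0.
have p' : 0 <= cabs (x ^+ 2) * t by rewrite mulr_ge0.
lra.
Qed.

End Identification.

(** * Choice of the branch when the mean vanishes *)

Section Branches.
Context {R : realType}.
Implicit Types (w : R -> probability R R) (mu : probability R R)
  (a b p u y z : R[i]) (U : set R[i]) (k : R).

Lemma sector_Re_gt0 u k p : 0 < k -> sector u k p -> 0 < Re (p / u).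
Proof. by move=> k0 H; have := le_lt_trans (normr_ge0 _) H; rewrite pmulr_rgt0. Qed.

Lemma cabs_sector u k p : u != 0 -> 0 < k -> sector u k p ->
  cabs p <= (1 + k) * (cabs u * Re (p / u)).
Proof.
move=> u0 k0 ps; have r0 := sector_Re_gt0 k0 ps.
have H : `|Im (p / u)| < k * Re (p / u) by exact: ps.
have e : cabs p = cabs u * cabs (p / u) by rewrite -cabsM mulrC divfK.
rewrite e mulrCA ler_wpM2l ?cabs_ge0//.
by apply: le_trans (cabs_le _) _; rewrite ger0_norm ?(ltW r0)//; lra.
Qed.

(** A reverse triangle inequality: in a sector, moduli are comparable with the component along the
    axis, which is additive. Nearly opposite points cannot both belong to it. *)
Lemma cabs_sectorD u k p y : u != 0 -> 0 < k -> sector u k p -> sector u k y ->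
  cabs p + cabs y <= (1 + k) * cabs (p + y).
Proof.
move=> u0 k0 ps ys; have h1 := cabs_sector u0 k0 ps; have h2 := cabs_sector u0 k0 ys.
have h3 : cabs u * Re ((p + y) / u) <= cabs (p + y).
  have e : cabs (p + y) = cabs u * cabs ((p + y) / u).
    by rewrite -cabsM mulrC divfK.
  rewrite e ler_wpM2l ?cabs_ge0//.
  exact: le_trans (ler_norm _) (cabs_Re _).
have k1 : 0 <= 1 + k by lra.
have := ler_wpM2l k1 h3; rewrite (mulrDl p y u^-1) ReD; lra.
Qed.

(** [U] is open and reaches 0, so it contains two distinct points near 0, which injectivity gives
    distinct images. *)
Lemma S_well_defined_second_moment mu U : bounded_support mu ->
  S_well_defined mu U -> 0 < \int[mu]_x (x ^+ 2).
Proof.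
move=> [M mM] [oU cU injU _]; have M0 := supported_in_ge0 mM.
have K0 : 0 < (2 * (M + 1))^-1 by rewrite invr_gt0; lra.
have [p Up] := closure_cabsP cU K0; rewrite sub0r cabsN => pK.
have [e e0 eU] : exists2 e : R, 0 < e & forall y, cabs (p - y) < e -> U y.
  by apply/nbhs_cabsP; exact: open_nbhs_nbhs.
pose d := Num.min e ((2 * (M + 1))^-1 - cabs p) / 2.
have h1 : Num.min e ((2 * (M + 1))^-1 - cabs p) <= e by rewrite ge_min lexx.
have h2 : Num.min e ((2 * (M + 1))^-1 - cabs p) <= (2 * (M + 1))^-1 - cabs p.
  by rewrite ge_min lexx orbT.
have h3 : 0 < Num.min e ((2 * (M + 1))^-1 - cabs p) by rewrite lt_min e0/=; lra.
have d0 : 0 < d by rewrite /d; lra.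
have dp : cabs d%:C = d by rewrite cabsr gtr0_norm.
have Uy : U (p + d%:C).
  by apply: eU; rewrite opprD addNKr cabsN dp /d; lra.
apply: (second_moment_gt0 mM (near0_lt M0 pK) (b := p + d%:C)).
  by apply: near0_lt => //; apply: le_lt_trans (cabsD _ _) _; rewrite dp /d; lra.
apply/eqP => E; have := injU p (p + d%:C); rewrite !inE => /(_ Up Uy E).
move=> /(congr1 (fun c => cabs (p - c))).
by rewrite subrr cabs0 opprD addNKr cabsN dp => h; rewrite -h ltxx in d0.
Qed.

(* When the mean vanishes, the two preimages of a point near 0 are almost
   opposite, so that at most one of them is close to the sector. *)
Lemma branch_unique mu U U' (K : R) : bounded_support mu -> 0 <= K ->
  S_well_defined mu U -> same_branch mu U U' ->
  exists2 r, 0 < r & forall a b y, U' a -> U y -> cabs a < r -> cabs y < r ->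
    cabs (a - b) <= K * cabs a ^+ 2 -> Psi mu y = Psi mu b -> y = b.
Proof.
move=> bs K0 wd br.
(* The point [b] need not be in the sector; only its closeness to [a] at second order is known. *)
have close a b : cabs a * (1 + K) < 1 -> cabs (a - b) <= K * cabs a ^+ 2 ->
    cabs b <= 2 * cabs a.
  move=> aK ab; have := cabs_triB b a; rewrite cabsBC => tri.
  have a0 := cabs_ge0 a; have aK' : K * cabs a <= 1 by lra.
  by have := ler_wpM2r a0 aK'; lra.
have K1 : 0 < 1 + K by lra.
have [m0|m0] := eqVneq (\int[mu]_x x) 0; last first.
  have [r r0 inj] := Psi_locally_injective bs m0.
  exists (Num.min (r / 2) (1 + K)^-1); first by rewrite lt_min invr_gt0 K1 andbT; lra.
  move=> a b y _ _; rewrite !lt_min => /andP[ar aK] /andP[yr _] ab.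
  have := close a b (cabs_lt_inv K1 aK) ab => ba.
  by apply: inj; have := cabs_ge0 a; lra.
case: br => [|[u [k [u0 k0 Us Us']]]]; first by rewrite m0 eqxx.
have [C [r [C0 r0 two]]] :=
  Psi_locally_two_to_one bs m0 (S_well_defined_second_moment bs wd).
have L0 : 0 <= (1 + k) * (4 * C + K) by rewrite mulr_ge0; lra.
pose L := 1 + K + 2 * ((1 + k) * (4 * C + K)).
have L1 : 0 < L by rewrite /L; lra.
exists (Num.min (r / 2) L^-1); first by rewrite lt_min invr_gt0 L1 andbT; lra.
move=> a b y aU yU; rewrite !lt_min => /andP[ar aL] /andP[yr yL] ab E.
have a0 := cabs_ge0 a; have y0 := cabs_ge0 y.
have {}aL := cabs_lt_inv L1 aL; have {}yL := cabs_lt_inv L1 yL.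
have p1 : 0 <= cabs a * (1 + K) by rewrite mulr_ge0 ?(ltW K1).
have p2 := mulr_ge0 y0 (ltW K1); have p3 := mulr_ge0 a0 L0.
have p4 := mulr_ge0 y0 L0.
have ba : cabs b <= 2 * cabs a by apply: close => //; rewrite /L in aL; lra.
apply/eqP/negP => /negP yb.
have yb2 : cabs (y + b) <= C * (cabs y + cabs b) ^+ 2 by apply: two => //; lra.
pose N := cabs a + cabs y.
have as' := Us' _ aU; have ys := Us _ yU.
have ap : 0 < cabs a.
  rewrite cabs_gt0; apply: contraTneq (sector_Re_gt0 k0 as') => ->.
  by rewrite mul0r /= ltxx.
have N0 : 0 < N by rewrite /N; lra.
have NL : N * ((1 + k) * (4 * C + K)) < 1.
  rewrite /N; rewrite /L in aL yL; lra.
have b0 := cabs_ge0 b.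
have aN : cabs a <= N by rewrite /N; lra.
have q1 : C * (cabs y + cabs b) ^+ 2 <= C * (2 * N) ^+ 2.
  by rewrite ler_wpM2l// ler_pXn2r// ?nnegrE /N; lra.
have q2 : K * cabs a ^+ 2 <= K * N ^+ 2.
  by rewrite ler_wpM2l// ler_pXn2r// nnegrE ltW.
(* If [y] differed from [b] it would be nearly opposite to it, hence to [a], so [a + y] would be of
   second order; the sector makes it of first order. *)
have q3 : cabs (a + y) <= (4 * C + K) * N ^+ 2.
  have -> : a + y = (a - b) + (y + b) by ring.
  by apply: le_trans (cabsD _ _) _; lra.
have q4 := cabs_sectorD u0 k0 as' ys.
have k1 : 0 <= 1 + k by lra.
have q5 := ler_wpM2l k1 q3.
have := ltr_pM2r N0 (N * ((1 + k) * (4 * C + K))) 1; rewrite NL -/N in q4 *.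
rewrite mul1r; lra.
Qed.
End Branches.

(** * Identity (ii) *)

Section FreeBrownian.
Context {R : realType}.
Implicit Types (w : R -> probability R R) (U : set R[i]).

Lemma chi_small (mu : probability R R) U (e : R) : S_well_defined mu U -> 0 < e ->
  exists2 d : R, 0 < d & forall z, z != 0 -> Sdom mu U z -> cabs z < d ->
    cabs (chi mu U z) < e.
Proof.
move=> [_ _ _ /cvg_withinP cv] e0; have [d d0 H] := cv e e0.
exists d => // z z0 zD zd; have := H z z0 zD.
by rewrite !sub0r !cabsN => h; exact: h.
Qed.

(** The transported point [a / (1 - d)] need not lie in [U0] or [Ut], but it differs from [a] by a
    second-order term, and [branch_unique] identifies it with [chi] at time 0. *)
Lemma w_Strans w U0 Ut (t : R) : w_process w -> S_well_defined (w 0) U0 ->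
  0 <= t -> S_well_defined (w t) Ut -> same_branch (w 0) U0 Ut ->
  \forall z \near (0 : R[i])^',
    let S := Strans (w t) Ut z in
    let q := S ^+ 2 * inv_Sw0_sq t z in
    Sdom (w t) Ut z -> Sdom (w 0) U0 (z * (1 - q)) ->
    S / (1 - q) = Strans (w 0) U0 (z * (1 - q)).
Proof.
move=> hw wd0 t0 wdt br; have [bs _ _] := hw.
have [r1 r10 flow] := w_flow_Psi hw t0.
(* The constant in [|a - a / (1 - d)| <= 6 t |a|^2], from [|d| <= 3 t |a|^2], [|1 - d| >= 1/2] and
   [|a| <= 1]. *)
have K0 : 0 <= 6 * t by lra.
have [r2 r20 uniq_b] := branch_unique (bs 0 (lexx 0)) K0 wd0 br.
have [d1 d10 y_small] := chi_small wd0 r20.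
pose r := Num.min (Num.min r1 r2) (Num.min 1 (d1 / (2 * (1 + 9 * t)))).
have r0 : 0 < r.
  by rewrite /r !lt_min r10 r20 ltr01 divr_gt0// mulr_gt0//; lra.
have [d2 d20 a_small] := chi_small wdt r0.
apply: (@near_punctured _ 0 _ (Num.min d2 (d1 / 2))).
  by rewrite lt_min d20; lra.
move=> z z0; rewrite sub0r cabsN lt_min => /andP[zd2 zd1]; cbv zeta.
set S := Strans (w t) Ut z; set q := S ^+ 2 * inv_Sw0_sq t z => zD zD0.
have [aU aE] := chi_in zD; have := a_small z z0 zD zd2.
set a := chi (w t) Ut z in aU aE *.
rewrite /r !lt_min => /andP[/andP[ar1 ar2] /andP[a1 ad]].
have := flow a ar1; cbv zeta; rewrite aE; set g := a * (1 + z) => -[gb _ db E].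
have db' : cabs (t%:C * g * a) <= 3 * t * cabs a ^+ 2.
  by have := flow a ar1; cbv zeta; rewrite aE => -[].
have SE : S = g / z by rewrite /S /Strans -/a /g; ring.
have z'E : z * (1 - q) = z - t%:C * g ^+ 2.
  by rewrite /q /inv_Sw0_sq SE; field.
rewrite -z'E in E; set z' := z * (1 - q) in zD0 z'E E *.
have a0 := cabs_ge0 a; set d := t%:C * g * a in db db' E.
have half1 : 1 / 2 < 1 :> R by lra.
have dn0 := neq0_1B half1 db; have dh := cabs_1B_ge db.
(* Again [0^-1 = 0] makes both sides vanish. *)
have [z'0|z'0] := eqVneq z' 0.
  move/eqP: (z'0); rewrite /z' mulf_eq0 (negbTE z0)/= => /eqP q0.
  by rewrite /z' q0 invr0 !mulr0 /Strans invr0 mulr0 mul0r.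
have q1 : 1 - q != 0 by apply: contra_neq z'0 => h; rewrite /z' h mulr0.
have [yU yE] := chi_in zD0.
have z'd : cabs z' < d1.
  rewrite z'E; apply: le_lt_trans (cabsB _ _) _.
  rewrite cabsM cabsr (ger0_norm t0) cabsX.
  have h1 : cabs g ^+ 2 <= 9 * cabs a.
    apply: le_trans (_ : _ <= (3 * cabs a) ^+ 2) _.
      by rewrite ler_pXn2r// nnegrE ?cabs_ge0//; lra.
    have : cabs a * cabs a <= cabs a * 1 by rewrite ler_wpM2l// ltW.
    by lra.
  have h2 := ler_wpM2l t0 h1.
  have T0 : 0 < 2 * (1 + 9 * t) by lra.
  by move: ad; rewrite ltr_pdivlMr//; lra.
have ys := y_small z' z'0 zD0 z'd.
have ab : cabs (a - a / (1 - d)) <= 6 * t * cabs a ^+ 2.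
  have -> : a - a / (1 - d) = - (a * d) / (1 - d) by field.
  rewrite cabsM cabsN cabsV ler_pdivrMr ?cabs_gt0// cabsM.
  have h1 : cabs a * cabs d <= 1 * (3 * t * cabs a ^+ 2).
    by apply: ler_pM => //; rewrite ?cabs_ge0// ltW.
  have h2 : 0 <= 6 * t * cabs a ^+ 2 by rewrite mulr_ge0 ?exprn_ge0.
  have h3 : 1 / 2 <= cabs (1 - d) by lra.
  have := ler_wpM2l h2 h3; lra.
have yb := uniq_b a (a / (1 - d)) _ aU yU ar2 ys ab (etrans yE (esym E)).
rewrite /Strans yb SE.
have zE : 1 + z' = (1 + z) * (1 - d) by rewrite z'E /d /g; ring.
by rewrite zE /z' /g; field; rewrite z0 q1 dn0.
Qed.

End FreeBrownian.

Unset Implicit Arguments.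

Theorem theorem1p5 (R : realType) (lam : R) (w m wl : R -> probability R R)
    (lam_ge0 : 0 <= lam)
    (hw : w_process w) (hm : m_process lam m) (hwl : wl_process lam wl) :
  [/\ (* (i) *)
      is_symmetrization (m 0) (wl 0) ->
      forall t : R, 0 <= t ->
      (m t [set 0%R] < 1)%E -> (wl t [set 0%R] < 1)%E ->
      exists sqrtS : R[i] -> R[i],
        [/\ {within Sdom (m t) left_half, continuous sqrtS},
            forall z, Sdom (m t) left_half z ->
              sqrtS z ^+ 2 = Strans (m t) left_half z,
            forall x : R, fine (m t [set 0%R]) - 1 < x < 0 ->
              0 < sqrtS x%:C &
            forall z, Sdom (wl t) Hcone z -> Sdom (m t) left_half z ->
              Sdom dmeas Hcone z ->
              Strans (wl t) Hcone z = Strans dmeas Hcone z * sqrtS z],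
      (* (ii) *)
      forall U0 : set R[i], S_well_defined (w 0) U0 ->
      forall t : R, 0 <= t ->
      forall Ut : set R[i], S_well_defined (w t) Ut ->
      same_branch (w 0) U0 Ut ->
      \forall z \near (0 : R[i])^',
        let S := Strans (w t) Ut z in
        let q := S ^+ 2 * inv_Sw0_sq t z in
        Sdom (w t) Ut z -> Sdom (w 0) U0 (z * (1 - q)) ->
        S / (1 - q) = Strans (w 0) U0 (z * (1 - q)),
      (* (iii) *)
      (m 0%R [set 0%R] < 1)%E ->
      forall t : R, 0 <= t -> (m t [set 0%R] < 1)%E ->
      \forall z \near (0 : R[i])^',
        let S := Strans (m t) left_half z in
        let q := S * inv_Sw0_sq t z in
        let q' := S * inv_Sm0 lam t z in
        Sdom (m t) left_half z -> Sdom (m 0) left_half (z * (1 - q')) ->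
        S / ((1 - q) * (1 - q')) = Strans (m 0) left_half (z * (1 - q')),
      (* (iv) *)
      (wl 0%R [set 0%R] < 1)%E ->
      forall t : R, 0 <= t -> (wl t [set 0%R] < 1)%E ->
      let S := Strans (wl t) Hcone in
      let q := fun z => S z ^+ 2 * inv_Sw0_sq t z in
      let q' := fun z => S z ^+ 2 * inv_Swl0_sq lam t z in
      let D := [set z | Sdom (wl t) Hcone z /\
                        Sdom (wl 0) Hcone (z * (1 - q' z))] in
      exists root : R[i] -> R[i],
        [/\ \forall z \near (0 : R[i])^', D z ->
              root z ^+ 2 =
              (1 - z / (1 + z) * q' z) / (1 - z / (1 + z) * q z),
            root z @[z --> within D 0^'] --> (1 : R[i]) &
            \forall z \near (0 : R[i])^', D z ->
              root z * (S z / (1 - q' z)) =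
              Strans (wl 0) Hcone (z * (1 - q' z))] &
      (* (iv) at lam = 1 *)
      lam = 1 ->
      (forall A, measurable A -> wl 0 A = w 0 A) ->
      (forall (t : R) A, 0 <= t -> measurable A -> wl t A = w t A) /\
      ((wl 0%R [set 0%R] < 1)%E ->
       forall t : R, 0 <= t -> (wl t [set 0%R] < 1)%E ->
       \forall z \near (0 : R[i])^', Sdom (wl t) Hcone z ->
         let S1 := Strans (wl t) Hcone z in
         let S := Strans (w t) Hcone z in
         let q1' := S1 ^+ 2 * inv_Swl0_sq lam t z in
         let q1 := S1 ^+ 2 * inv_Sw0_sq t z in
         let q := S ^+ 2 * inv_Sw0_sq t z in
         [/\ (1 - z / (1 + z) * q1') / (1 - z / (1 + z) * q1) = 1,
             S1 / (1 - q1') = S / (1 - q) &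
             Strans (wl 0) Hcone (z * (1 - q1')) =
             Strans (w 0) Hcone (z * (1 - q))])].
Proof.
split.
- move=> sym t t0 mt0 _; exact: Strans_symmetrization hm hwl sym t0 mt0.
- move=> U0 wd0 t t0 Ut wdt br; exact: w_Strans hw wd0 t0 wdt br.
- move=> m0 t t0 mt0; exact: m_Strans hm t0 m0 mt0.
- move=> wl0 t t0 wlt0; exact: wl_Strans hwl wl0 t0 wlt0.
- move=> lam1 e0; move: hwl; rewrite lam1 => hwl1; split.
    by move=> t A t0; exact: wl1_eq_w hw hwl1 e0 t0 A.
  move=> _ t t0 wlt0; exact: wl1_Strans hw hwl1 e0 t0 wlt0.
Qed.
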